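(* Let $X$ be a pure-jump (driftless) subordinator with Lévy measure $\nu_X\ne0$. As $\epsilon\searrow0$ along $\epsilon\in(0,1)\cap\mathbb{Q}$, it holds for every $x>0$ that $\phi_{[X^{(\epsilon)}]}(x)\to\phi_{[X]}(x)$, where $$\phi_{[X^{(\epsilon)}]}(x)=\frac{\sum_{k=1}^\infty\upsilon_{\epsilon,k}}{\sum_{j=0}^\infty c_{\epsilon,j}e^{-\epsilon j}}\sum_{j=0}^\infty c_{\epsilon,j}\exp\Bigl(-e^{\epsilon j}x\sum_{k=1}^\infty\upsilon_{\epsilon,k}\Bigr),$$ with $\upsilon_{\epsilon,k}=\nu_X([\epsilon k,\epsilon(k+1)))$ and the coefficients $c_{\epsilon,j}$ determined by $$c_{\epsilon,0}=1,\qquad c_{\epsilon,j}=\frac{1}{(1-e^{\epsilon j})\sum_{k=1}^\infty\upsilon_{\epsilon,k}}\sum_{k=1}^je^{\epsilon k}c_{\epsilon,j-k}\,\upsilon_{\epsilon,k},\qquad j\in\{1,2,\dots\}.$$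
   Context: A subordinator is a Lévy process with nondecreasing paths started at $0$. Pure-jump means it has no drift, so $\mathsf{E}e^{-uX_t}=e^{-t\Psi(u)}$ with $\Psi(u)=\int_{(0,\infty)}(1-e^{-uz})\,\nu_X(dz)$, where $\int\min(z,1)\,\nu_X(dz)<\infty$. Write $X_t=\int_{(0,\infty)}z\,M([0,t],dz)$, where $M$ is a Poisson random measure on $\mathbb{R}_+\times(0,\infty)$ (with intensity $dt\otimes\nu_X(dz)$). For $\epsilon\in(0,1)\cap\mathbb{Q}$ define the compound Poisson process $X^{(\epsilon)}_t=\int_{[\epsilon,\infty)}\epsilon\lfloor z/\epsilon\rfloor\,M([0,t],dz)$, whose Lévy measure is $\sum_{k\ge1}\upsilon_{\epsilon,k}\delta_{\epsilon k}$. The exponential functionals are $I_{[X]}=\int_0^\infty e^{-X_t}\,dt$ and $I_{[X^{(\epsilon)}]}=\int_0^\infty e^{-X^{(\epsilon)}_t}\,dt$. Their probability density functions on $(0,\infty)$ (continuous versions) are denoted by $\phi_{[X]}$ and $\phi_{[X^{(\epsilon)}]}$. *)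

(* Defs.v *)
From mathcomp Require Import all_boot all_order all_algebra.
From mathcomp Require Import all_classical all_reals all_analysis.
From mathcomp Require Import measurable_realfun.

Set Implicit Arguments.
Unset Strict Implicit.
Unset Printing Implicit Defensive.

Import Order.TTheory GRing.Theory Num.Theory.
Import numFieldNormedType.Exports.

Local Open Scope ring_scope.
Local Open Scope classical_set_scope.

(* The product rule for a sub-family is the case [A i = setT] off it. *)
Definition mutually_independent (R : realType) (d d' : measure_display)
    (T : measurableType d) (E : measurableType d') (P : probability T R)
    (n : nat) (Y : 'I_n -> T -> E) : Prop :=
  forall A : 'I_n -> set E, (forall i, measurable (A i)) ->
    P (\bigcap_(i in [set: 'I_n]) (Y i @^-1` A i)) =
    (\prod_(i < n) P (Y i @^-1` A i))%E.

(* A Levy measure on (0,oo) is a measure on the line that does not charge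
   ]-oo,0]. *)
Definition subordinator_levy_measure (R : realType)
    (nu : {sigma_finite_measure set R -> \bar R}) : Prop :=
  nu `]-oo, 0] = 0%E /\
  (\int[nu]_(z in `]0%R, +oo[) (Num.min z 1)%:E < +oo)%E.

(* Processes are indexed by R; only the times t >= 0 are meaningful.
   Left limits exist by monotonicity. *)
Definition subordinator (R : realType) (d : measure_display)
    (T : measurableType d) (P : probability T R)
    (X : R -> {RV P >-> R}) : Prop :=
  [/\ forall w, X 0 w = 0,
      forall w (s t : R), 0 <= s -> s <= t -> X s w <= X t w,
      forall w (t : R), 0 <= t -> X s w @[s --> t^'+] --> X t w,
      forall (n : nat) (s : nat -> R), 0 <= s 0%N ->
        {homo s : i j / (i <= j)%N >-> i <= j} ->
        mutually_independent P
          (fun (i : 'I_n) w => X (s i.+1) w - X (s i) w)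
    & forall s h : R, 0 <= s -> 0 <= h ->
        forall A : set R, measurable A ->
          P ((fun w => X (s + h) w - X s w) @^-1` A) = P (X h @^-1` A)].

Definition driftless_exponent (R : realType)
    (nu : {sigma_finite_measure set R -> \bar R}) (u : R) : R :=
  \int[nu]_(z in `]0, +oo[) (1 - expR (- (u * z))).

Definition pure_jump_subordinator (R : realType) (d : measure_display)
    (T : measurableType d) (P : probability T R)
    (X : R -> {RV P >-> R})
    (nu : {sigma_finite_measure set R -> \bar R}) : Prop :=
  [/\ subordinator X,
      subordinator_levy_measure nu
    & forall u t : R, 0 <= u -> 0 <= t ->
        (\int[P]_w (expR (- (u * X t w)))%:E =
         (expR (- (t * driftless_exponent nu u)))%:E)%E].

(* dt (x) nu(dz) on [0,oo) x (0,oo), seen as a set function on R x R. *)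
Definition jump_intensity (R : realType)
    (nu : {sigma_finite_measure set R -> \bar R}) (B : set (R * R)) : \bar R :=
  (@lebesgue_measure R \x nu)%E (B `&` (`[0, +oo[ `*` `]0, +oo[)).

(* A random measure is a kernel from the sample space. The Poisson weights are
   written out because the library's [poisson_pmf 0 k] is 1 for every k. *)
Definition poisson_random_measure (R : realType) (d d' : measure_display)
    (T : measurableType d) (E : measurableType d') (P : probability T R)
    (M : R.-ker T ~> E) (mu : set E -> \bar R) : Prop :=
  [/\ forall B, measurable B -> (mu B < +oo)%E -> forall k : nat,
        P [set w | M w B = k%:R%:E] =
        ((fine (mu B)) ^+ k / k`!%:R * expR (- fine (mu B)))%:E,
      forall B, measurable B -> mu B = +oo%E -> P [set w | M w B = +oo%E] = 1%E
    & forall (n : nat) (B : 'I_n -> set E), (forall i, measurable (B i)) ->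
        trivIset setT B ->
        mutually_independent P (fun (i : 'I_n) w => M w (B i))].

(* int_D g(z) M([0,t],dz) *)
Definition jump_integral (R : realType) (d : measure_display)
    (T : measurableType d) (M : R.-ker T ~> (R * R)%type) (D : set R)
    (g : R -> R) (t : R) (w : T) : \bar R :=
  (\int[M w]_(p in `[0%R, t] `*` D) (g p.2)%:E)%E.

Definition discretized_process (R : realType) (d : measure_display)
    (T : measurableType d) (M : R.-ker T ~> (R * R)%type) (e : R) :
    R -> T -> \bar R :=
  jump_integral M `[e, +oo[ (fun z => e * (Num.floor (z / e))%:~R).

Definition exp_functional (R : realType) (T : Type) (Z : R -> T -> \bar R)
    (w : T) : \bar R :=
  (\int[@lebesgue_measure R]_(t in `[0%R, +oo[) expeR (- Z t w))%E.

(* [f] is a continuous density on (0,oo) of the law of [Y]; its values on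
   ]-oo,0] are irrelevant. Taking [B = setT] shows that [f] has total mass 1,
   hence that [Y] is a.s. finite and positive. *)
Definition continuous_pdf (R : realType) (d : measure_display)
    (T : measurableType d) (P : probability T R) (Y : T -> \bar R)
    (f : R -> R) : Prop :=
  [/\ measurable_fun setT Y,
      forall x : R, 0 < x -> {for x, continuous f},
      forall x : R, 0 < x -> 0 <= f x
    & forall B : set (\bar R), measurable B ->
        P (Y @^-1` B) =
        (\int[@lebesgue_measure R]_(x in `]0%R, +oo[ `&` EFin @^-1` B)
            (f x)%:E)%E].

Definition rational01 (R : realType) : set R := `]0, 1[ `&` range (@ratr R).

Section explicit_density.
Variables (R : realType) (nu : {sigma_finite_measure set R -> \bar R}) (e : R).

Definition upsilon (k : nat) : R := fine (nu `[e * k%:R, e * k.+1%:R[).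

Definition upsilon_sum : R :=
  fine (\sum_(1 <= k <oo) nu `[(e * k%:R)%R, (e * k.+1%:R)%R[)%E.

Definition density_coefficients (c : nat -> R) : Prop :=
  c 0%N = 1 /\
  forall j : nat, (0 < j)%N ->
    c j = ((1 - expR (e * j%:R)) * upsilon_sum)^-1 *
          \sum_(1 <= k < j.+1) expR (e * k%:R) * c (j - k)%N * upsilon k.

Definition norm_term (c : nat -> R) (j : nat) : R :=
  c j * expR (- (e * j%:R)).

Definition density_term (c : nat -> R) (x : R) (j : nat) : R :=
  c j * expR (- (expR (e * j%:R) * x * upsilon_sum)).

Definition density_formula (c : nat -> R) (x : R) : R :=
  upsilon_sum / limn (series (norm_term c)) * limn (series (density_term c x)).

End explicit_density.

(* Main.v *)
Require Import Defs.
From HB Require Import structures.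
From mathcomp Require Import all_boot all_order all_algebra.
From mathcomp Require Import all_classical all_reals all_analysis.
From mathcomp Require Import measurable_realfun.
From mathcomp Require Import ring lra.

Set Implicit Arguments.
Unset Strict Implicit.
Unset Printing Implicit Defensive.

Import Order.TTheory GRing.Theory Num.Theory.
Import numFieldNormedType.Exports.

Local Open Scope ring_scope.
Local Open Scope classical_set_scope.

(** Let I be the integral of exp(-X_t) over the half line, I_e the same integral for the
    discretized process of mesh e, and F, F_e their distribution functions.

    For a fixed mesh the discretized process is compound Poisson, of rate
    lam = nu [e, +oo[. Splitting at the first jump before a small time h, and using that
    the process after h is independent of the past and distributed as the original one
    ([prob_shift]), gives inequalities for the increments of F_e that are exact to first
    order in h ([cdf_step]). They show that F_e is differentiable, with
    F_e' x = int (F_e (x exp (q z)) - F_e x) nu(dz), where q rounds z down to a multiple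
    of e ([mesh_density_is_derive]). The recursion of the coefficients c_j says precisely
    that the series H x = sum_j c_j exp(-e j) exp(-exp(e j) lam x) solves the equation
    satisfied by 1 - F_e ([wave_sum_rates]), and it forces c_j exp(-e j) to decay
    geometrically ([nt_geometric]), so that H converges, together with its derivative. A
    maximum principle ([ode_unique]) identifies H with a multiple of 1 - F_e, and the
    derivative of this identity is the explicit density ([mesh_density_formula]).

    As the mesh tends to 0, the integrals I_e, which are at least I, converge to I almost
    surely ([cvg_expint]). This only gives convergence in law; to reach the densities one
    needs a bound on F_e' that does not depend on e. Small jumps may make the rate lam blow up,
    but the integral formula for F_e' is self-improving: the increments of F_e are controlled by
    the supremum of F_e', and small jumps bring back at most half of this supremum, because
    exp z - 1 has a small nu-integral near 0 ([mesh_density_uniform]). The functions F_e are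
    thus Lipschitz on bounded sets, uniformly in e; hence F_e converges to F pointwise
    ([mesh_cdf_cvg]), the integrands F_e (x exp (q z)) - F_e x are dominated by a multiple of
    min(z, 1), and F_e' x tends to phi x = int (F (x exp z) - F x) nu(dz)
    ([mesh_density_cvg]). The same domination shows that phi is continuous and that its
    integrals are the increments of F ([limit_density_primitive]), so phi is the density of
    I ([limit_density_pdf]). *)

(** * Counts of a Poisson random measure *)

Lemma natr_injective (R : numDomainType) : injective (fun n : nat => n%:R : R).
Proof. by move=> m n h; apply/eqP; rewrite -(eqr_nat R); apply/eqP. Qed.

(** Presents two distinguished cells and a family of cells as one family indexed by
    an ordinal, the form in which independence is available. *)
Definition ocons2 (X : Type) n (x0 x1 : X) (f : 'I_n -> X) (l : 'I_n.+2) : X :=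
  if unlift ord0 l is Some l' then
    if unlift ord0 l' is Some l'' then f l'' else x1
  else x0.

Section prm.
Context {R : realType} {d d' : measure_display} {T : measurableType d}
  {E : measurableType d'} (P : probability T R) (M : R.-ker T ~> E)
  (mu : set E -> \bar R).
Hypothesis prm : poisson_random_measure P M mu.

Definition poisson_weight (m : \bar R) (k : nat) : R :=
  fine m ^+ k / k`!%:R * expR (- fine m).

Lemma measurable_count (B : set E) (x : \bar R) : measurable B ->
  measurable [set w | M w B = x].
Proof.
move=> mB; rewrite (_ : [set w | _] = (M ^~ B) @^-1` [set x]).
  by rewrite -[X in measurable X]setTI; exact: (measurable_kernel M).
by apply/seteqP; split.
Qed.

Lemma prm_counts n (B : 'I_n -> set E) (k : 'I_n -> nat) :
  (forall i, measurable (B i)) -> trivIset setT B ->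
  (forall i, (mu (B i) < +oo)%E) ->
  P [set w | forall i, M w (B i) = (k i)%:R%:E] =
  (\prod_(i < n) poisson_weight (mu (B i)) (k i))%:E.
Proof.
case: prm => pois _ indep mB tB fB.
have := indep n B mB tB (fun i => [set (k i)%:R%:E]) (fun i => emeasurable_set1 _).
rewrite (_ : \bigcap_(i in _) _ = [set w | forall i, M w (B i) = (k i)%:R%:E]).
  move=> ->; rewrite -prodEFin; apply: eq_bigr => i _.
  by rewrite -(pois _ (mB i) (fB i) (k i)).
apply/seteqP; split=> [w /= h i|w /= h i _]; last exact: h.
exact: (h i).
Qed.

(** The Poisson weights sum to one, by the exponential series. *)
Lemma prm_count_nat (B : set E) : measurable B -> (mu B < +oo)%E ->
  P (\bigcup_k [set w | M w B = k%:R%:E]) = 1%E.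
Proof.
case: prm => pois _ _ mB fB.
rewrite measure_bigcup//=; last 2 first.
- by move=> i _; exact: measurable_count.
- by move=> i j _ _ [w [/= h1 h2]]; apply: (@natr_injective R); apply: EFin_inj; rewrite -h1 -h2.
under eq_eseriesr do rewrite pois//.
set x := fine _.
have -> : (fun n : nat => \sum_(0 <= i < n | i \in [set: nat]) (x ^+ i / i`!%:R * expR (- x))%:E)%E
  = EFin \o (fun n => series (exp_coeff x) n * expR (- x)).
  apply/funext => n /=.
  rewrite sumEFin seriesEnat/= big_distrl/=; congr EFin.
  by apply: eq_bigl => i; rewrite in_setT.
apply/cvg_lim => //; apply: cvg_EFin; first exact: nearW.
rewrite -(expRxMexpNx_1 x); apply: cvgM; last exact: cvg_cst.
exact: is_cvg_series_exp_coeff.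
Qed.

Lemma prm_count_ae (B : set E) : measurable B -> (mu B < +oo)%E ->
  {ae P, forall w, exists k : nat, M w B = k%:R%:E}.
Proof.
move=> mB fB.
have mU : measurable (\bigcup_k [set w | M w B = k%:R%:E]).
  by apply: bigcup_measurable => i _; exact: measurable_count.
exists (~` \bigcup_k [set w | M w B = k%:R%:E]); split.
- exact: measurableC.
- by rewrite probability_setC// prm_count_nat// subee.
- by move=> w /= h [k _ hk]; apply: h; exists k.
Qed.

Lemma measure_ae_setI (D G : set T) : measurable D ->
  measurable G -> {ae P, forall w, G w} -> P (D `&` G) = P D.
Proof.
move=> mD mG aeG.
have G0 : P (~` G) = 0%E by apply/negligibleP => //; exact: measurableC.
have DG0 : P (D `\` G) = 0%E.
  apply/eqP; rewrite -measure_le0 -[leRHS]G0; apply: le_measure; rewrite ?inE.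
  - exact: measurableD.
  - exact: measurableC.
  - exact: subIsetr.
by rewrite [RHS](measureDI P mD mG) [X in (X + _)%E]DG0 add0e.
Qed.

Section decomposition.
Variables (n : nat) (C : 'I_n -> set E).
Hypothesis mC : forall i, measurable (C i).
Hypothesis tC : trivIset setT C.
Hypothesis fC : forall i, (mu (C i) < +oo)%E.

Let counts (f : 'I_n -> nat) : set T :=
  [set w | forall i, M w (C i) = (f i)%:R%:E].

Lemma measurable_counts f : measurable (counts f).
Proof.
rewrite (_ : counts f = \bigcap_i [set w | M w (C i) = (f i)%:R%:E]).
  by apply: fin_bigcap_measurable => // i _; exact: measurable_count.
by apply/seteqP; split=> [w h i _|w h i]; exact: h.
Qed.

(** The count vectors are countable; [pickle_inv] enumerates them. *)
Let piece (i : nat) : set T :=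
  if @pickle_inv {ffun 'I_n -> nat} i is Some f then counts f else set0.

Let measurable_piece i : measurable (piece i).
Proof. by rewrite /piece; case: pickle_inv => // f; exact: measurable_counts. Qed.

Let trivIset_piece : trivIset setT piece.
Proof.
move=> i j _ _ [w []]; rewrite /piece.
have := @pickle_invK {ffun 'I_n -> nat} i.
have := @pickle_invK {ffun 'I_n -> nat} j.
case: pickle_inv => // g /= <-; case: pickle_inv => // f /= <- hf hg.
congr (pickle _); apply/ffunP => k.
by apply: (@natr_injective R); apply: EFin_inj; rewrite -(hf k) -(hg k).
Qed.

Let piece_ae : {ae P, forall w, (\bigcup_i piece i) w}.
Proof.
have : {ae P, forall w, forall i : 'I_n, exists k : nat, M w (C i) = k%:R%:E}.
  by apply: filter_forall => i; exact: prm_count_ae.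
apply: filterS => w /choice [f hf].
exists (pickle (finfun f)) => //; rewrite /piece pickleK_inv => i.
by rewrite ffunE.
Qed.

(** Almost every point lies in exactly one of the countably many events that
    prescribe all the counts, and on each of them [A] is decided. *)
Lemma prob_counts_decomp (D : set T) (A : set ('I_n -> \bar R)) :
  measurable D -> measurable [set w | A (fun i => M w (C i))] ->
  P (D `&` [set w | A (fun i => M w (C i))]) =
  (\sum_(0 <= i <oo) if @pickle_inv {ffun 'I_n -> nat} i is Some f then
    if `[< A (fun i => (f i)%:R%:E) >] then P (D `&` counts f) else 0%R
   else 0%R)%E.
Proof.
move=> mD mA.
have mDA : measurable (D `&` [set w | A (fun i => M w (C i))]).
  exact: measurableI.
rewrite -(measure_ae_setI _ _ piece_ae)//; last exact: bigcup_measurable.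
rewrite setI_bigcupr measure_bigcup//=; last 2 first.
- by move=> i _; exact: measurableI.
- by apply: trivIset_setIl.
apply: congr_lim; apply/funext => N /=.
apply: eq_big => [i|i _]; first by rewrite in_setT.
rewrite /piece; case: pickle_inv => [f|]; last first.
  by rewrite setI0 measure0.
case: asboolP => [Af|nAf].
  congr (P _); apply/seteqP; split=> [w [[]]//|w [Dw fw]]; split=> //; split=> //=.
  by rewrite (_ : (fun i => _) = (fun i => (f i)%:R%:E))//; apply/funext => j.
rewrite (_ : _ `&` _ = set0) ?measure0//; apply/seteqP; split=> // w [[Dw Aw] fw].
by apply: nAf; rewrite -(_ : (fun i => M w (C i)) = (fun i => (f i)%:R%:E))//; apply/funext => j.
Qed.
End decomposition.

(** Both sides expand over the values of the counts, where the joint law is a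
    product of Poisson weights. These depend on the cells only through their
    intensities, so cells can be replaced by cells of equal intensity, and the two
    cells that are disjoint from the others factor out. *)
Lemma prm_shift_ord n (B0 B1 : set E) (C C' : 'I_n -> set E) (i j : nat)
    (A : set ('I_n -> \bar R)) :
  measurable B0 -> measurable B1 ->
  (forall k, measurable (C k)) -> (forall k, measurable (C' k)) ->
  (mu B0 < +oo)%E -> (mu B1 < +oo)%E -> (forall k, (mu (C k) < +oo)%E) ->
  (forall k, mu (C k) = mu (C' k)) ->
  B0 `&` B1 = set0 -> (forall k, B0 `&` C k = set0) ->
  (forall k, B1 `&` C k = set0) -> trivIset setT C -> trivIset setT C' ->
  measurable [set w | A (fun k => M w (C k))] ->
  measurable [set w | A (fun k => M w (C' k))] ->
  P ([set w | M w B0 = i%:R%:E /\ M w B1 = j%:R%:E] `&`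
     [set w | A (fun k => M w (C k))]) =
  ((poisson_weight (mu B0) i * poisson_weight (mu B1) j)%:E *
    P [set w | A (fun k => M w (C' k))])%E.
Proof.
move=> mB0 mB1 mC mC' fB0 fB1 fC CC' B01 B0C B1C tC tC' mA mA'.
have mE : measurable [set w | M w B0 = i%:R%:E /\ M w B1 = j%:R%:E].
  by apply: measurableI; exact: measurable_count.
have fC' k : (mu (C' k) < +oo)%E by rewrite -CC'.
rewrite prob_counts_decomp// -[X in (_ * P X)%E]setTI prob_counts_decomp//.
rewrite -nneseriesZl; last by move=> k _; case: pickle_inv => // f; case: asboolP.
apply: eq_eseriesr => k _; case: pickle_inv => [f|]; last by rewrite mule0.
case: asboolP => _; last by rewrite mule0.
rewrite setTI prm_counts//.
pose D := ocons2 B0 B1 C; pose g := ocons2 i j f.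
rewrite (_ : _ `&` _ = [set w | forall l, M w (D l) = (g l)%:R%:E]); last first.
  apply/seteqP; split=> [w [[h0 h1] h] l|w h].
    case: (unliftP ord0 l) => [l' ->|->]; last by rewrite /D /g /ocons2 unlift_none.
    case: (unliftP ord0 l') => [l'' ->|->].
      by rewrite /D /g /ocons2 !liftK; exact: h.
    by rewrite /D /g /ocons2 liftK unlift_none.
  split; first split.
  - by have := h ord0; rewrite /D /g /ocons2 unlift_none.
  - by have := h (lift ord0 ord0); rewrite /D /g /ocons2 liftK unlift_none.
  - by move=> l; have := h (lift ord0 (lift ord0 l)); rewrite /D /g /ocons2 !liftK.
rewrite prm_counts.
- rewrite !big_ord_recl /D /g /ocons2 unlift_none liftK unlift_none mulrA EFinM.
  congr (_ * _)%E; congr EFin; apply: eq_bigr => l _.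
  by rewrite !liftK CC'.
- move=> l; rewrite /D /ocons2.
  by case: (unlift _ l) => // l'; case: (unlift _ l').
- move=> l m _ _ [w []]; rewrite /D /ocons2.
  case: (unliftP ord0 l) => [l' ->|->]; case: (unliftP ord0 m) => [m' ->|->] //;
   rewrite ?liftK ?unlift_none.
  + case: (unliftP ord0 l') => [l'' ->|->]; case: (unliftP ord0 m') => [m'' ->|->] //;
     rewrite ?liftK ?unlift_none.
    * by move=> h1 h2; congr (lift _ (lift _ _)); apply: (tC l'' m'') => //; exists w.
    * by move=> h1 h2; have : (B1 `&` C l'') w by []; rewrite B1C.
    * by move=> h1 h2; have : (B1 `&` C m'') w by []; rewrite B1C.
  + case: (unliftP ord0 l') => [l'' ->|->]; rewrite ?liftK ?unlift_none => h1 h2.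
    * by have : (B0 `&` C l'') w by []; rewrite B0C.
    * by have : (B0 `&` B1) w by []; rewrite B01.
  + case: (unliftP ord0 m') => [m'' ->|->]; rewrite ?liftK ?unlift_none => h1 h2.
    * by have : (B0 `&` C m'') w by []; rewrite B0C.
    * by have : (B0 `&` B1) w by []; rewrite B01.
- move=> l; rewrite /D /ocons2.
  by case: (unlift _ l) => // l'; case: (unlift _ l').
Qed.

Lemma prm_shift (I : finType) (B0 B1 : set E) (C C' : I -> set E) (i j : nat)
    (A : set (I -> \bar R)) :
  measurable B0 -> measurable B1 ->
  (forall k, measurable (C k)) -> (forall k, measurable (C' k)) ->
  (mu B0 < +oo)%E -> (mu B1 < +oo)%E -> (forall k, (mu (C k) < +oo)%E) ->
  (forall k, mu (C k) = mu (C' k)) ->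
  B0 `&` B1 = set0 -> (forall k, B0 `&` C k = set0) ->
  (forall k, B1 `&` C k = set0) -> trivIset setT C -> trivIset setT C' ->
  measurable [set w | A (fun k => M w (C k))] ->
  measurable [set w | A (fun k => M w (C' k))] ->
  P ([set w | M w B0 = i%:R%:E /\ M w B1 = j%:R%:E] `&`
     [set w | A (fun k => M w (C k))]) =
  ((poisson_weight (mu B0) i * poisson_weight (mu B1) j)%:E *
    P [set w | A (fun k => M w (C' k))])%E.
Proof.
move=> mB0 mB1 mC mC' fB0 fB1 fC CC' B01 B0C B1C tC tC' mA mA'.
pose A' : set ('I_#|I| -> \bar R) :=
  [set f : 'I_#|I| -> \bar R | A (fun k => f (enum_rank k))].
have AE (K : I -> set E) : [set w | A (fun k => M w (K k))] =
    [set w | A' (fun k => M w (K (enum_val k)))].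
  apply/seteqP; split=> w /=; rewrite /A' /=;
   by congr A; apply/funext => k /=; rewrite enum_rankK.
have tr (K : I -> set E) : trivIset setT K -> trivIset setT (K \o @enum_val I I).
  by move=> tK a b _ _ ab; apply/enum_val_inj/tK.
rewrite (AE C) in mA *; rewrite (AE C') in mA' *.
apply: (@prm_shift_ord _ B0 B1 (C \o @enum_val I I) (C' \o @enum_val I I) i j A') => //=; exact: tr.
Qed.

End prm.

(** * Riemann sums of nonincreasing functions *)

Section riemann.
Local Open Scope ereal_scope.
Context {R : realType}.
Notation leb := (@lebesgue_measure R).
Variables (s : R) (f : R -> \bar R).
Hypothesis f0 : forall t, 0 <= f t.
Hypothesis f1 : forall t, f t <= 1.
Hypothesis f_noninc : forall t u, (s <= t)%R -> (t <= u)%R -> f u <= f t.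

Lemma measurable_noninc : measurable_fun `[s, +oo[ f.
Proof.
have ffin t : f t = (fine (f t))%:E.
  by rewrite fineK// ge0_fin_numE// (le_lt_trans (f1 t))// ltry.
pose g t := fine (f (Num.max s t)).
apply: (eq_measurable_fun (EFin \o g)).
  by move=> t; rewrite inE/= in_itv/= andbT => st; rewrite /g max_r// -ffin.
apply/measurable_EFinP; apply: nonincreasing_measurable => // t u tu.
rewrite /g fine_le//.
- by rewrite ffin.
- by rewrite ffin.
- apply: f_noninc; first by rewrite le_max lexx.
  by rewrite ge_max !le_max lexx tu orbT.
Qed.

Let mf (a : R) (b : itv_bound R) : (s <= a)%R -> measurable_fun [set` Interval (BLeft a) b] f.
Proof.
move=> sa; apply: (@measurable_funS _ _ _ _ `[s, +oo[%classic) => //;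
  last exact: measurable_noninc.
move=> t /=.
by rewrite !itv_boundlr/= /Order.le/= => /andP[at_ _]; rewrite andbT (le_trans sa).
Qed.

Definition lower_sum (dl : R) N := \sum_(i < N) dl%:E * f (s + i.+1%:R * dl)%R.
Definition upper_sum (dl : R) N := \sum_(i < N) dl%:E * f (s + i%:R * dl)%R.

Lemma integral_lower_upper (dl : R) N : (0 < dl)%R ->
  lower_sum dl N <= \int[leb]_(t in `[s, (s + N%:R * dl)%R[) f t <= upper_sum dl N.
Proof.
move=> dl0; elim: N => [|N /andP[IHl IHu]].
  rewrite /lower_sum /upper_sum !big_ord0 mul0r addr0 set_itvco0 integral_set0.
  by rewrite lexx.
have -> : `[s, (s + N.+1%:R * dl)%R[%classic = `[s, (s + N%:R * dl)%R[%classic `|`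
    `[(s + N%:R * dl)%R, (s + N.+1%:R * dl)%R[%classic.
  rewrite -itv_bndbnd_setU//= bnd_simp.
  - by rewrite lerDl mulr_ge0// ltW.
  - by rewrite lerD2l ler_pM2r// ler_nat.
set a := (s + N%:R * dl)%R; set b := (s + N.+1%:R * dl)%R.
have sa : (s <= a)%R by rewrite lerDl mulr_ge0// ltW.
have ab : (a < b)%R by rewrite ltrD2l ltr_pM2r// ltr_nat.
have ba : (b - a = dl)%R by rewrite /a /b -natr1; ring.
have lab : leb `[a, b[ = dl%:E by rewrite lebesgue_measure_itv/= lte_fin ab -EFinB ba.
rewrite ge0_integral_setU//=; last 2 first.
- rewrite -itv_bndbnd_setU ?bnd_simp ?(ltW ab)//; exact: mf.
- apply/disj_setPS => t [] /=; rewrite !in_itv/= => /andP[_ ta] /andP[at_ _].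
  by move: (lt_le_trans ta at_); rewrite ltxx.
rewrite /lower_sum /upper_sum !big_ord_recr/= -/(lower_sum dl N) -/(upper_sum dl N).
apply/andP; split; apply: leeD => //.
- rewrite -lab muleC -integral_cst//; apply: ge0_le_integral => //.
  + by move=> x _; exact: f0.
  + exact: mf.
  + move=> t /=; rewrite in_itv/= => /andP[at_ tb].
    by apply: f_noninc; [exact: (le_trans sa)|exact: ltW].
- rewrite -[in leRHS]lab muleC -integral_cst//; apply: ge0_le_integral => //.
  + exact: mf.
  + move=> t /=; rewrite in_itv/= => /andP[at_ tb].
    exact: f_noninc.
Qed.

(** The two sums are shifted by one node: they differ by at most the first term. *)
Lemma upper_lower (dl : R) N : (0 < dl)%R ->
  upper_sum dl N <= dl%:E + lower_sum dl N.
Proof.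
move=> dl0; case: N => [|N].
  by rewrite /lower_sum /upper_sum !big_ord0 adde0 lee_fin ltW.
rewrite /lower_sum /upper_sum big_ord_recl/= big_ord_recr/=.
apply: leeD; first by rewrite -[leRHS]mule1 lee_pmul2l ?lte_fin.
rewrite -[leLHS]adde0; apply: leeD; last by rewrite mule_ge0// lee_fin ltW.
by apply: lee_sum => i _; rewrite /bump leq0n add1n.
Qed.

(** The step tends to zero while the window, of length [n.+1], exhausts the half line. *)
Definition lower_seq n := lower_sum n.+1%:R^-1 (n.+1 * n.+1).

Lemma lower_seq_le n : lower_seq n <= \int[leb]_(t in `[s, +oo[) f t.
Proof.
have n0 : (0 < n.+1%:R^-1 :> R)%R by rewrite invr_gt0.
have /andP[h _] := integral_lower_upper (n.+1 * n.+1) n0.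
apply: (le_trans h); apply: ge0_subset_integral => //.
- exact: measurable_noninc.
- by move=> t /=; rewrite !in_itv/= andbT => /andP[].
Qed.

(** The integral over the window lies between the lower sum and the upper sum, which
    exceeds the lower one by at most the step. *)
Lemma cvg_lower_seq : lower_seq n @[n --> \oo] --> \int[leb]_(t in `[s, +oo[) f t.
Proof.
have cvgI : \int[leb]_(t in `[s, (s + n.+1%:R)%R[) f t @[n --> \oo] -->
    \int[leb]_(t in `[s, +oo[) f t.
  have -> : `[s, +oo[%classic = \bigcup_n `[s, (s + n.+1%:R)%R[%classic.
    apply/seteqP; split=> [t|t [n _]] /=; last first.
      by rewrite !in_itv/= andbT => /andP[].
    rewrite in_itv/= andbT => st; exists (Num.truncn (t - s)) => //=.
    rewrite in_itv/= st/= -ltrBlDl; exact: truncnS_gt.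
  apply: ge0_nondecreasing_set_cvg_integral => //.
  - move=> n m nm; apply/subsetPset => t /=; rewrite !in_itv/= => /andP[-> h]/=.
    by rewrite (lt_le_trans h)// lerD2l ler_nat.
  - by move=> n; exact: mf.
have cvgI' : \int[leb]_(t in `[s, (s + n.+1%:R)%R[) f t - (n.+1%:R^-1)%:E @[n --> \oo] -->
    \int[leb]_(t in `[s, +oo[) f t.
  rewrite -[X in _ --> X]sube0; apply: cvgeB => //.
    by rewrite oppe0 fin_num_adde_defl.
  exact: cvge_harmonic.
apply: (squeeze_cvge _ cvgI') (cvg_cst (\int[leb]_(t in `[s, +oo[) f t)).
apply: nearW => n; rewrite lower_seq_le andbT leeBlDr//.
have n0 : (0 < n.+1%:R^-1 :> R)%R by rewrite invr_gt0.
have /andP[_ h] := integral_lower_upper (n.+1 * n.+1) n0.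
move: h; rewrite natrM mulfK ?pnatr_eq0// => h.
by rewrite (le_trans h)// addeC upper_lower.
Qed.

End riemann.

(** * Exponential integrals along nondecreasing paths *)

Lemma measurable_expeR (R : realType) : measurable_fun setT (@expeR R).
Proof.
apply: (measurability (@ErealGenOInfty.G R)) => [|/= _ [_ [r ->] <-]].
  exact: ErealGenOInfty.measurableE.
rewrite setTI; have [r0|r0] := ltP r 0.
  rewrite (_ : _ @^-1` _ = setT)//; apply/seteqP; split=> // x _ /=.
  by rewrite in_itv/= andbT (lt_le_trans _ (expeR_ge0 x))// lte_fin.
rewrite (_ : _ @^-1` _ = [set x | (lne r%:E < x)%E]).
  have := @emeasurable_fun_o_infty _ _ R setT id measurableT (@measurable_id _ _ _) (lne r%:E).
  by rewrite setTI.
apply/seteqP; split=> x /=; rewrite in_itv/= andbT -(lte_expeR (lne r%:E)) lneK//;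
 by rewrite in_itv/= lee_fin r0 leey.
Qed.

Lemma expeRN_ge0_le1 (R : realType) (x : \bar R) : (0 <= x)%E ->
  (0 <= expeR (- x) <= 1)%E.
Proof.
by move=> x0; rewrite expeR_ge0/= -expeR0 lee_expeR oppe_le0.
Qed.

Section exp_integral.
Local Open Scope ereal_scope.
Context {R : realType} {d} {T : measurableType d}.
Notation leb := (@lebesgue_measure R).
Variables (s : R) (Z : R -> T -> \bar R).
Hypothesis Z0 : forall t w, 0 <= Z t w.
Hypothesis Zm : forall t, measurable_fun setT (Z t).
Hypothesis Z_nondec : forall t u w, (s <= t)%R -> (t <= u)%R -> Z t w <= Z u w.

Let f w t := expeR (- Z t w).
Let f0 w t : 0 <= f w t. Proof. exact: expeR_ge0. Qed.
Let f1 w t : f w t <= 1.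
Proof. by case/andP: (expeRN_ge0_le1 (Z0 t w)). Qed.
Let f_noninc w t u : (s <= t)%R -> (t <= u)%R -> f w u <= f w t.
Proof. by move=> st tu; rewrite /f lee_expeR leeN2 Z_nondec. Qed.

Lemma measurable_exp_path w : measurable_fun `[s, +oo[ (f w).
Proof. exact: (measurable_noninc (f0 w) (f1 w) (@f_noninc w)). Qed.

Lemma exp_lower_seq_le w n :
  lower_seq s (f w) n <= \int[leb]_(t in `[s, +oo[) expeR (- Z t w).
Proof. exact: (lower_seq_le (f0 w) (f1 w) (@f_noninc w)). Qed.

Lemma cvg_exp_lower_seq w :
  lower_seq s (f w) n @[n --> \oo] --> \int[leb]_(t in `[s, +oo[) expeR (- Z t w).
Proof. exact: (cvg_lower_seq (f0 w) (f1 w) (@f_noninc w)). Qed.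

Lemma measurable_exp_lower_seq n : measurable_fun setT (fun w => lower_seq s (f w) n).
Proof.
apply: emeasurable_sum => i; apply: measurable_funeM.
apply: measurableT_comp; first exact: measurable_expeR.
exact: measurableT_comp.
Qed.

(** The Riemann sums read the path at countably many times only; each of them is
    measurable in the sample point, and so is their limit. *)
Lemma measurable_exp_integral :
  measurable_fun setT (fun w => \int[leb]_(t in `[s, +oo[) expeR (- Z t w)).
Proof.
apply: (emeasurable_fun_cvg (fun n w => lower_seq s (f w) n)).
  exact: measurable_exp_lower_seq.
by move=> w _; exact: cvg_exp_lower_seq.
Qed.

End exp_integral.

Lemma dominated_cvg_ae d (T : measurableType d) (R : realType)
    (mu : {measure set T -> \bar R}) (D : set T) (f_ : (T -> \bar R)^nat)
    (f g : T -> \bar R) :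
  measurable D ->
  (forall n, measurable_fun D (f_ n)) -> measurable_fun D f ->
  {ae mu, forall x, D x -> f_ ^~ x @ \oo --> f x} -> mu.-integrable D g ->
  {ae mu, forall x n, D x -> (`|f_ n x| <= g x)%E} ->
  (\int[mu]_(x in D) f_ n x)%E @[n --> \oo] --> (\int[mu]_(x in D) f x)%E.
Proof.
move=> mD mf_ mf cf ig fg.
by have [] := @dominated_convergence _ _ _ mu D mD f_ f g mf_ mf cf ig fg.
Qed.

Section prob_cvg.
Local Open Scope ereal_scope.
Context {R : realType} {d} {T : measurableType d} (P : probability T R).

Lemma measurable_le_set (I : T -> \bar R) b : measurable_fun setT I ->
  measurable [set w | I w <= b].
Proof.
by move=> mI; have := emeasurable_fun_infty_c measurableT mI b; rewrite setTI.
Qed.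

(** On [I <= b] the approximations from below stay below [b], and on [I > b] they
    eventually exceed it; the indicators therefore converge almost surely. *)
Lemma prob_le_cvg (D : set T) (S : nat -> T -> \bar R) (I : T -> \bar R) b :
  measurable D -> (forall n, measurable_fun setT (S n)) -> measurable_fun setT I ->
  (forall n w, S n w <= I w) -> {ae P, forall w, S n w @[n --> \oo] --> I w} ->
  P (D `&` [set w | S n w <= b]) @[n --> \oo] --> P (D `&` [set w | I w <= b]).
Proof.
move=> mD mS mI SI Scvg.
have mDS n : measurable (D `&` [set w | S n w <= b]).
  by apply: measurableI => //; exact: measurable_le_set.
have mDI : measurable (D `&` [set w | I w <= b]).
  by apply: measurableI => //; exact: measurable_le_set.
rewrite -[X in _ --> P X]setIT -(integral_indic P measurableT)//.
under eq_fun do rewrite -[X in P X]setIT -(integral_indic P measurableT)//.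
apply: (@dominated_cvg_ae _ _ _ P _ _ _ (cst 1)) => //.
- by move=> n; apply/measurable_EFinP; exact: measurable_indic.
- by apply/measurable_EFinP; exact: measurable_indic.
- apply: filterS Scvg => w Sw _.
  apply: cvg_near_cst.
  have [Dw|Dw] := pselect (D w); last first.
    by apply: nearW => n; rewrite !indicE !memNset// => -[].
  have [Iw|Iw] := leP (I w) b.
    apply: nearW => n; rewrite !indicE !mem_set//; split=> //=.
    exact: le_trans (SI n w) Iw.
  near=> n.
  rewrite !indicE !memNset//=; first by move=> [_]; rewrite leNgt Iw.
  move=> [_]; apply/negP; rewrite -ltNge.
  near: n; exact: (Sw [set y | b < y] (open_ereal_gt' Iw)).
- exact: finite_measure_integrable_cst.
- by apply: aeW => w n _; rewrite /= lee_fin indicE; case: (_ \in _); rewrite ?normr1 ?normr0.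
Unshelve. all: by end_near. Qed.

End prob_cvg.

(** * Independence and stationarity of the discretized process *)

Lemma measurable_kernel_integral (R : realType) d d' (X : measurableType d)
    (Y : measurableType d') (k : R.-ker X ~> Y) (D : set Y) (f : Y -> \bar R) :
  measurable D -> (forall y, D y -> (0 <= f y)%E) -> measurable_fun D f ->
  measurable_fun setT (fun x => \int[k x]_(y in D) f y)%E.
Proof.
move=> mD f0 mf; under eq_fun do rewrite integral_mkcond.
apply: measurable_fun_integral_kernel.
- by move=> U mU; exact: measurable_kernel.
- by move=> y; apply: erestrict_ge0.
- exact/(measurable_restrictT _ mD).1.
Qed.

Section cells.
Context {R : realType} {d : measure_display} {T : measurableType d}
  (P : probability T R) (nu : {sigma_finite_measure set R -> \bar R})
  (M : R.-ker T ~> (R * R)%type) (e : R).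
Hypothesis prm : poisson_random_measure P M (jump_intensity nu).
Hypothesis e0 : 0 < e.
Hypothesis nu_fin : (nu `[e, +oo[ < +oo)%E.

Lemma jump_intensity_rect (a b : R) (A : set R) : 0 <= a -> a <= b ->
  measurable A -> A `<=` `]0, +oo[ ->
  jump_intensity nu (`]a, b] `*` A) = ((b - a)%:E * nu A)%E.
Proof.
move=> a0 ab mA A0; rewrite /jump_intensity.
rewrite (_ : _ `&` _ = `]a, b] `*` A); last first.
  apply/seteqP; split=> [[x y] [[]]//|[x y] [/= xab Ay]]; split=> //; split=> //=.
    move: xab; rewrite !in_itv/= andbT => /andP[ax _].
    exact: ltW (le_lt_trans a0 ax).
  exact: A0.
have lab : @lebesgue_measure R `]a, b] = (b - a)%:E.
  rewrite lebesgue_measure_itv/= lte_fin; case: ltP => //.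
  by move=> ba; rewrite (_ : b = a) ?subrr//; apply/eqP; rewrite eq_le ba ab.
rewrite -lab; exact: product_measure1E.
Qed.

Definition quantize (z : R) : R := e * (Num.floor (z / e))%:~R.

Lemma quantize_cell k z : e * k%:R <= z < e * k.+1%:R -> quantize z = e * k%:R.
Proof.
move=> /andP[h1 h2]; rewrite /quantize; congr (_ * _).
rewrite (@floor_def _ _ k%:Z)//.
have -> : (k%:Z + 1)%:~R = k.+1%:R :> R by rewrite intrD -natr1.
by rewrite ler_pdivlMr// ltr_pdivrMr// ![_ * e]mulrC h1.
Qed.

Lemma quantize_ge0 z : e <= z -> 0 <= quantize z.
Proof.
by move=> ez; rewrite mulr_ge0 ?(ltW e0)// ler0z floor_ge0 divr_ge0 ?(ltW e0)// (le_trans (ltW e0)).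
Qed.

Lemma measurable_quantize : measurable_fun setT quantize.
Proof.
apply: measurable_funM; first exact: measurable_cst.
have -> : (fun z => (Num.floor (z / e))%:~R) =
  (fun y => (Num.floor y)%:~R) \o (fun z => z / e) :> (R -> R) by [].
apply: measurableT_comp; last exact: measurable_funM.
apply: nondecreasing_measurable => // x y xy.
by rewrite ler_int le_floor.
Qed.

(** The cells [e (k+1), e (k+2)[ for k < K, and the unbounded remainder. *)
Definition mark K (k : nat) : set R :=
  if (k < K)%N then `[e * k.+1%:R, e * k.+2%:R[%classic else `[e * K.+1%:R, +oo[%classic.

Lemma measurable_mark K k : measurable (mark K k).
Proof. by rewrite /mark; case: ifP. Qed.

Lemma mark_sub K k : mark K k `<=` `[e, +oo[.
Proof.
rewrite /mark; case: ifP => _ z /=; rewrite !in_itv/= !andbT;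
 [move=> /andP[h _]|move=> h]; apply: le_trans h;
 by rewrite ler_peMr ?(ltW e0)// ler1n.
Qed.

Lemma mark_pos K k : mark K k `<=` `]0, +oo[.
Proof.
move=> z /mark_sub /=; rewrite !in_itv/= !andbT; exact: lt_le_trans.
Qed.

Lemma trivIset_mark K : trivIset setT (fun k : 'I_K.+1 => mark K k).
Proof.
move=> i j _ _ [z [hi hj]]; apply/val_inj => /=.
wlog ij : i j hi hj / (i <= j)%N.
  move=> W; have [/W|/ltnW /W] := leqP i j; first exact.
  by move=> h; apply/esym/h.
apply/eqP; rewrite eqn_leq ij/= leqNgt; apply/negP => ltij.
have iK : (i < K)%N by rewrite (leq_trans ltij)// -ltnS.
move: hi; rewrite /mark iK /= in_itv/= => /andP[_ zi].
move: hj; rewrite /mark; case: ifP => _ /=; rewrite in_itv/= => /andP[zj _];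
  move: (le_lt_trans zj zi); rewrite ltr_pM2l// ltr_nat ltnS; last first.
- by rewrite ltnS leqNgt iK.
- by rewrite ltnS leqNgt ltij.
Qed.

Lemma bigcup_mark K : \big[setU/set0]_(k < K.+1) mark K k = `[e, +oo[%classic.
Proof.
rewrite -(@bigcup_mkord _ K.+1 (mark K)); apply/seteqP; split=> [z [k _ /mark_sub]//|z].
rewrite /= in_itv/= andbT => ez.
have [h|h] := leP (e * K.+1%:R) z.
  by exists K => //=; rewrite /mark ltnn/= in_itv/= h.
have [k hk] : exists k, Num.truncn (z / e) = k.+1.
  have : (0 < Num.truncn (z / e))%N by rewrite truncn_gt0 ler_pdivlMr// mul1r.
  by case: Num.truncn => // k _; exists k.
have := truncn_itv (divr_ge0 (le_trans (ltW e0) ez) (ltW e0)).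
rewrite hk ler_pdivlMr// ltr_pdivrMr// ![_ * e]mulrC => /andP[h1 h2].
have kK : (k < K)%N by move: (le_lt_trans h1 h); rewrite ltr_pM2l// ltr_nat.
by exists k; [exact: ltnW|rewrite /mark kK /= in_itv/= h1].
Qed.

Definition weight K (k : nat) : \bar R := if (k < K)%N then (e * k.+1%:R)%:E else +oo%E.

Lemma weight_ge0 K k : (0 <= weight K k)%E.
Proof.
by rewrite /weight; case: ifP => // _; rewrite lee_fin mulr_ge0// ltW.
Qed.

Definition level (s t : R) (w : T) : \bar R :=
  (\int[M w]_(p in `]s, t] `*` `[e, +oo[) (quantize p.2)%:E)%E.

(** A jump of size at least e (K+1) sends the path to infinity. The killed level is
    a function of finitely many counts, and it is equal to [level] as long as no
    such jump has occurred. *)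
Definition killed_level K (s t : R) (w : T) : \bar R :=
  (\sum_(k < K.+1) weight K k * M w (`]s, t] `*` mark K k))%E.

Lemma killed_level_ge0 K s t w : (0 <= killed_level K s t w)%E.
Proof. by apply: sume_ge0 => k _; rewrite mule_ge0// weight_ge0. Qed.

Let mrect (a b : R) (A : set R) : measurable A -> measurable (`]a, b] `*` A).
Proof. by move=> mA; apply: measurableX. Qed.

Let mq (D : set (R * R)) : measurable_fun D (fun p : R * R => (quantize p.2)%:E).
Proof.
apply: measurable_funTS; apply/measurable_EFinP.
by apply: measurableT_comp; [exact: measurable_quantize|exact: measurable_snd].
Qed.

Lemma measurable_killed_level K s t : measurable_fun setT (killed_level K s t).
Proof.
apply: emeasurable_sum => k; apply: measurable_funeM.
by apply: measurable_kernel; apply: mrect; exact: measurable_mark.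
Qed.

Lemma killed_level_nondec K s t u w : t <= u ->
  (killed_level K s t w <= killed_level K s u w)%E.
Proof.
move=> tu; apply: lee_sum => k _; rewrite lee_wpmul2l ?weight_ge0//.
apply: le_measure; rewrite ?inE; [exact: mrect (measurable_mark _ _)..|].
move=> [x y] [/= xst my]; split=> //=.
by move: xst; rewrite !in_itv/= => /andP[-> /le_trans]; exact.
Qed.

Lemma level_killed K s t w : M w (`]s, t] `*` `[e * K.+1%:R, +oo[) = 0%E ->
  level s t w = killed_level K s t w.
Proof.
move=> h0; rewrite /level -(bigcup_mark K).
have -> : `]s, t] `*` \big[setU/set0]_(k < K.+1) mark K k =
    \big[setU/set0]_(k < K.+1) (`]s, t] `*` mark K k).
  rewrite -(@bigcup_mkord _ K.+1 (mark K)) -(@bigcup_mkord _ K.+1 (fun k => `]s, t] `*` mark K k)).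
  by rewrite setX_bigcupr.
rewrite ge0_integral_bigsetU//=; last 4 first.
- by move=> k; apply: mrect; exact: measurable_mark.
- exact: index_enum_uniq.
- move=> k l _ _ [[x y] [[_ yk] [_ yl]]]; apply: (@trivIset_mark K) => //.
  by exists y.
- move=> p; rewrite -(@bigcup_mkord _ K.+1 (fun k => `]s, t] `*` mark K k)) => -[k _ [_ /mark_sub]].
  by rewrite /= in_itv/= andbT lee_fin => /quantize_ge0.
apply: eq_bigr => k _; have [kK|kK] := ltnP k K; last first.
  rewrite /weight /mark ltnNge kK/= h0 mule0; apply: null_set_integral => //.
  exact: mrect.
rewrite (eq_integral (cst (e * k.+1%:R)%:E)).
  rewrite integral_cst; last exact: mrect (measurable_mark _ _).
  by rewrite /weight kK.
move=> [x y]; rewrite inE => -[_]; rewrite /mark kK => yk /=.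
by rewrite (@quantize_cell k.+1).
Qed.

Lemma killed_level_oo K s t w : M w (`]s, t] `*` `[e * K.+1%:R, +oo[) != 0%E ->
  killed_level K s t w = +oo%E.
Proof.
move=> h; rewrite /killed_level big_ord_recr/= {2}/weight {2}/mark ltnn.
rewrite gt0_mulye; last by rewrite lt0e h/=.
rewrite addey// gt_eqF// (lt_le_trans _ (sume_ge0 _ _))// => k _.
by rewrite mule_ge0// weight_ge0.
Qed.

Lemma level_le_killed K s t w : (level s t w <= killed_level K s t w)%E.
Proof.
have [/level_killed -> //|h] := eqVneq (M w (`]s, t] `*` `[e * K.+1%:R, +oo[)) 0%E.
by rewrite killed_level_oo// leey.
Qed.

Lemma level_ge0 s t w : (0 <= level s t w)%E.
Proof.
apply: integral_ge0 => p [_ /=]; rewrite in_itv/= andbT lee_fin.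
exact: quantize_ge0.
Qed.

Lemma measurable_level s t : measurable_fun setT (level s t).
Proof.
apply: measurable_kernel_integral; first exact: mrect.
- by move=> p [_ /=]; rewrite in_itv/= andbT lee_fin; exact: quantize_ge0.
- exact: mq.
Qed.

Lemma level_nondec s t u w : t <= u -> (level s t w <= level s u w)%E.
Proof.
move=> tu; apply: ge0_subset_integral; [exact: mrect|exact: mrect|exact: mq|..].
  move=> p [_ /=]; rewrite in_itv/= andbT lee_fin; exact: quantize_ge0.
move=> [x y] [/= xst my]; split=> //=.
by move: xst; rewrite !in_itv/= => /andP[-> /le_trans]; exact.
Qed.

Definition expint s w := (\int[@lebesgue_measure R]_(t in `[s, +oo[) expeR (- level s t w))%E.
Definition killed_expint K s w :=
  (\int[@lebesgue_measure R]_(t in `[s, +oo[) expeR (- killed_level K s t w))%E.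

Lemma killed_expint_le K s w : (killed_expint K s w <= expint s w)%E.
Proof.
apply: ge0_le_integral => //.
- move=> t _; exact: expeR_ge0.
- apply: measurable_exp_path => [??|???? ?]; [exact: killed_level_ge0|exact: killed_level_nondec].
- apply: measurable_exp_path => [??|???? ?]; [exact: level_ge0|exact: level_nondec].
- by move=> t _; rewrite lee_expeR leeN2 level_le_killed.
Qed.

(** A bounded time window has finite intensity, hence carries finitely many jumps; the
    counts of the shrinking tails are integers that tend to zero. *)
Lemma mark_bound_ae (s : R) : 0 <= s ->
  {ae P, forall w, forall N : nat, exists K0 : nat, forall K, (K0 <= K)%N ->
     M w (`]s, s + N%:R] `*` `[e * K.+1%:R, +oo[) = 0%E}.
Proof.
move=> s0.
have sN (N : nat) : s <= s + N%:R by rewrite lerDl.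
have eK (K : nat) : e <= e * K.+1%:R by rewrite ler_peMr ?ler1n// ltW.
have sub0 (K : nat) : `[e * K.+1%:R, +oo[ `<=` (`]0, +oo[ : set R).
  by move=> z /=; rewrite !in_itv/= !andbT; apply: lt_le_trans; rewrite mulr_gt0.
have aeN : {ae P, forall w, forall N K : nat, exists k : nat,
    M w (`]s, s + N%:R] `*` `[e * K.+1%:R, +oo[) = k%:R%:E}.
  apply: ae_foralln => N; apply: ae_foralln => K.
  apply: (prm_count_ae prm); first exact: mrect.
  rewrite jump_intensity_rect// lte_mul_pinfty ?lee_fin ?subr_ge0//.
  apply: le_lt_trans nu_fin; apply: le_measure; rewrite ?inE// => z /=.
  by rewrite !in_itv/= !andbT; exact: le_trans.
apply: filterS aeN => w hw N.
pose F K := `]s, s + N%:R] `*` (`[e * K.+1%:R, +oo[ : set R).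
have mF K : measurable (F K) by exact: mrect.
have capF : \bigcap_K F K = set0.
  apply/seteqP; split=> // -[x y] h.
  have [_ /=] := h (Num.truncn (y / e)) I; rewrite in_itv/= andbT leNgt => /negP; apply.
  by rewrite mulrC -ltr_pdivrMr// truncnS_gt.
have : M w (F n) @[n --> \oo] --> M w (\bigcap_K F K).
  apply: nonincreasing_cvg_mu => //.
  - by have [k ->] := hw N 0%N; rewrite ltry.
  - exact: bigcap_measurable.
  - move=> m n mn; apply/subsetPset => -[x y] [xs /= yn]; split=> //=.
    move: yn; rewrite !in_itv/= !andbT; apply: le_trans.
    by rewrite ler_pM2l// ler_nat.
rewrite capF measure0 => /(_ [set y | (y < 1)%E]).
have /[swap] /[apply] : nbhs 0%E [set y : \bar R | (y < 1)%E].
  by apply: (@open_ereal_lt' _ 0%E 1%E); rewrite lte_fin.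
case=> K0 _ hK0; exists K0 => K /hK0 /=; rewrite -/(F K).
have [k ->] := hw N K; rewrite lte_fin -[1]/(1%:R) ltr_nat ltnS leqn0.
by move=> /eqP ->.
Qed.

Lemma tail_sub (a b : R) (K L : nat) : (K <= L)%N ->
  `]a, b] `*` `[e * L.+1%:R, +oo[ `<=` `]a, b] `*` (`[e * K.+1%:R, +oo[ : set R).
Proof.
move=> KL [x y] [xs /= yn]; split=> //=; move: yn; rewrite !in_itv/= !andbT.
by apply: le_trans; rewrite ler_pM2l// ler_nat.
Qed.

Lemma tail_null (a b b' : R) (K L : nat) w : (K <= L)%N -> b' <= b ->
  M w (`]a, b] `*` `[e * K.+1%:R, +oo[) = 0%E ->
  M w (`]a, b'] `*` `[e * L.+1%:R, +oo[) = 0%E.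
Proof.
move=> KL bb h; apply/eqP; rewrite -measure_le0 -[leRHS]h.
apply: le_measure; rewrite ?inE; [exact: mrect|exact: mrect|].
apply: (subset_trans (tail_sub KL)) => -[x y] [/= xs yn]; split=> //=.
by move: xs; rewrite !in_itv/= => /andP[-> /le_trans]; exact.
Qed.

Lemma killed_level_noninc K L s t w : (K <= L)%N ->
  (killed_level L s t w <= killed_level K s t w)%E.
Proof.
move=> KL.
have [h|h] := eqVneq (M w (`]s, t] `*` `[e * K.+1%:R, +oo[)) 0%E.
  by rewrite -(level_killed h) -(level_killed (tail_null KL (lexx t) h)).
by rewrite (killed_level_oo h) leey.
Qed.

Lemma measurable_killed_path K (s : R) w :
  measurable_fun `[s, +oo[ (fun t => expeR (- killed_level K s t w)).
Proof.
apply: measurable_exp_path => [??|???? ?]; [exact: killed_level_ge0|exact: killed_level_nondec].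
Qed.

(** At each time the killed level is eventually the level, and it decreases in [K]. *)
Lemma killed_expint_cvg s : 0 <= s ->
  {ae P, forall w, killed_expint K s w @[K --> \oo] --> expint s w}.
Proof.
move=> s0; apply: filterS (mark_bound_ae s0) => w hw.
rewrite (_ : expint s w = (\int[@lebesgue_measure R]_(t in `[s, +oo[)
   limn (fun K => expeR (- killed_level K s t w)))%E).
  apply: (@cvg_monotone_convergence _ _ _ (@lebesgue_measure R) `[s, +oo[%classic _
     (fun K t => expeR (- killed_level K s t w))) => //.
  - by move=> K; exact: measurable_killed_path.
  - by move=> K t _; exact: expeR_ge0.
  - by move=> t _ K L KL; rewrite lee_expeR leeN2 killed_level_noninc.
apply: eq_integral => t _; apply/esym/cvg_lim => //.
apply: cvg_near_cst.
have [K0 hK0] := hw (Num.truncn (t - s)).+1.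
near=> K; congr (expeR (- _)); apply/esym/level_killed.
apply: (tail_null (leqnn K) _ (hK0 K _)); last by near: K; exists K0.
by rewrite -lerBlDl ltW// truncnS_gt.
Unshelve. all: by end_near. Qed.

Section grid.
Variables (n K : nat).
Let N := (n.+1 * n.+1)%N.
Let dl : R := n.+1%:R^-1.
Let dl0 : 0 < dl. Proof. by rewrite invr_gt0. Qed.

Definition grid_cell s (jk : 'I_N * 'I_K.+1) : set (R * R) :=
  `]s + jk.1%:R * dl, s + jk.1.+1%:R * dl] `*` mark K jk.2.

(** The lower Riemann sum of the killed integral, as a function of the counts in the
    cells of a grid. *)
Definition grid_fun (g : 'I_N * 'I_K.+1 -> \bar R) : \bar R :=
  (\sum_(i < N) dl%:E *
    expeR (- \sum_(k < K.+1) weight K k * \sum_(j < N | (j < i.+1)%N) g (j, k)))%E.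

Lemma measurable_grid_cell s jk : measurable (grid_cell s jk).
Proof. by apply: mrect; exact: measurable_mark. Qed.

Lemma trivIset_grid_cell s : trivIset setT (grid_cell s).
Proof.
move=> [i k] [j l] _ _ [[x y] [[/= xi yk] [/= xj yl]]].
have -> : k = l by apply: (@trivIset_mark K) => //; exists y.
congr (_, _); apply/val_inj => /=.
wlog ij : i j xi xj / (i <= j)%N.
  move=> W; have [/W|/ltnW /W] := leqP i j; first exact.
  by move=> h; apply/esym/h.
apply/eqP; rewrite eqn_leq ij/= leqNgt; apply/negP => ltij.
move: xi xj; rewrite !in_itv/= => /andP[_ xi] /andP[xj _].
by move: (lt_le_trans xj xi); rewrite ltrD2l ltr_pM2r// ltr_nat ltnS leqNgt ltij.
Qed.

Lemma count_time_split s w (A : set R) i : measurable A ->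
  M w (`]s, s + i%:R * dl] `*` A) =
  (\sum_(j < i) M w (`](s + j%:R * dl)%R, (s + j.+1%:R * dl)%R] `*` A))%E.
Proof.
move=> mA; elim: i => [|i IH].
  by rewrite big_ord0 mul0r addr0 set_itvoc0 set0X measure0.
rewrite big_ord_recr/= -IH -measureU//; [|exact: mrect|exact: mrect|].
  congr (M w _); apply/seteqP; split=> [[x y] [/= xs Ay]|[x y]].
    move: xs; rewrite in_itv/= => /andP[sx xi].
    have [h|h] := leP x (s + i%:R * dl).
      by left; split => //=; rewrite in_itv/= sx h.
    by right; split => //=; rewrite in_itv/= h xi.
  move=> [] [/= xs Ay]; split=> //=; move: xs; rewrite !in_itv/= => /andP[sx xi].
    rewrite sx/= (le_trans xi)// lerD2l ler_pM2r// ler_nat//.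
  by rewrite xi andbT (le_lt_trans _ sx)// lerDl mulr_ge0// ltW.
apply/seteqP; split=> // -[x y] [[/= h1 _] [/= h2 _]].
move: h1 h2; rewrite !in_itv/= => /andP[_ h1] /andP[h2 _].
by move: (lt_le_trans h2 h1); rewrite ltxx.
Qed.

Lemma grid_funE s w :
  lower_seq s (fun t => expeR (- killed_level K s t w)) n =
  grid_fun (fun jk => M w (grid_cell s jk)).
Proof.
rewrite /lower_seq /lower_sum -/N -/dl /grid_fun; apply: eq_bigr => i _.
congr (_ * expeR (- _))%E; rewrite /killed_level; apply: eq_bigr => k _.
congr (_ * _)%E; rewrite count_time_split; last exact: measurable_mark.
by rewrite (big_ord_widen N (fun j => M w (`](s + j%:R * dl)%R, (s + j.+1%:R * dl)%R] `*` mark K k))).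
Qed.

Lemma intensity_grid_cell s jk : 0 <= s ->
  jump_intensity nu (grid_cell s jk) = (dl%:E * nu (mark K jk.2))%E.
Proof.
move=> s0; rewrite jump_intensity_rect.
- by congr (_%:E * _)%E; rewrite -natr1; ring.
- by rewrite addr_ge0// mulr_ge0// ltW.
- by rewrite lerD2l ler_pM2r// ler_nat.
- exact: measurable_mark.
- exact: mark_pos.
Qed.

End grid.

(** The Riemann sums from time [s] are functions of counts in cells located after [s];
    moving these cells back by [s] preserves their intensities, and [prm_shift]
    applies. *)
Lemma prob_shift_killed (s : R) (B0 B1 : set (R * R)) (i j : nat) K b : 0 <= s ->
  measurable B0 -> measurable B1 -> B0 `&` B1 = set0 ->
  B0 `<=` [set p | p.1 <= s] -> B1 `<=` [set p | p.1 <= s] ->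
  (jump_intensity nu B0 < +oo)%E -> (jump_intensity nu B1 < +oo)%E ->
  P ([set w | M w B0 = i%:R%:E /\ M w B1 = j%:R%:E] `&` [set w | (killed_expint K s w <= b)%E]) =
  ((poisson_weight (jump_intensity nu B0) i * poisson_weight (jump_intensity nu B1) j)%:E *
   P [set w | (killed_expint K 0%R w <= b)%E])%E.
Proof.
move=> s0 mB0 mB1 B01 B0s B1s fB0 fB1.
have mE : measurable [set w | M w B0 = i%:R%:E /\ M w B1 = j%:R%:E].
  by apply: measurableI; exact: measurable_count.
have mS r n : measurable_fun setT (fun w => lower_seq r (fun t => expeR (- killed_level K r t w)) n).
  apply: measurable_exp_lower_seq => t; exact: measurable_killed_level.
have mI r : measurable_fun setT (killed_expint K r).
  apply: measurable_exp_integral => [??|?|???? ?].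
  - exact: killed_level_ge0.
  - exact: measurable_killed_level.
  - exact: killed_level_nondec.
have le_ r n w : (lower_seq r (fun t => expeR (- killed_level K r t w)) n <= killed_expint K r w)%E.
  by apply: exp_lower_seq_le => [??|???? ?]; [exact: killed_level_ge0|exact: killed_level_nondec].
have cvg_ r : {ae P, forall w, lower_seq r (fun t => expeR (- killed_level K r t w)) n
   @[n --> \oo] --> killed_expint K r w}.
  by apply: aeW => w; apply: cvg_exp_lower_seq => [??|???? ?];
   [exact: killed_level_ge0|exact: killed_level_nondec].
have h1 := prob_le_cvg (b := b) mE (mS s) (mI s) (le_ s) (cvg_ s).
have h2 := prob_le_cvg (b := b) measurableT (mS 0) (mI 0) (le_ 0) (cvg_ 0).
rewrite !setTI in h2.
have ffin : (poisson_weight (jump_intensity nu B0) i *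
  poisson_weight (jump_intensity nu B1) j)%:E \is a fin_num by [].
have h3 := cvgeZl ffin h2.
apply: (cvg_unique (@ereal_hausdorff R) h1); apply: cvg_trans h3.
apply: near_eq_cvg; apply: nearW => n.
pose A : set (('I_(n.+1 * n.+1) * 'I_K.+1)%type -> \bar R) :=
  [set g | (grid_fun g <= b)%E].
have AE r : [set w | (lower_seq r (fun t => expeR (- killed_level K r t w)) n <= b)%E] =
    [set w | A (fun jk => M w (grid_cell r jk))].
  by apply/seteqP; split=> w /=; rewrite /A/= grid_funE.
have mA r : measurable [set w | A (fun jk => M w (grid_cell r jk))].
  by rewrite -AE; exact: measurable_le_set.
have fcell r jk : 0 <= r -> (jump_intensity nu (@grid_cell n K r jk) < +oo)%E.
  move=> r0; rewrite intensity_grid_cell// lte_mul_pinfty ?lee_fin ?invr_ge0//.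
  apply: le_lt_trans nu_fin; apply: le_measure; rewrite ?inE//; last exact: mark_sub.
  exact: measurable_mark.
have disj (B : set (R * R)) jk : B `<=` [set p | p.1 <= s] -> B `&` @grid_cell n K s jk = set0.
  move=> Bs; apply/seteqP; split=> // -[x y] [/Bs /= xs [/= + _]].
  rewrite in_itv/= => /andP[+ _]; rewrite ltNge => /negP; apply.
  by rewrite (le_trans xs)// lerDl mulr_ge0// invr_ge0.
rewrite !AE setTI; apply/esym.
apply: (@prm_shift _ _ _ _ _ P M _ prm _ B0 B1 (@grid_cell n K s) (@grid_cell n K 0) i j A) => //.
- by move=> jk; exact: measurable_grid_cell.
- by move=> jk; exact: measurable_grid_cell.
- by move=> jk; exact: fcell.
- by move=> jk; rewrite !intensity_grid_cell.
- by move=> jk; exact: disj.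
- by move=> jk; exact: disj.
- exact: trivIset_grid_cell.
- exact: trivIset_grid_cell.
Qed.

Lemma measurable_expint s : measurable_fun setT (expint s).
Proof.
apply: measurable_exp_integral => [??|?|???? ?].
- exact: level_ge0.
- exact: measurable_level.
- exact: level_nondec.
Qed.

(** The Markov property at a fixed time, obtained from [prob_shift_killed] by letting
    the killing threshold tend to infinity. Two prescribed counts are enough to
    describe a single jump of given size. *)
Lemma prob_shift (s : R) (B0 B1 : set (R * R)) (i j : nat) b : 0 <= s ->
  measurable B0 -> measurable B1 -> B0 `&` B1 = set0 ->
  B0 `<=` [set p | p.1 <= s] -> B1 `<=` [set p | p.1 <= s] ->
  (jump_intensity nu B0 < +oo)%E -> (jump_intensity nu B1 < +oo)%E ->
  P ([set w | M w B0 = i%:R%:E /\ M w B1 = j%:R%:E] `&` [set w | (expint s w <= b)%E]) =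
  ((poisson_weight (jump_intensity nu B0) i * poisson_weight (jump_intensity nu B1) j)%:E *
   P [set w | (expint 0%R w <= b)%E])%E.
Proof.
move=> s0 mB0 mB1 B01 B0s B1s fB0 fB1.
have mE : measurable [set w | M w B0 = i%:R%:E /\ M w B1 = j%:R%:E].
  by apply: measurableI; exact: measurable_count.
have mI K r : measurable_fun setT (killed_expint K r).
  apply: measurable_exp_integral => [??|?|???? ?].
  - exact: killed_level_ge0.
  - exact: measurable_killed_level.
  - exact: killed_level_nondec.
have h1 := prob_le_cvg (b := b) mE (mI^~ s) (measurable_expint s)
  (fun K => @killed_expint_le K s) (killed_expint_cvg s0).
have h2 := prob_le_cvg (b := b) measurableT (mI^~ 0) (measurable_expint 0)
  (fun K => @killed_expint_le K 0) (killed_expint_cvg (lexx 0)).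
rewrite !setTI in h2.
have ffin : (poisson_weight (jump_intensity nu B0) i *
  poisson_weight (jump_intensity nu B1) j)%:E \is a fin_num by [].
have h3 := cvgeZl ffin h2.
apply: (cvg_unique (@ereal_hausdorff R) h1); apply: cvg_trans h3.
apply: near_eq_cvg; apply: nearW => K /=.
by rewrite setTI prob_shift_killed.
Qed.

End cells.

(** * Splitting at the first jump *)

Section renewal.
Context {R : realType} {d : measure_display} {T : measurableType d}
  (P : probability T R) (nu : {sigma_finite_measure set R -> \bar R})
  (M : R.-ker T ~> (R * R)%type) (e : R).
Hypothesis prm : poisson_random_measure P M (jump_intensity nu).
Hypothesis e0 : 0 < e.
Hypothesis nu_fin : (nu `[e, +oo[ < +oo)%E.

Local Notation level := (level M e).
Local Notation expint := (expint M e).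

Let mrect (a b : R) (A : set R) : measurable A -> measurable (`]a, b] `*` A).
Proof. by move=> mA; apply: measurableX. Qed.

Let mq (D : set (R * R)) : measurable_fun D (fun p : R * R => (quantize e p.2)%:E).
Proof.
apply: measurable_funTS; apply/measurable_EFinP.
by apply: measurableT_comp; [exact: measurable_quantize|exact: measurable_snd].
Qed.

Let q0 (I : set R) (p : R * R) : (I `*` `[e, +oo[) p -> (0 <= (quantize e p.2)%:E)%E.
Proof. move=> [_ /=]; rewrite in_itv/= andbT lee_fin; exact: quantize_ge0. Qed.

Lemma level_split s t w : 0 <= s -> s <= t ->
  (level 0 t w = level 0 s w + level s t w)%E.
Proof.
move=> s0 st; rewrite /level.
have -> : `]0, t] `*` `[e, +oo[ = (`]0, s] `*` `[e, +oo[) `|` (`]s, t] `*` (`[e, +oo[ : set R)).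
  apply/seteqP; split=> [[x y] [/= + Ay]|[x y] [] [/= + Ay]]; rewrite !in_itv/=.
  - move=> /andP[x0 xt]; have [h|h] := leP x s.
      by left; split => //; rewrite x0.
    by right; split => //; rewrite xt ?h.
  - by move=> /andP[x0 xs]; split => //; rewrite x0 (le_trans xs).
  - by move=> /andP[x0 xs]; split => //; rewrite xs (le_lt_trans s0).
rewrite ge0_integral_setU//; [exact: mrect|exact: mrect| |].
  by move=> p [|]; exact: q0.
apply/disj_setPS => -[x y] [[/= + _] [/= + _]]; rewrite !in_itv/= => /andP[_ xs] /andP[sx _].
by move: (lt_le_trans sx xs); rewrite ltxx.
Qed.

Lemma expint_split (s : R) w : 0 <= s ->
  (expint 0%R w = \int[@lebesgue_measure R]_(t in `[0%R, s[) expeR (- level 0 t w) +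
     expeR (- level 0 s w) * expint s w)%E.
Proof.
move=> s0.
have mL (r : R) : measurable_fun `[r, +oo[ (fun t => expeR (- level r t w)).
  by apply: measurable_exp_path => [??|???? ?]; [exact: level_ge0|exact: level_nondec].
rewrite /expint.
have U : `[0, +oo[%classic = `[0, s[%classic `|` `[s, +oo[%classic :> set R.
  by rewrite -itv_bndbnd_setU.
rewrite [in LHS]U ge0_integral_setU//; last 3 first.
- by rewrite -U; exact: mL.
- by move=> t _; exact: expeR_ge0.
- by apply/disj_setPS => t [] /=; rewrite !in_itv/= andbT => /andP[_ ts] st;
  move: (lt_le_trans ts st); rewrite ltxx.
congr (_ + _)%E; rewrite -ge0_integralZl//.
- apply: eq_integral => t; rewrite inE/= in_itv/= andbT => st.
  rewrite -expeRD (level_split _ s0 st) oppeD//.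
  by rewrite ge0_adde_def// inE level_ge0.
- exact: mL.
- by move=> t _; exact: expeR_ge0.
- exact: expeR_ge0.
Qed.

Let cell (k : nat) : set R := `[e * k.+1%:R, e * k.+2%:R[.

Let cell_sub k : cell k `<=` `[e, +oo[.
Proof.
move=> z; rewrite /cell /= !in_itv/= andbT => /andP[h _]; apply: le_trans h.
by rewrite ler_peMr ?(ltW e0)// ler1n.
Qed.

Let itv_sub : `[e, +oo[ `<=` (`]0, +oo[ : set R).
Proof. by move=> z /=; rewrite !in_itv/= !andbT; exact: lt_le_trans. Qed.

Definition jump_rate : R := fine (nu `[e, +oo[).
(** The rate of the jumps of size e (k+1). *)
Definition cell_rate k : R := fine (nu (cell k)).

Let nu_cell k : nu (cell k) = (cell_rate k)%:E.
Proof.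
rewrite fineK// ge0_fin_numE//; apply: le_lt_trans nu_fin.
by apply: le_measure; rewrite ?inE//; exact: measurable_itv.
Qed.

Let nu_jump_rate : nu `[e, +oo[ = jump_rate%:E.
Proof. by rewrite fineK// ge0_fin_numE. Qed.

Let nu_rest k : nu (`[e, +oo[ `\` cell k) = (jump_rate - cell_rate k)%:E.
Proof.
have -> : nu (`[e, +oo[ `\` cell k) = (nu `[e, +oo[ - nu (`[e, +oo[ `&` cell k))%E.
  by apply: measureD => //; exact: measurable_itv.
rewrite (_ : _ `&` _ = cell k); last exact/setIidr/cell_sub.
by rewrite nu_jump_rate nu_cell.
Qed.

Definition expint_cdf (b : R) : R := fine (P [set w | (expint 0%R w <= b%:E)%E]).

Let cdfE b : (expint_cdf b)%:E = P [set w | (expint 0%R w <= b%:E)%E].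
Proof. by rewrite fineK// fin_num_measure//; exact/measurable_le_set/measurable_expint. Qed.

Section step.
Variable h : R.
Hypothesis h0 : 0 <= h.

Let strip (A : set R) : set (R * R) := `]0, h] `*` A.

Let mstrip A : measurable A -> measurable (strip A).
Proof. by move=> mA; exact: mrect. Qed.

Let mu_strip A : measurable A -> A `<=` `[e, +oo[ ->
  jump_intensity nu (strip A) = (h%:E * nu A)%E.
Proof.
move=> mA Ae; rewrite /strip jump_intensity_rect ?subr0//.
exact: subset_trans Ae itv_sub.
Qed.

(** Index 0: no jump up to time [h]; index k+1: exactly one jump, of size e (k+1). The
    clause on [set0] gives both cases the shape of [prob_shift]. *)
Definition jump_event (k : nat) : set T :=
  if k is k'.+1 then
    [set w | M w (strip (cell k')) = 1%:R%:E /\ M w (strip (`[e, +oo[ `\` cell k')) = 0%:R%:E]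
  else [set w | M w (strip `[e, +oo[) = 0%:R%:E /\ M w set0 = 0%:R%:E].

Definition jump_weight (k : nat) : R :=
  if k is k'.+1 then h * cell_rate k' * expR (- (jump_rate * h)) else expR (- (jump_rate * h)).

Let strip_sub A : strip A `<=` [set p | p.1 <= h].
Proof. by move=> [x y] [/= + _]; rewrite in_itv/= => /andP[]. Qed.

Let mcell k : measurable (cell k). Proof. exact: measurable_itv. Qed.
Let mrest k : measurable (`[e, +oo[ `\` cell k). Proof. exact: measurableD. Qed.
Let rest_sub k : `[e, +oo[ `\` cell k `<=` `[e, +oo[. Proof. exact: subDsetl. Qed.

Lemma measurable_jump_event k : measurable (jump_event k).
Proof.
by case: k => [|k]; apply: measurableI; apply: measurable_count => //; exact: mstrip.
Qed.

Lemma prob_jump_event k b :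
  P (jump_event k `&` [set w | (expint h w <= b)%E]) =
  ((jump_weight k)%:E * P [set w | (expint 0%R w <= b)%E])%E.
Proof.
case: k => [|k].
  rewrite (prob_shift prm e0 nu_fin)//; last 4 first.
  - exact: mstrip.
  - by rewrite setI0.
  - by rewrite mu_strip// nu_jump_rate ltry.
  - by rewrite /jump_intensity set0I measure0.
  congr (_%:E * _)%E; rewrite /poisson_weight mu_strip// nu_jump_rate /=.
  rewrite /jump_intensity set0I measure0/= !expr0 fact0 divr1 !mul1r oppr0 expR0 mulr1.
  by rewrite mulrC.
rewrite (prob_shift prm e0 nu_fin)//; last 5 first.
- exact: mstrip.
- exact: mstrip.
- apply/seteqP; split=> // -[x y] [[_ /= yc] [_ /= [_]]]; exact.
- by rewrite mu_strip; [rewrite nu_cell ltry|exact: mcell|exact: cell_sub].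
- by rewrite mu_strip// nu_rest ltry.
congr (_%:E * _)%E; rewrite /poisson_weight !mu_strip//.
rewrite nu_cell nu_rest/= expr0 expr1 fact0 (_ : 1`!%N = 1%N)// !divr1 mul1r.
rewrite -mulrA -expRD; congr (_ * expR _); ring.
Qed.

Lemma trivIset_jump_event : trivIset setT jump_event.
Proof.
have sub_count (A B : set R) w : measurable A -> measurable B -> A `<=` B ->
    (M w (strip A) <= M w (strip B))%E.
  move=> mA mB AB; apply: le_measure; rewrite ?inE; [exact: mstrip|exact: mstrip|].
  by move=> [x y] [/= hx /AB].
have one0 : (1%:R%:E <= 0%:R%:E :> \bar R)%E -> False by rewrite lee_fin ler10.
have H0 k w : jump_event 0 w -> jump_event k.+1 w -> False.
  move=> [h1 _] [h2 _]; apply: one0; rewrite -[X in (X <= _)%E]h2 -[X in (_ <= X)%E]h1.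
  by apply: sub_count => //; exact: cell_sub.
move=> [|k] [|l] _ _ [w [hk hl]] //.
- by have := H0 _ _ hk hl.
- by have := H0 _ _ hl hk.
congr S; apply/eqP/negPn/negP => kl; move: hk hl => [h1 _] [_ h2].
apply: one0; rewrite -[X in (X <= _)%E]h1 -[X in (_ <= X)%E]h2.
apply: sub_count => // z zk; split; first exact: cell_sub zk.
move=> zl; move/negP: kl; apply; apply/eqP.
move: zk zl; rewrite /cell /= !in_itv/= => /andP[a1 a2] /andP[b1 b2].
have := le_lt_trans a1 b2; have := le_lt_trans b1 a2.
rewrite !ltr_pM2l// !ltr_nat !ltnS => lk kl; apply/eqP; rewrite eqn_leq.
by rewrite kl lk.
Qed.

Lemma level_jump_event k w : jump_event k.+1 w -> level 0 h w = (e * k.+1%:R)%:E.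
Proof.
move=> [h1 h2]; rewrite /level -/(strip `[e, +oo[).
have -> : strip `[e, +oo[ = strip (cell k) `|` strip (`[e, +oo[ `\` cell k).
  apply/seteqP; split=> [[x y] [xh ye]|[x y] [] [xh]].
  - by have [c|c] := pselect (cell k y); [left|right].
  - by move=> /cell_sub.
  - by move=> [].
rewrite ge0_integral_setU//; last 4 first.
- exact: mstrip.
- exact: mstrip.
- by move=> p [[xh /cell_sub ye]|[xh [ye _]]]; exact: (@q0 `]0, h] p (conj xh ye)).
- by apply/disj_setPS => -[x y] [[_ c] [_ [_]]].
rewrite [X in (_ + X)%E]null_set_integral// ?adde0; last exact: mstrip.
rewrite (eq_integral (cst (e * k.+1%:R)%:E)).
  rewrite integral_cst; last exact: mstrip.
  by rewrite [X in (_ * X)%E]h1 mule1.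
move=> [x y]; rewrite inE => -[_ yk].
by rewrite (@quantize_cell _ _ e0 k.+1).
Qed.

Lemma level_no_jump t w : t <= h -> jump_event 0 w -> level 0 t w = 0%E.
Proof.
move=> th [h1 _]; apply: null_set_integral => //; first exact: mrect.
apply/eqP; rewrite -measure_le0 -[leRHS]h1; apply: le_measure; rewrite ?inE.
- exact: mrect.
- exact: mstrip.
- move=> [x y] [/= + yn]; rewrite in_itv/= => /andP[x0 xt]; split=> //=.
  by rewrite in_itv/= x0 (le_trans xt).
Qed.

Definition jump_factor (k : nat) : R := if k is k'.+1 then expR (- (e * k'.+1%:R)) else 1.

Lemma expint_first w :
  (0 <= \int[@lebesgue_measure R]_(t in `[0%R, h[) expeR (- level 0 t w) <= h%:E)%E.
Proof.
apply/andP; split; first by apply: integral_ge0 => t _; exact: expeR_ge0.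
have -> : h%:E = (\int[@lebesgue_measure R]_(t in `[0%R, h[) (cst 1%E) t)%E.
  rewrite integral_cst//= mul1e lebesgue_measure_itv/= lte_fin.
  by case: ltP => [_|]; rewrite ?oppr0 ?adde0// => hh; congr EFin; apply/eqP; rewrite eq_le hh h0.
apply: ge0_le_integral => //.
- by move=> t _; exact: expeR_ge0.
- apply: (@measurable_funS _ _ _ _ (`[0%R : R, +oo[%classic)) => //.
    by move=> t /=; rewrite !in_itv/= andbT => /andP[].
  by apply: measurable_exp_path => [??|???? ?]; [exact: level_ge0|exact: level_nondec].
- by move=> t _; case/andP: (expeRN_ge0_le1 (level_ge0 M e0 0 t w)).
Qed.

Lemma level_nojump_factor k w : jump_event k w ->
  (expeR (- level 0 h w) = (jump_factor k)%:E)%E.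
Proof.
case: k => [E0|k /level_jump_event -> //].
by rewrite (level_no_jump (lexx h) E0) oppe0 expeR0.
Qed.

Lemma expint_no_jump w : jump_event 0 w -> (expint 0%R w = h%:E + expint h w)%E.
Proof.
move=> E0; rewrite (expint_split w h0) (level_nojump_factor E0) mul1e; congr (_ + _)%E.
rewrite (eq_integral (cst 1%E)).
  rewrite integral_cst//= mul1e lebesgue_measure_itv/= lte_fin.
  by case: ltP => [_|]; rewrite ?oppr0 ?adde0// => hh; congr EFin; apply/eqP; rewrite eq_le hh h0.
move=> t; rewrite inE/= in_itv/= => /andP[_ th].
by rewrite (level_no_jump (ltW th) E0) oppe0 expeR0.
Qed.

(** On [jump_event k], the integral from 0 is at most [a] if the integral from [h] is
    below the low threshold, and only if it is below the high one. The two differ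
    because the jump may occur at any time before [h]. *)
Definition low_threshold a k := if k is k'.+1 then (a - h) * expR (e * k'.+1%:R) else a - h.
Definition high_threshold a k := if k is k'.+1 then a * expR (e * k'.+1%:R) else a - h.

Lemma jump_factor_le k (x : \bar R) (y : R) : (0 <= x)%E ->
  ((jump_factor k.+1)%:E * x <= y%:E)%E = (x <= (y * expR (e * k.+1%:R))%:E)%E.
Proof.
move=> x0; rewrite /= expRN; case: x x0 => [r| |]//= r0.
- by rewrite -EFinM !lee_fin mulrC ler_pdivrMr ?expR_gt0.
- by rewrite gt0_muley ?lte_fin ?invr_gt0 ?expR_gt0.
Qed.

Let expint_ge0 s w : (0 <= expint s w)%E.
Proof. by apply: integral_ge0 => t _; exact: expeR_ge0. Qed.

Lemma expint_high k a w : jump_event k w -> (expint 0%R w <= a%:E)%E ->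
  (expint h w <= (high_threshold a k)%:E)%E.
Proof.
case: k => [E0|k Ek].
  by rewrite (expint_no_jump E0) /= EFinB leeBrDr// addeC.
rewrite (expint_split w h0) (level_nojump_factor Ek) => H.
rewrite -jump_factor_le//; apply: le_trans H; rewrite leeDr//.
by case/andP: (expint_first w).
Qed.

Lemma expint_low k a w : jump_event k w -> (expint h w <= (low_threshold a k)%:E)%E ->
  (expint 0%R w <= a%:E)%E.
Proof.
case: k => [E0|k Ek].
  by rewrite (expint_no_jump E0) /= EFinB leeBrDr// addeC.
rewrite (expint_split w h0) (level_nojump_factor Ek) /low_threshold -jump_factor_le// => H.
rewrite (_ : a = h + (a - h)); last by rewrite addrC subrK.
rewrite [in leRHS]EFinD; apply: leeD => //.
by case/andP: (expint_first w).
Qed.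

Let mle s b : measurable [set w | (expint s w <= b)%E].
Proof. exact/measurable_le_set/measurable_expint. Qed.

Lemma cdf_step_ge a :
  (\sum_(0 <= k <oo) (jump_weight k)%:E * (expint_cdf (low_threshold a k))%:E <= (expint_cdf a)%:E)%E.
Proof.
under eq_eseriesr do rewrite cdfE -prob_jump_event.
rewrite -(measure_semi_bigcup P); last 3 first.
- by move=> k; apply: measurableI; [exact: measurable_jump_event|exact: mle].
- by apply: trivIset_setIr; exact: trivIset_jump_event.
- by apply: bigcup_measurable => k _; apply: measurableI; [exact: measurable_jump_event|exact: mle].
rewrite cdfE; apply: le_measure; rewrite ?inE//.
- by apply: bigcup_measurable => k _; apply: measurableI; [exact: measurable_jump_event|exact: mle].
- by move=> w [k _ [Ek H]]; exact: expint_low Ek H.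
Qed.

Lemma prob_jump_event_total k : P (jump_event k) = (jump_weight k)%:E.
Proof.
transitivity (P (jump_event k `&` [set w | (expint h w <= +oo)%E])).
  by congr (P _); apply/esym/setIidl => w _; exact: leey.
rewrite prob_jump_event -[RHS]mule1; congr (_ * _)%E.
transitivity (P setT); last exact: probability_setT.
by congr (P _); apply/seteqP; split=> [//|w _]; exact: leey.
Qed.

Let jump_weight_ge0 k : 0 <= jump_weight k.
Proof. by rewrite -lee_fin -prob_jump_event_total. Qed.

(** Several jumps before [h] are accounted for by the missing mass of the weights. *)
Lemma cdf_step_le a :
  ((expint_cdf a)%:E <= \sum_(0 <= k <oo) (jump_weight k)%:E * (expint_cdf (high_threshold a k))%:E +
     (1 - \sum_(0 <= k <oo) (jump_weight k)%:E))%E.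
Proof.
pose U := \bigcup_k jump_event k.
have mU : measurable U by apply: bigcup_measurable => k _; exact: measurable_jump_event.
have PU : P U = (\sum_(0 <= k <oo) (jump_weight k)%:E)%E.
  rewrite (measure_semi_bigcup P)//; last exact: trivIset_jump_event.
    by apply: eq_eseriesr => k _; exact: prob_jump_event_total.
  by move=> k; exact: measurable_jump_event.
rewrite -PU -probability_setC// cdfE.
under eq_eseriesr do rewrite cdfE -prob_jump_event.
have mD k : measurable (jump_event k `&` [set w | (expint h w <= (high_threshold a k)%:E)%E]).
  by apply: measurableI; [exact: measurable_jump_event|exact: mle].
rewrite -(measure_semi_bigcup P)//; last 2 first.
- by apply: trivIset_setIr; exact: trivIset_jump_event.
- by apply: bigcup_measurable.
apply: (le_trans _ (measureU2 _ _ _)); last 2 first.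
- by apply: bigcup_measurable.
- exact: measurableC.
apply: le_measure; rewrite ?inE; first exact: mle.
  by apply: measurableU; [apply: bigcup_measurable|exact: measurableC].
move=> w H; have [[k _ Ek]|nU] := pselect (U w); last by right.
by left; exists k => //; split => //; exact: expint_high Ek H.
Qed.

End step.

Lemma bigcup_cell : \bigcup_k cell k = `[e, +oo[.
Proof.
apply/seteqP; split=> [z [k _ /cell_sub]//|z]; rewrite /= in_itv/= andbT => ez.
have [k hk] : exists k, Num.truncn (z / e) = k.+1.
  have : (0 < Num.truncn (z / e))%N by rewrite truncn_gt0 ler_pdivlMr// mul1r.
  by case: Num.truncn => // k _; exists k.
have := truncn_itv (divr_ge0 (le_trans (ltW e0) ez) (ltW e0)).
rewrite hk ler_pdivlMr// ltr_pdivrMr// ![_ * e]mulrC => /andP[h1 h2].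
by exists k => //; rewrite /cell/= in_itv/= h1.
Qed.

Lemma trivIset_cell : trivIset setT cell.
Proof.
move=> k l _ _ [z []]; rewrite /cell /= !in_itv/= => /andP[a1 a2] /andP[b1 b2].
have := le_lt_trans a1 b2; have := le_lt_trans b1 a2.
rewrite !ltr_pM2l// !ltr_nat !ltnS => lk kl; apply/eqP; rewrite eqn_leq.
by rewrite kl lk.
Qed.

Lemma quantize_integral (f : R -> R) : measurable_fun setT f -> (forall x, 0 <= f x) ->
  (\int[nu]_(z in `[e, +oo[) (f (quantize e z))%:E =
   \sum_(0 <= k <oo) (cell_rate k)%:E * (f (e * k.+1%:R))%:E)%E.
Proof.
move=> mf f0; rewrite -bigcup_cell ge0_integral_bigcup//.
- apply: eq_eseriesr => k _; rewrite (eq_integral (cst (f (e * k.+1%:R))%:E)).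
    by rewrite integral_cst; [rewrite muleC; congr (_ * _)%E; exact: nu_cell|exact: measurable_itv].
  by move=> z; rewrite inE => zk /=; rewrite (@quantize_cell _ _ e0 k.+1).
- by move=> k; exact: measurable_itv.
- apply: measurable_funTS; apply/measurable_EFinP.
  by apply: measurableT_comp => //; exact: measurable_quantize.
- by move=> z _; rewrite lee_fin.
- exact: trivIset_cell.
Qed.

Lemma expint_cdf_nondecreasing : {homo expint_cdf : a b / a <= b}.
Proof.
move=> a b ab; rewrite -lee_fin !cdfE; apply: le_measure; rewrite ?inE.
- exact/measurable_le_set/measurable_expint.
- exact/measurable_le_set/measurable_expint.
- by move=> w /= H; apply: (le_trans H); rewrite lee_fin.
Qed.

Let cdf_ge0 a : 0 <= expint_cdf a. Proof. by rewrite -lee_fin cdfE. Qed.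
Let cdf_le1 a : expint_cdf a <= 1. Proof. by rewrite -lee_fin cdfE probability_le1//; exact/measurable_le_set/measurable_expint. Qed.

(** The mean number, per unit of time, of jumps after which the integral is at most [a]. *)
Definition jump_mean (a : R) : \bar R :=
  (\int[nu]_(z in `[e, +oo[) (expint_cdf (a * expR (quantize e z)))%:E)%E.

Lemma jump_mean_series a :
  jump_mean a = (\sum_(0 <= k <oo) (cell_rate k)%:E * (expint_cdf (a * expR (e * k.+1%:R)))%:E)%E.
Proof.
apply: (quantize_integral (f := fun y => expint_cdf (a * expR y))) => // .
apply: (@measurableT_comp _ _ _ _ _ _ expint_cdf _ (fun y => a * expR y)).
  by apply: nondecreasing_measurable => //; exact: expint_cdf_nondecreasing.
by apply: measurable_funM => //; exact: measurable_expR.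
Qed.

Let cell_rate_ge0 k : 0 <= cell_rate k. Proof. by rewrite -lee_fin -nu_cell. Qed.

Lemma jump_weight_series h (f : nat -> R) : 0 <= h -> (forall k, 0 <= f k) ->
  (\sum_(0 <= k <oo) (jump_weight h k)%:E * (f k)%:E =
   (expR (- (jump_rate * h)) * f 0%N)%:E + (h * expR (- (jump_rate * h)))%:E *
     \sum_(0 <= k <oo) (cell_rate k)%:E * (f k.+1)%:E)%E.
Proof.
move=> h0 f0.
have w0 k : (0 <= (jump_weight h k)%:E * (f k)%:E)%E.
  rewrite mule_ge0// ?lee_fin//; case: k => [|k] /=; first exact: expR_ge0.
  by rewrite !mulr_ge0// expR_ge0.
rewrite nneseries_recl//= -EFinM; congr (_ + _)%E.
rewrite -nneseriesZl; last by move=> k _; rewrite mule_ge0 ?lee_fin.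
rewrite -[in LHS](nneseries_addn 1)//.
apply: eq_eseriesr => k _; rewrite addn1/= -!EFinM; congr EFin; ring.
Qed.

Lemma cell_rate_series : (\sum_(0 <= k <oo) (cell_rate k)%:E = jump_rate%:E)%E.
Proof.
have := quantize_integral (f := cst 1) (measurable_cst _) (fun=> ler01).
under eq_eseriesr do rewrite mule1.
move=> <-; rewrite (eq_integral (cst 1%E))// integral_cst// mul1e; exact: nu_jump_rate.
Qed.

Definition rjump_mean a : R := fine (jump_mean a).

Lemma jump_mean_bounds a : (0 <= jump_mean a <= jump_rate%:E)%E.
Proof.
rewrite jump_mean_series -cell_rate_series; apply/andP; split.
  by apply: nneseries_ge0 => k _ _; rewrite mule_ge0 ?lee_fin.
apply: lee_nneseries => k _; first by rewrite mule_ge0 ?lee_fin.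
by rewrite -EFinM lee_fin ler_piMr.
Qed.

Lemma jump_meanE a : jump_mean a = (rjump_mean a)%:E.
Proof.
have /andP[h1 h2] := jump_mean_bounds a.
by rewrite fineK// ge0_fin_numE// (le_lt_trans h2)// ltry.
Qed.

(** The renewal inequality. To first order in [h] it reads F' = G - lam F, with G the
    [rjump_mean]; both bounds are correct up to terms of second order. *)
Lemma cdf_step a h (p := expR (- (jump_rate * h))) : 0 <= h ->
  p * expint_cdf (a - h) + h * p * rjump_mean (a - h) <= expint_cdf a <=
  p * expint_cdf (a - h) + h * p * rjump_mean a + (1 - p * (1 + jump_rate * h)).
Proof.
move=> h0; apply/andP; split.
  have := cdf_step_ge h0 a.
  rewrite (@jump_weight_series h (fun k => expint_cdf (low_threshold h a k)))//=.
  by rewrite -jump_mean_series jump_meanE -EFinM -EFinD lee_fin.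
have := cdf_step_le h0 a.
rewrite (@jump_weight_series h (fun k => expint_cdf (high_threshold h a k)))//=.
rewrite -jump_mean_series jump_meanE.
have := @jump_weight_series h (fun=> 1) h0 (fun=> ler01).
under eq_eseriesr do rewrite mule1.
move=> ->; under eq_eseriesr do rewrite mule1.
rewrite cell_rate_series -!EFinM -!EFinD lee_fin => /le_trans; apply.
by rewrite le_eqVlt; apply/orP; left; apply/eqP; rewrite -/p; ring.
Qed.

End renewal.

(** * Differentiability from one-step inequalities *)

Section step_derivative.
Context {R : realType}.
Variables (F G : R -> R) (lam : R).
Hypothesis lam0 : 0 <= lam.
Hypothesis F01 : forall a, 0 <= F a <= 1.
Hypothesis F_nondec : {homo F : a b / a <= b}.
Hypothesis F_neg : forall a : R, a < 0 -> F a = 0.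
Hypothesis G_bound : forall a, 0 <= G a <= lam.
Hypothesis step : forall a h : R, 0 <= h ->
  expR (- (lam * h)) * F (a - h) + h * expR (- (lam * h)) * G (a - h) <= F a <=
  expR (- (lam * h)) * F (a - h) + h * expR (- (lam * h)) * G a +
    (1 - expR (- (lam * h)) * (1 + lam * h)).

Let exp_lower (x : R) : 0 <= x -> 1 - x <= expR (- x) <= 1.
Proof.
move=> x0; apply/andP; split; first exact: expR_ge1Dx.
by rewrite -expR0 ler_expR oppr_le0.
Qed.

Let exp_upper (x : R) : 0 <= x -> expR (- x) <= 1 - x + x ^+ 2.
Proof.
move=> x0; have x1 : 0 < 1 + x by rewrite ltr_pwDl.
have h : expR (- x) <= (1 + x)^-1.
  by rewrite expRN lef_pV2 ?posrE ?expR_gt0// expR_ge1Dx.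
apply: (le_trans h); rewrite -[X in X <= _]mul1r ler_pdivrMr//.
have -> : (1 - x + x ^+ 2) * (1 + x) = 1 + x ^+ 3 by ring.
by rewrite lerDl exprn_ge0.
Qed.

(** With [step_upper], the increments of F up to second order in [h], uniformly in [a]. *)
Lemma step_lower (a h : R) : 0 <= h ->
  h * (G (a - h) - lam * F (a - h)) - (lam * h) ^+ 2 <= F a - F (a - h).
Proof.
move=> h0; have /andP[H _] := step a h0.
have lh : 0 <= lam * h by exact: mulr_ge0.
have /andP[p1 p2] := exp_lower lh.
have /andP[f0 f1] := F01 (a - h); have /andP[g0 g1] := G_bound (a - h).
move: H p1 p2 lh; set p := expR _; set f := F (a - h); set g := G (a - h) => H p1 p2 lh.
have e1 : 0 <= (p - (1 - lam * h)) * f by rewrite mulr_ge0// subr_ge0.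
have e2 : 0 <= (p - (1 - lam * h)) * (h * g) by rewrite !mulr_ge0// subr_ge0.
have e3 : 0 <= (lam * h) * (h * (lam - g)) by rewrite !mulr_ge0// subr_ge0.
nra.
Qed.

Lemma step_upper (a h : R) : 0 <= h ->
  F a - F (a - h) <= h * (G a - lam * F (a - h)) + 2 * (lam * h) ^+ 2.
Proof.
move=> h0; have /andP[_ H] := step a h0.
have lh : 0 <= lam * h by exact: mulr_ge0.
have /andP[p1 p2] := exp_lower lh; have p3 := exp_upper lh.
have /andP[f0 f1] := F01 (a - h); have /andP[g0 g1] := G_bound a.
move: H p1 p2 p3 lh; set p := expR _; set f := F (a - h); set g := G a => H p1 p2 p3 lh.
have e1 : 0 <= ((lam * h) ^+ 2 - (p - (1 - lam * h))) * f by rewrite mulr_ge0// ; lra.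
have e1' : 0 <= (lam * h) ^+ 2 * (1 - f) by rewrite mulr_ge0 ?exprn_ge0// subr_ge0.
have e2 : 0 <= (1 - p) * (h * g) by rewrite !mulr_ge0// subr_ge0.
have e3 : 0 <= (p - (1 - lam * h)) * (1 + lam * h) by rewrite mulr_ge0 ?subr_ge0// addr_ge0.
nra.
Qed.

Lemma step_lipschitz (x y : R) : x <= y -> y - x <= 1 ->
  F y - F x <= (lam + 2 * lam ^+ 2) * (y - x).
Proof.
move=> xy xy1; have h0 : 0 <= y - x by rewrite subr_ge0.
have := step_upper y h0; rewrite subKr => H.
have /andP[f0 f1] := F01 x; have /andP[g0 g1] := G_bound y.
have e1 : 0 <= lam * F x by exact: mulr_ge0.
have e2 : 0 <= (y - x) * (lam - (G y - lam * F x)) by rewrite mulr_ge0//; lra.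
have e3 : 0 <= lam ^+ 2 * (y - x) * (1 - (y - x)) by rewrite !mulr_ge0 ?exprn_ge0 ?subr_ge0.
rewrite exprMn in H; nra.
Qed.

Lemma step_continuous : continuous F.
Proof.
move=> a; pose C := lam + 2 * lam ^+ 2 + 1.
have C0 : 0 < C by rewrite ltr_wpDl// addr_ge0// mulr_ge0// exprn_ge0.
apply/cvgrPdist_le => eps eps0; near=> x.
have xa1 : `|a - x| <= 1 by near: x; apply: cvgr_dist_le.
have xae : `|a - x| <= eps / C by near: x; apply: cvgr_dist_le => //; rewrite divr_gt0.
have lip u v : u <= v -> v - u <= 1 -> v - u <= eps / C -> `|F v - F u| <= eps.
  move=> uv uv1 uve; rewrite ger0_norm ?subr_ge0 ?F_nondec//.
  apply: (le_trans (step_lipschitz uv uv1)).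
  move: uve; rewrite ler_pdivlMr// => uve; apply: le_trans uve.
  by rewrite mulrC ler_wpM2l ?subr_ge0// /C lerDl.
have [ax|xa] := leP a x.
  rewrite distrC; apply: lip => //.
  - by rewrite -[leLHS]ger0_norm ?subr_ge0// distrC.
  - by rewrite -[leLHS]ger0_norm ?subr_ge0// distrC.
apply: lip; first exact: ltW.
- by rewrite -[leLHS]ger0_norm ?subr_ge0// ltW.
- by rewrite -[leLHS]ger0_norm ?subr_ge0// ltW.
Unshelve. all: by end_near. Qed.

Lemma step_le0 a : a <= 0 -> F a = 0.
Proof.
suff F0 : F 0 <= 0.
  move=> a0; apply/eqP; rewrite eq_le; apply/andP; split.
    exact: le_trans (F_nondec a0) F0.
  by case/andP: (F01 a).
apply/ler_addgt0Pl => eps eps0; rewrite addr0.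
pose h := Num.min 1 (eps / (lam + 2 * lam ^+ 2 + 1)).
have C0 : 0 < lam + 2 * lam ^+ 2 + 1 by rewrite ltr_wpDl// addr_ge0// mulr_ge0// exprn_ge0.
have h0 : 0 < h by rewrite lt_min ltr01 divr_gt0.
have h1 : h <= 1 by rewrite ge_min lexx.
have he : h * (lam + 2 * lam ^+ 2 + 1) <= eps by rewrite -ler_pdivlMr// ge_min lexx orbT.
have := @step_lipschitz (- h) 0; rewrite oppr_le0 sub0r opprK (ltW h0) => /(_ isT h1).
rewrite (@F_neg (- h)) ?oppr_lt0// subr0 => /le_trans; apply; apply: le_trans he.
by rewrite mulrC ler_wpM2l ?(ltW h0)// lerDl.
Qed.

Hypothesis G_cont : continuous G.

(** For the right increments the inequalities are used at [a + h], for the left ones at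
    [a]; continuity of F and G gives both the same limit. *)
Lemma step_is_derive (a : R) : is_derive a 1 F (G a - lam * F a).
Proof.
have F_cont := step_continuous.
suff H : h^-1 *: (F (h + a) - F a) @[h --> 0^'] --> G a - lam * F a.
  have H' : h^-1 *: ((F \o shift a) (h *: 1) - F a) @[h --> 0^'] --> G a - lam * F a.
    have E (u : R) : u *: (1 : R^o) = u by rewrite /GRing.scale/= mulr1.
    by under eq_fun do rewrite /= E.
  split; first by apply/cvg_ex; exists (G a - lam * F a).
  by rewrite /derive; apply/cvg_lim.
apply/cvgrPdist_le => eps eps0.
have e4 : 0 < eps / 4 by rewrite divr_gt0.
have shift_cvg : h + a @[h --> 0^'] --> a.
  rewrite -[X in _ --> X]add0r; apply: cvgD; last exact: cvg_cst.
  exact: nbhs_dnbhs.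
near=> h.
have h_neq0 : h != 0 by near: h; exact: nbhs_dnbhs_neq.
have dG : `|G a - G (h + a)| <= eps / 4.
  by near: h; apply: cvgr_dist_le => //; apply: cvg_comp shift_cvg _; exact: G_cont.
have dF : `|lam * F a - lam * F (h + a)| <= eps / 4.
  near: h; apply: cvgr_dist_le => //; apply: cvgM; first exact: cvg_cst.
  by apply: cvg_comp shift_cvg _; exact: F_cont.
have dh : `|0 - 2 * lam ^+ 2 * h| <= eps / 4.
  near: h; apply: cvgr_dist_le => //.
  rewrite -[X in _ --> X](mulr0 (2 * lam ^+ 2)); apply: cvgM; first exact: cvg_cst.
  exact: nbhs_dnbhs.
set q := h^-1 *: _.
have hq : h * q = F (h + a) - F a by rewrite /q /GRing.scale/= mulVKf.
move: dG dF dh; rewrite !ler_norml sub0r => /andP[dG1 dG2] /andP[dF1 dF2] /andP[dh1 dh2].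
have [hpos|hneg] := ltP 0 h.
  have := step_lower (h + a) (ltW hpos); have := step_upper (h + a) (ltW hpos).
  rewrite addrAC subrr add0r -hq => up lo.
  have up' : q <= G (h + a) - lam * F a + 2 * lam ^+ 2 * h.
    by rewrite -(ler_pM2l hpos); apply: (le_trans up); rewrite le_eqVlt; apply/orP; left; apply/eqP; ring.
  have lo' : G a - lam * F a - lam ^+ 2 * h <= q.
    by rewrite -(ler_pM2l hpos); apply: le_trans lo; rewrite le_eqVlt; apply/orP; left; apply/eqP; ring.
  have lh : 0 <= lam ^+ 2 * h by rewrite mulr_ge0 ?exprn_ge0// ltW.
  by apply/andP; split; lra.
have kpos : 0 < - h by rewrite oppr_gt0 lt_neqAle h_neq0.
have := step_lower a (ltW kpos); have := step_upper a (ltW kpos).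
have qE : F a - F (h + a) = (- h) * q by rewrite mulNr hq opprB.
rewrite opprK [a + h]addrC qE => up lo.
have up' : q <= G a - lam * F (h + a) + 2 * lam ^+ 2 * (- h).
  by rewrite -(ler_pM2l kpos); apply: (le_trans up); rewrite le_eqVlt; apply/orP; left; apply/eqP; ring.
have lo' : G (h + a) - lam * F (h + a) - lam ^+ 2 * (- h) <= q.
  by rewrite -(ler_pM2l kpos); apply: le_trans lo; rewrite le_eqVlt; apply/orP; left; apply/eqP; ring.
have lh : 0 <= lam ^+ 2 * (- h) by rewrite mulr_ge0 ?exprn_ge0// ltW.
by apply/andP; split; lra.
Unshelve. all: by end_near. Qed.

End step_derivative.

(** * Decay of the coefficients *)

Lemma dom_series (R : realType) (a b : R ^nat) :
  (forall j, `|a j| <= b j) -> cvgn (series b) ->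
  cvgn (series a) /\ `|limn (series a)| <= limn (series b).
Proof.
move=> ab cb.
have cn : cvgn [normed series a].
  apply: series_le_cvg cb => n //=.
  exact: le_trans (ab n).
split; first exact: (@normed_cvg _ R^o).
apply: (le_trans (@lim_series_norm _ R^o _ cn)).
exact: lim_series_le.
Qed.

Lemma le_lim_norm (R : realType) (u : R ^nat) (b : R) : cvgn u ->
  (\forall n \near \oo, `|u n| <= b) -> `|limn u| <= b.
Proof.
move=> cu ub; rewrite ler_norml; apply/andP; split.
  by apply: limr_ge => //; apply: (filterS _ ub) => n; rewrite ler_norml => /andP[].
by apply: limr_le => //; apply: (filterS _ ub) => n; rewrite ler_norml => /andP[].
Qed.

Section coefficients.
Context {R : realType}.
Variables (e lam : R) (ups c : nat -> R).
Hypothesis e0 : 0 < e.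
Hypothesis lam0 : 0 < lam.
Hypothesis ups0 : forall k, 0 <= ups k.
Hypothesis ups_le : forall n, \sum_(k < n) ups k <= lam.
Hypothesis c0 : c 0%N = 1.
Hypothesis c_rec : forall j, c j * (1 - expR (e * j%:R)) * lam =
  \sum_(k < j) expR (e * k.+1%:R) * c (j - k.+1)%N * ups k.

Let nt j := c j * expR (- (e * j%:R)).

(** Damping c_j by exp(-e j) removes the growing factors of the recursion. *)
Lemma nt_rec j : lam * (nt j - c j) = \sum_(k < j) ups k * nt (j - k.+1)%N.
Proof.
have h := c_rec j.
transitivity (expR (- (e * j%:R)) * (c j * (1 - expR (e * j%:R)) * lam)).
  have E := expRxMexpNx_1 (e * j%:R); rewrite /nt.
  set y := expR (- _) in E *; set x := expR _ in E *.
  rewrite (_ : y * _ = lam * (c j * y - c j * (x * y))); last by ring.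
  by rewrite E mulr1.
rewrite h mulr_sumr; apply: eq_bigr => k _; rewrite /nt.
have -> : expR (- (e * (j - k.+1)%:R)) = expR (- (e * j%:R)) * expR (e * k.+1%:R).
  by rewrite -expRD; congr expR; rewrite natrB// mulrBr opprB addrC.
ring.
Qed.

Let r : R := expR (- e).
Let r01 : 0 < r < 1.
Proof. by rewrite expR_gt0 -expR0 ltr_expR oppr_lt0. Qed.

Let expRn j : expR (e * j%:R) = expR e ^+ j.
Proof. by rewrite mulrC -expRM_natl mulr_natl. Qed.

Let e1 : 1 < expR e. Proof. by rewrite -expR0 ltr_expR. Qed.

Let gap j : (expR e - 1) * expR e ^+ j <= expR e ^+ j.+1 - 1.
Proof.
by rewrite mulrBl mul1r exprS lerD2l lerN2 exprn_ege1// ltW.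
Qed.

(** The right-hand side of [nt_rec] is at most lam times the largest earlier term, while
    c_j exceeds the damped coefficient by the factor exp(e j). *)
Lemma nt_step j B : (forall i, (i < j)%N -> `|nt i| <= B) -> (0 < j)%N ->
  `|nt j| * (expR e ^+ j - 1) <= B.
Proof.
case: j => [//|j] HB _.
have B0 : 0 <= B by apply: le_trans (HB 0%N isT).
have cE : c j.+1 = nt j.+1 * expR e ^+ j.+1.
  by rewrite /nt -expRn -mulrA [expR (- _) * _]mulrC expRxMexpNx_1 mulr1.
have h := nt_rec j.+1.
have h2 : lam * (`|nt j.+1| * (expR e ^+ j.+1 - 1)) <= lam * B.
  have -> : lam * (`|nt j.+1| * (expR e ^+ j.+1 - 1)) = `|lam * (nt j.+1 - c j.+1)|.
    rewrite cE -{2}[nt j.+1]mulr1 -mulrBr !normrM (gtr0_norm lam0); congr (_ * (_ * _)).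
    by rewrite distrC ger0_norm// subr_ge0 exprn_ege1// ltW.
  rewrite h; apply: (le_trans (ler_norm_sum _ _ _)).
  apply: (@le_trans _ _ (\sum_(k < j.+1) ups k * B)).
    apply: ler_sum => k _; rewrite normrM ger0_norm//; apply: ler_wpM2l => //.
    by apply: HB; rewrite subSS ltnS leq_subr.
  by rewrite -mulr_suml; apply: ler_wpM2r.
by rewrite ler_pM2l in h2.
Qed.

(** Once exp(e j) is at least 2, [nt_step] propagates a bound without loss. *)
Lemma nt_bounded : exists2 A, 0 < A & forall j, `|nt j| <= A.
Proof.
have [J HJ] : exists J : nat, forall j, (J <= j)%N -> 2 <= expR e ^+ j.
  pose J := (Num.truncn (e^-1)).+1; exists J => j Jj.
  have J1 : 1 <= e * j%:R.
    rewrite mulrC -ler_pdivrMr// div1r; apply: ltW; apply: (lt_le_trans (truncnS_gt _)).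
    by rewrite ler_nat.
  rewrite -expRn; apply: le_trans (expR_ge1Dx _); rewrite -[2]/(1 + 1); exact: lerD.
pose A := 1 + \sum_(i < J) `|nt i|.
have A0 : 0 < A by rewrite ltr_pwDl// sumr_ge0.
exists A => // j; elim/ltn_ind: j => j IH.
have [jJ|Jj] := ltnP j J.
  rewrite /A (bigD1 (Ordinal jJ))//= addrCA lerDl addr_ge0// sumr_ge0//.
have j0 : (0 < j)%N.
  rewrite lt0n; apply/eqP => j0; move: (HJ j Jj); rewrite j0 expr0; lra.
have := nt_step IH j0; apply: le_trans.
rewrite ler_peMr// lerBrDr; apply: le_trans (HJ j Jj); lra.
Qed.

(** [nt_step] once more, now starting from boundedness. *)
Lemma nt_geometric : exists2 C, 0 < C & forall j, `|nt j| <= C * r ^+ j.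
Proof.
have [A A0 HA] := nt_bounded.
have g0 : 0 < expR e - 1 by rewrite subr_gt0.
exists (A + A / (expR e - 1) * expR e).
  by rewrite addr_gt0// mulr_gt0 ?expR_gt0// divr_gt0.
have rE j : r ^+ j = (expR e ^+ j)^-1 by rewrite /r expRN exprVn.
move=> [|j].
  rewrite expr0 mulr1; apply: (le_trans (HA 0%N)).
  by rewrite lerDl mulr_ge0 ?expR_ge0// divr_ge0// ltW.
apply: (@le_trans _ _ (A / (expR e - 1) * expR e * r ^+ j.+1)); last first.
  by rewrite ler_pM2r ?lerDr ?(ltW A0)// exprn_gt0//; case/andP: r01.
have xj : 0 < expR e ^+ j by rewrite exprn_gt0// expR_gt0.
have -> : A / (expR e - 1) * expR e * r ^+ j.+1 = A / ((expR e - 1) * expR e ^+ j).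
  rewrite rE exprS; field; rewrite !gt_eqF ?expR_gt0//.
rewrite ler_pdivlMr ?mulr_gt0//; apply: le_trans (nt_step (fun i _ => HA i) (ltn0Sn j)).
by apply: ler_wpM2l.
Qed.

End coefficients.

(** * Sums of exponential waves *)

Lemma exp_taylor2 (R : realType) (u : R) : `|expR (- u) - 1 + u| <= u ^+ 2 * expR `|u|.
Proof.
have lo : 0 <= expR (- u) - 1 + u by have := expR_ge1Dx (- u); lra.
rewrite ger0_norm//; have [u0|u0] := leP 0 u.
  rewrite ger0_norm//.
  have x1 : 0 < 1 + u by rewrite ltr_pwDl.
  have h : expR (- u) <= (1 + u)^-1.
    by rewrite expRN lef_pV2 ?posrE ?expR_gt0// expR_ge1Dx.
  have h' : expR (- u) * (1 + u) <= 1 by rewrite -ler_pdivlMr// div1r.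
  have E1 : 1 <= expR u by rewrite -expR0 ler_expR.
  have h2 : expR (- u) - 1 + u <= u ^+ 2.
    have p0 := expR_ge0 (- u).
    rewrite -(ler_pM2r x1).
    have : 0 <= u ^+ 3 by rewrite exprn_ge0.
    have -> : u ^+ 3 = u * (u * u) by ring.
    nra.
  by apply: (le_trans h2); rewrite ler_peMr// exprn_ge0.
rewrite ltr0_norm//.
have p0 := expR_gt0 (- u).
have E := expRxMexpNx_1 u; have h := expR_ge1Dx u.
have hu : 0 <= (1 - u) * (expR u - (1 + u)) by rewrite mulr_ge0//; lra.
have : 0 <= expR (- u) * ((1 - u) * (expR u - (1 + u))) by rewrite mulr_ge0// ltW.
have -> : expR (- u) * ((1 - u) * (expR u - (1 + u))) =
  (1 - u) * (expR u * expR (- u)) - (1 - u ^+ 2) * expR (- u) by ring.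
rewrite E; nra.
Qed.

Lemma is_derive_quad (R : realType) (f : R -> R) (x l K dl : R) : 0 < dl ->
  (forall h, `|h| <= dl -> `|f (x + h) - f x - h * l| <= K * h ^+ 2) ->
  is_derive x 1 f l.
Proof.
move=> dl0 H.
suff C : h^-1 *: (f (h + x) - f x) @[h --> 0^'] --> l.
  have H' : h^-1 *: ((f \o shift x) (h *: 1) - f x) @[h --> 0^'] --> l.
    have E (u : R) : u *: (1 : R^o) = u by rewrite /GRing.scale/= mulr1.
    by under eq_fun do rewrite /= E.
  split; first by apply/cvg_ex; exists l.
  by rewrite /derive; apply/cvg_lim.
apply/cvgrPdist_le => eps eps0; near=> h.
have h_neq0 : h != 0 by near: h; exact: nbhs_dnbhs_neq.
have h1 : `|0 - h| <= dl by near: h; apply: cvgr_dist_le => //; exact: nbhs_dnbhs.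
have h2 : `|0 - h| <= eps / (`|K| + 1).
  near: h; apply: cvgr_dist_le; first exact: nbhs_dnbhs.
  by rewrite divr_gt0// ltr_wpDl.
rewrite !sub0r !normrN in h1 h2.
have := H h h1; rewrite [x + h]addrC => H1.
have -> : l - h^-1 *: (f (h + x) - f x) = - h^-1 * (f (h + x) - f x - h * l).
  by rewrite /GRing.scale/=; field.
rewrite normrM normrN normfV ler_pdivrMl ?normr_gt0//.
apply: (le_trans H1).
have -> : h ^+ 2 = `|h| * `|h| by rewrite -expr2 real_normK ?num_real.
rewrite mulrCA ler_pM2l ?normr_gt0// mulrC.
move: h2; rewrite ler_pdivlMr ?ltr_wpDl//; apply: le_trans.
rewrite ler_wpM2l//; apply: le_trans (ler_norm K) _; by rewrite lerDl.
Unshelve. all: by end_near. Qed.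

Section waves.
Context {R : realType}.
Variables (e lam C : R) (ups c : nat -> R).
Hypothesis e0 : 0 < e.
Hypothesis lam0 : 0 < lam.
Hypothesis C0 : 0 < C.
Hypothesis ups0 : forall k, 0 <= ups k.
Hypothesis ups_le : forall n, \sum_(k < n) ups k <= lam.
Hypothesis c0 : c 0%N = 1.

Let nt j := c j * expR (- (e * j%:R)).
Let r : R := expR (- e).
Hypothesis nt_le : forall j, `|nt j| <= C * r ^+ j.
Hypothesis nt_rec : forall j, lam * (nt j - c j) = \sum_(k < j) ups k * nt (j - k.+1)%N.

Let r0 : 0 < r. Proof. exact: expR_gt0. Qed.
Let r1 : r < 1. Proof. by rewrite -expR0 ltr_expR oppr_lt0. Qed.
Let nr1 : `|r| < 1. Proof. by rewrite gtr0_norm. Qed.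
Let A := C * (1 - r)^-1.
Let A0 : 0 < A. Proof. by rewrite divr_gt0// subr_gt0. Qed.

Definition wave (j : nat) (x : R) : R := expR (- (expR (e * j%:R) * x * lam)).

(** The identity that makes the family of waves stable under the jumps x -> x exp(e k). *)
Lemma wave_shift j k x : wave (j + k) x = wave j (x * expR (e * k%:R)).
Proof.
by rewrite /wave natrD mulrDr expRD [x * expR _]mulrC mulrA.
Qed.

Lemma wave_gt0 j x : 0 < wave j x. Proof. exact: expR_gt0. Qed.

Lemma wave_le1 j x : 0 <= x -> wave j x <= 1.
Proof.
by move=> x0; rewrite -expR0 ler_expR oppr_le0 !mulr_ge0// ?expR_ge0// ltW.
Qed.

Lemma wave_noninc j k x : 0 <= x -> (j <= k)%N -> wave k x <= wave j x.
Proof.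
move=> x0 jk; rewrite ler_expR lerN2 ler_pM2r// ler_wpM2r// ler_expR.
by rewrite ler_pM2l// ler_nat.
Qed.

Let exp_r j : expR (e * j%:R) * r ^+ j = 1.
Proof. by rewrite /r -expRM_natl -mulr_natl mulrN [_ * e]mulrC expRxMexpNx_1. Qed.

Let cE j : c j = nt j * expR (e * j%:R).
Proof. by rewrite /nt -mulrA [expR (- _) * _]mulrC expRxMexpNx_1 mulr1. Qed.

Lemma wave_decay j x : 0 < x -> expR (e * j%:R) * wave j x <= (x * lam)^-1.
Proof.
move=> x0; have xl : 0 < x * lam by exact: mulr_gt0.
rewrite -div1r ler_pdivlMr// /wave mulrAC expRN.
rewrite ler_pdivrMr ?expR_gt0// mul1r mulrA.
by apply: le_trans (expR_ge1Dx _); rewrite lerDr.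
Qed.

Lemma c_wave_le j x : 0 < x -> `|c j * wave j x| <= C * (x * lam)^-1 * r ^+ j.
Proof.
move=> x0; rewrite normrM (gtr0_norm (wave_gt0 _ _)) cE normrM (gtr0_norm (expR_gt0 _)) -mulrA.
rewrite mulrAC.
by apply: ler_pM => //; [rewrite mulr_ge0 ?expR_ge0// ltW// wave_gt0|exact: wave_decay].
Qed.

Lemma nt_wave_le j x : 0 <= x -> `|nt j * wave j x| <= C * r ^+ j.
Proof.
move=> x0; rewrite normrM (gtr0_norm (wave_gt0 _ _)) -[leRHS]mulr1.
by apply: ler_pM => //; [rewrite ltW// wave_gt0|exact: wave_le1].
Qed.

Let geo a : cvgn (series (fun j => a * r ^+ j)).
Proof. apply: (@is_cvg_geometric_series R a r); exact: nr1. Qed.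

Let limgeo a : limn (series (fun j => a * r ^+ j)) = a * (1 - r)^-1.
Proof. by apply/cvg_lim => //; exact: cvg_geometric_series. Qed.

Lemma cvg_c_wave x : 0 < x -> cvgn (series (fun j => c j * wave j x)).
Proof. by move=> x0; case: (dom_series (fun j => c_wave_le j x0) (@geo _)). Qed.

Lemma cvg_nt_wave x : 0 <= x -> cvgn (series (fun j => nt j * wave j x)).
Proof. by move=> x0; case: (dom_series (fun j => nt_wave_le j x0) (@geo _)). Qed.

Lemma cvg_nt : cvgn (series nt).
Proof. by case: (dom_series nt_le (@geo _)). Qed.

(** Up to constant factors, [wave_sum] is the tail of the law and [wave_dsum] its density. *)
Definition wave_sum x := limn (series (fun j => nt j * wave j x)).
Definition wave_dsum x := limn (series (fun j => c j * wave j x)).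

Lemma wave_sum0 : wave_sum 0 = limn (series nt).
Proof.
rewrite /wave_sum; congr (limn (series _)); apply/funext => j.
by rewrite /wave mulr0 mul0r oppr0 expR0 mulr1.
Qed.

(** Waves decrease with their index, so the tail is its first wave times a geometric
    series. *)
Lemma wave_sum_tail p x : 0 <= x ->
  `|wave_sum x - \sum_(j < p) nt j * wave j x| <= A * wave p x.
Proof.
move=> x0; pose a j := if (j < p)%N then 0 else nt j * wave j x.
have aE n : (p <= n)%N -> series a n = series (fun j => nt j * wave j x) n - \sum_(j < p) nt j * wave j x.
  move=> pn; rewrite /series/= -(big_mkord xpredT (fun j => nt j * wave j x)).
  rewrite (big_cat_nat (leq0n p) pn)/= (big_cat_nat (leq0n p) pn)/=.
  rewrite addrAC subrr add0r big_nat_cond big1 ?add0r.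
    rewrite big_nat_cond [RHS]big_nat_cond; apply: eq_bigr => j /andP[/andP[pj _] _].
    by rewrite /a ltnNge pj.
  by move=> j /andP[/andP[_ jp] _]; rewrite /a jp.
have al j : `|a j| <= C * wave p x * r ^+ j.
  rewrite /a; case: ltnP => pj.
    by rewrite normr0 !mulr_ge0// ltW// ?wave_gt0// exprn_gt0.
  rewrite normrM (gtr0_norm (wave_gt0 _ _)) mulrAC; apply: ler_pM => //.
    by rewrite ltW// wave_gt0.
  exact: wave_noninc.
have [ca] := dom_series al (@geo _); rewrite limgeo.
rewrite (_ : limn (series a) = wave_sum x - \sum_(j < p) nt j * wave j x).
  by move=> h; apply: (le_trans h); rewrite /A mulrAC.
apply/cvg_lim => //.
have h : series (fun j => nt j * wave j x) n - \sum_(j < p) nt j * wave j x @[n --> \oo]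
   --> wave_sum x - \sum_(j < p) nt j * wave j x.
  by apply: cvgB; [exact: cvg_nt_wave|exact: cvg_cst].
apply: cvg_trans h; apply: near_eq_cvg; near=> n.
by rewrite aE//; near: n; exists p.
Unshelve. all: by end_near. Qed.

Lemma wave_sum_le x : 0 <= x -> `|wave_sum x| <= A * wave 0 x.
Proof. by move=> x0; have := wave_sum_tail 0 x0; rewrite big_ord0 subr0. Qed.

Lemma wave_sum_first x : 0 <= x -> `|wave_sum x - wave 0 x| <= A * wave 1 x.
Proof.
move=> x0; have := wave_sum_tail 1 x0; rewrite big_ord_recl big_ord0 addr0.
by rewrite /nt c0 mulr0 oppr0 expR0 !mul1r.
Qed.

(** Termwise differentiation. The second order remainder of the wave of index j is, with
    m = lam exp(e j), at most (m h)^2 exp(-m x / 2), which is bounded by a multiple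
    of h^2 uniformly in j. *)
Lemma wave_dsum_deriv (x : R) : 0 < x -> is_derive x 1 wave_sum (- (lam * wave_dsum x)).
Proof.
move=> x0.
have x2 : 0 < x / 2 by rewrite divr_gt0.
apply: (@is_derive_quad _ _ _ _ (16 / x ^+ 2 * A) (x / 2)) => // h hx.
have xh0 : 0 <= x + h by move: hx; rewrite ler_norml => /andP[h1 h2]; lra.
pose a j := nt j * (wave j (x + h) - wave j x + h * (lam * (expR (e * j%:R) * wave j x))).
have aE n : series a n = series (fun j => nt j * wave j (x + h)) n -
    series (fun j => nt j * wave j x) n + h * (lam * series (fun j => c j * wave j x) n).
  rewrite /series/= !mulr_sumr -sumrB -big_split/=; apply: eq_bigr => j _.
  rewrite /a cE; move: (wave j (x + h)) (wave j x) (nt j) (expR _) => w w' m E.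
  ring.
have al j : `|a j| <= C * (16 / x ^+ 2 * h ^+ 2) * r ^+ j.
  pose m := expR (e * j%:R) * lam.
  have m0 : 0 < m by rewrite mulr_gt0 ?expR_gt0.
  have -> : a j = nt j * (wave j x * (expR (- (m * h)) - 1 + m * h)).
    rewrite /a; have -> : wave j (x + h) = wave j x * expR (- (m * h)).
      by rewrite /wave -expRD; congr expR; rewrite /m; move: (expR _) => E; ring.
    rewrite /m; set w := wave j x; set n := nt j; set E := expR (- _); set E' := expR (e * _).
    clearbody w n E E'; ring.
  rewrite normrM [leRHS]mulrAC; apply: ler_pM => //.
  rewrite normrM (gtr0_norm (wave_gt0 _ _)).
  apply: (@le_trans _ _ (wave j x * ((m * h) ^+ 2 * expR (m * x / 2)))).
    rewrite ler_pM2l ?wave_gt0//; apply: (le_trans (exp_taylor2 _)).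
    apply: ler_wpM2l; first exact: sqr_ge0.
    by rewrite ler_expR normrM (gtr0_norm m0) -mulrA ler_pM2l.
  have -> : wave j x = expR (- (m * x)).
    by rewrite /wave /m; congr (expR (- _)); move: (expR _) => E; ring.
  have -> : expR (- (m * x)) * ((m * h) ^+ 2 * expR (m * x / 2)) =
      (m * h) ^+ 2 * expR (- (m * x / 2)).
    rewrite mulrCA -expRD; congr (_ * expR _); by field.
  have h4 : m * x * expR (- (m * x / 4)) <= 4.
    rewrite expRN ler_pdivrMr ?expR_gt0//.
    have := expR_ge1Dx (m * x / 4); lra.
  have -> : expR (- (m * x / 2)) = expR (- (m * x / 4)) ^+ 2.
    rewrite -expRM_natl; congr expR; by field.
  rewrite [leRHS]mulrAC ler_pdivlMr ?exprn_gt0//.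
  have -> : (m * h) ^+ 2 * expR (- (m * x / 4)) ^+ 2 * x ^+ 2 =
      (m * x * expR (- (m * x / 4))) ^+ 2 * h ^+ 2.
    by move: (expR _) => E; ring.
  apply: ler_wpM2r; first exact: sqr_ge0.
  have -> : 16 = 4 ^+ 2 :> R by ring.
  rewrite lerXn2r// ?nnegrE// mulr_ge0 ?expR_ge0// mulr_ge0// ltW//.
have [_] := dom_series al (@geo _); rewrite limgeo.
have -> : limn (series a) = wave_sum (x + h) - wave_sum x - h * (- (lam * wave_dsum x)).
  apply/cvg_lim => //; rewrite mulrN opprK.
  rewrite (_ : series a = fun n => series (fun j => nt j * wave j (x + h)) n -
    series (fun j => nt j * wave j x) n + h * (lam * series (fun j => c j * wave j x) n)); last first.
    exact/funext.
  apply: cvgD; first by apply: cvgB; apply: cvg_nt_wave => //; exact: ltW.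
  apply: cvgM; first exact: cvg_cst.
  by apply: cvgM; [exact: cvg_cst|exact: cvg_c_wave].
move=> H; apply: (le_trans H); rewrite /A le_eqVlt; apply/orP; left; apply/eqP.
by move: ((1 - r)^-1) (x ^+ 2)^-1 => u v; ring.
Qed.

(** Summation along the diagonals j + k + 1 = m: by [wave_shift] the terms on a diagonal
    share the same wave, and [nt_rec] sums their coefficients. *)
Lemma triangle_sum x N :
  \sum_(m < N.+1) (lam * (nt m - c m)) * wave m x =
  \sum_(k < N) ups k * \sum_(j < N - k) nt j * wave j (x * expR (e * k.+1%:R)).
Proof.
elim: N => [|N IH].
  by rewrite big_ord0 big_ord_recl big_ord0 /nt mulr0 oppr0 expR0 mulr1 subrr mulr0 mul0r addr0.
rewrite big_ord_recr/= IH nt_rec mulr_suml.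
have -> : \sum_(k < N) ups k * \sum_(j < N - k) nt j * wave j (x * expR (e * k.+1%:R)) =
  \sum_(k < N.+1) ups k * \sum_(j < N - k) nt j * wave j (x * expR (e * k.+1%:R)).
  by rewrite [RHS]big_ord_recr/= subnn big_ord0 mulr0 addr0.
rewrite -big_split/=; apply: eq_bigr => k _.
have kN : (k <= N)%N by rewrite -ltnS.
rewrite subSS subSn// big_ord_recr/= mulrDr; congr (_ + _).
by rewrite -wave_shift addnS subnK// mulrA.
Qed.

Lemma wave_cvg0 x : 0 < x -> wave n x @[n --> \oo] --> 0.
Proof.
move=> x0.
have h : (x * lam)^-1 * r ^+ n @[n --> \oo] --> 0.
  exact: (@cvg_geometric R (x * lam)^-1 r nr1).
apply: (squeeze_cvgr _ (cvg_cst 0) h); apply: nearW => n.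
rewrite (ltW (wave_gt0 _ _))/=.
have := wave_decay n x0; rewrite -ler_pdivlMl ?expR_gt0//; move/le_trans; apply.
rewrite [leRHS]mulrC; apply: ler_wpM2r; first by rewrite invr_ge0 mulr_ge0// ltW.
by rewrite -(ler_pM2l (expR_gt0 (e * n%:R))) mulfV ?gt_eqF ?expR_gt0// exp_r.
Qed.

(** The wave sum H satisfies H' = - lam H + sum_k ups_k H (x exp(e (k+1))); here the
    derivative appears as - lam [wave_dsum]. *)
Lemma wave_sum_rates x : 0 < x ->
  series (fun k => ups k * wave_sum (x * expR (e * k.+1%:R))) n @[n --> \oo] -->
  lam * (wave_sum x - wave_dsum x).
Proof.
move=> x0.
have h1 : \sum_(m < n.+1) (lam * (nt m - c m)) * wave m x @[n --> \oo] -->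
    lam * (wave_sum x - wave_dsum x).
  have -> : (fun n => \sum_(m < n.+1) (lam * (nt m - c m)) * wave m x) =
    (fun n => lam * (series (fun j => nt j * wave j x) n.+1 - series (fun j => c j * wave j x) n.+1)).
    apply/funext => n; rewrite /series/= !big_mkord -sumrB mulr_sumr; apply: eq_bigr => m _.
    by rewrite -mulrA mulrBl.
  apply: cvgM; first exact: cvg_cst.
  apply: cvgB.
    by rewrite (cvg_shiftS (series (fun j => nt j * wave j x))); apply: cvg_nt_wave; exact: ltW.
  by rewrite (cvg_shiftS (series (fun j => c j * wave j x))); exact: cvg_c_wave.
have h2 : lam * A * wave n x @[n --> \oo] --> 0.
  by rewrite -[X in _ --> X](mulr0 (lam * A)); apply: cvgM; [exact: cvg_cst|exact: wave_cvg0].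
pose d n := series (fun k => ups k * wave_sum (x * expR (e * k.+1%:R))) n -
  \sum_(m < n.+1) (lam * (nt m - c m)) * wave m x.
have d0 : d n @[n --> \oo] --> 0.
  apply: norm_cvg0; apply: (squeeze_cvgr _ (cvg_cst 0) h2); apply: nearW => n.
  rewrite normr_ge0/= /d triangle_sum /series/= big_mkord -sumrB.
  apply: (le_trans (ler_norm_sum _ _ _)).
  apply: (@le_trans _ _ (\sum_(k < n) ups k * (A * wave n x))).
    apply: ler_sum => k _; rewrite -mulrBr normrM ger0_norm//; apply: ler_wpM2l => //.
    have y0 : 0 <= x * expR (e * k.+1%:R) by rewrite mulr_ge0 ?expR_ge0// ltW.
    apply: (le_trans (wave_sum_tail _ y0)); rewrite ler_pM2l// -wave_shift.
    by apply: wave_noninc; [exact: ltW|rewrite addnS subnK// ltnW].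
  rewrite -mulr_suml mulrA; apply: ler_wpM2r; first by rewrite ltW// wave_gt0.
  by apply: ler_wpM2r; [exact: ltW|exact: ups_le].
have -> : series (fun k => ups k * wave_sum (x * expR (e * k.+1%:R))) =
    (fun n => d n + \sum_(m < n.+1) (lam * (nt m - c m)) * wave m x).
  by apply/funext => n; rewrite /d subrK.
rewrite -[X in _ --> X]add0r; exact: cvgD.
Qed.

(** The defect 1 - [wave j x] is at most sqrt(lam x) exp(e j / 2), and the decay exp(-e j)
    of the coefficients absorbs the growing factor. *)
Lemma wave_sum_at0 : wave_sum x @[x --> 0^'+] --> limn (series nt).
Proof.
pose s : R := expR (- (e / 2)).
have s0 : 0 < s by exact: expR_gt0.
have s1 : s < 1 by rewrite -expR0 ltr_expR oppr_lt0 divr_gt0.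
have ns1 : `|s| < 1 by rewrite gtr0_norm.
have small (v : R) : 0 <= v -> 1 - expR (- v ^+ 2) <= v.
  move=> v0; have [v1|v1] := leP v 1.
    have := expR_ge1Dx (- v ^+ 2); nra.
  have := expR_ge0 (- v ^+ 2); lra.
pose K := C * (1 - s)^-1.
have K0 : 0 < K by rewrite divr_gt0// subr_gt0.
have bound x : 0 <= x -> `|wave_sum x - wave_sum 0| <= K * Num.sqrt (x * lam).
  move=> x0; have xl : 0 <= x * lam by rewrite mulr_ge0// ltW.
  pose a j := nt j * wave j x - nt j * wave j 0.
  have al j : `|a j| <= C * Num.sqrt (x * lam) * s ^+ j.
    have w0 : wave j 0 = 1 by rewrite /wave mulr0 mul0r oppr0 expR0.
    rewrite /a w0 -mulrBr normrM distrC (ger0_norm (_ : 0 <= 1 - wave j x)); last first.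
      by rewrite subr_ge0 wave_le1.
    have rs : r ^+ j = s ^+ j * s ^+ j.
      by rewrite -exprMn; congr (_ ^+ _); rewrite /s -expRD; congr expR; field.
    have sj : 0 < s ^+ j by exact: exprn_gt0.
    have se : s ^+ j * s ^+ j * expR (e * j%:R) = 1 by rewrite -rs mulrC exp_r.
    pose v := Num.sqrt (x * lam) / s ^+ j.
    have v0 : 0 <= v by rewrite divr_ge0 ?sqrtr_ge0// ltW.
    have vE : v ^+ 2 = expR (e * j%:R) * x * lam.
      rewrite /v expr_div_n sqr_sqrtr//.
      apply: (@mulIf _ ((s ^+ j) ^+ 2)); first by rewrite expf_neq0// gt_eqF.
      rewrite mulfVK; last by rewrite expf_neq0// gt_eqF.
      move: se; set u := s ^+ j; set E := expR (e * j%:R) => se.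
      rewrite [RHS](_ : _ = u * u * E * (x * lam)); first by rewrite se mul1r.
      by clearbody u E; ring.
    have := small v v0; rewrite vE -/(wave j x) => H.
    have e0' : 0 <= 1 - wave j x by rewrite subr_ge0 wave_le1.
    apply: (le_trans (ler_pM _ e0' (nt_le j) H)) => //.
    rewrite rs /v le_eqVlt; apply/orP; left; apply/eqP; field; by rewrite gt_eqF.
  have [_] := dom_series al (@is_cvg_geometric_series R _ s ns1).
  have -> : limn (series (fun j => C * Num.sqrt (x * lam) * s ^+ j)) = C * Num.sqrt (x * lam) * (1 - s)^-1.
    by apply/cvg_lim => //; exact: (@cvg_geometric_series R _ s ns1).
  rewrite (_ : limn (series a) = wave_sum x - wave_sum 0).
    by move=> H; apply: (le_trans H); rewrite /K mulrAC.
  apply/cvg_lim => //; rewrite (_ : series a = fun n => series (fun j => nt j * wave j x) n - series (fun j => nt j * wave j 0) n).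
    by apply: cvgB; apply: cvg_nt_wave.
  by apply/funext => n; rewrite /series/= -sumrB.
rewrite -wave_sum0; apply/cvgrPdist_le => eps eps0; near=> x.
have x0 : 0 < x by near: x; exact: nbhs_right_gt.
have xs : x <= (eps / K) ^+ 2 / lam.
  by near: x; apply: nbhs_right_le; rewrite divr_gt0// exprn_gt0// divr_gt0.
rewrite distrC; apply: (le_trans (bound x (ltW x0))).
have E : eps / K = Num.sqrt ((eps / K) ^+ 2).
  by rewrite sqrtr_sqr ger0_norm// divr_ge0// ltW.
by rewrite mulrC -ler_pdivlMr// E ler_sqrt ?sqr_ge0// -ler_pdivlMr.
Unshelve. all: by end_near. Qed.

End waves.

(** * A maximum principle for the renewal equation *)

Lemma derive_ge0_nondec (R : realType) (f f' : R -> R) (x y : R) :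
  (forall z, x <= z <= y -> is_derive z 1 f (f' z)) ->
  (forall z, x <= z <= y -> 0 <= f' z) -> x <= y -> f x <= f y.
Proof.
move=> df f'0 xy.
have cf : {within `[x, y], continuous f}.
  apply: derivable_within_continuous => z; rewrite in_itv/= => zxy.
  by have [] := df z zxy.
have [|c] := MVT_segment (df := f') xy _ cf.
  move=> z; rewrite in_itv/= => /andP[h1 h2]; apply: df; by rewrite (ltW h1) (ltW h2).
rewrite in_itv/= => cxy fxy; rewrite -subr_ge0 fxy mulr_ge0 ?subr_ge0//; exact: f'0.
Qed.

Section ode.
Context {R : realType}.
Variable lam : R.
Hypothesis lam0 : 0 < lam.

(** exp(lam x) (S - D x) is nondecreasing and tends to S at 0. *)
Lemma ode_half (D D' : R -> R) (S : R) :
  (forall x : R, 0 < x -> is_derive x 1 D (D' x)) -> D x @[x --> 0^'+] --> 0 ->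
  (forall x, 0 < x -> D' x + lam * D x <= lam * S) ->
  forall x, 0 < x -> D x <= S * (1 - expR (- (lam * x))).
Proof.
move=> dD D0 DS y y0.
pose K x := expR (lam * x) * (S - D x).
have dK (x : R) : 0 < x -> is_derive x 1 K (expR (lam * x) * (lam * S - (D' x + lam * D x))).
  move=> x0; have dx := dD x x0.
  have d1 : is_derive x 1 (fun x : R => expR (lam * x)) (expR (lam * x) * lam).
    apply: (@is_derive1_comp _ _ (fun x => lam * x)).
    by apply: is_derive_eq; rewrite /GRing.scale/= mulr1.
  have d2 : is_derive x 1 (fun x => S - D x) (- D' x).
    by apply: (is_derive_eq (is_deriveB (is_derive_cst S x 1) dx)); rewrite sub0r.
  have dKK := is_deriveM d1 d2.
  apply: (is_derive_eq dKK).
  by rewrite /GRing.scale/=; move: (expR _) => E; ring.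
have Kmono x : 0 < x -> x <= y -> K x <= K y.
  move=> x0 xy; apply: (@derive_ge0_nondec _ K (fun x => expR (lam * x) * (lam * S - (D' x + lam * D x))) x y _ _ xy).
  - by move=> z /andP[xz _]; apply: dK; exact: lt_le_trans xz.
  - by move=> z /andP[xz _]; rewrite mulr_ge0 ?expR_ge0// subr_ge0 DS//; exact: lt_le_trans xz.
have K0 : K x @[x --> 0^'+] --> S.
  rewrite -[X in _ --> X](_ : expR (lam * 0) * (S - 0) = S); last by rewrite mulr0 expR0 mul1r subr0.
  apply: cvgM; last by apply: cvgB => //; exact: cvg_cst.
  have ce : {for 0, continuous (fun x : R => expR (lam * x))}.
    apply: continuous_comp; last exact: continuous_expR.
    by apply: mulrl_continuous.
  exact: cvg_at_right_filter ce.
have SK : S <= K y.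
  apply: (cvgr_to_le K0); near=> x; apply: Kmono; first by near: x; exact: nbhs_right_gt.
  by near: x; exact: nbhs_right_le.
move: SK; rewrite /K; have p0 := expR_gt0 (lam * y); rewrite mulrC -ler_pdivrMr// -expRN.
by move=> h; rewrite mulrBr mulr1; lra.
Unshelve. all: by end_near. Qed.

(** A maximum principle. Let S be the supremum of |D|. By [ode_half], |D x| is at most
    S (1 - exp(-lam x)), which stays away from S on bounded sets, and |D| is at most
    S / 2 near infinity; hence S cannot be positive. *)
Lemma ode_unique (D D' : R -> R) (bnd : R) :
  (forall x : R, 0 < x -> is_derive x 1 D (D' x)) -> D x @[x --> 0^'+] --> 0 ->
  D x @[x --> +oo] --> 0 ->
  (forall x, 0 < x -> `|D x| <= bnd) ->
  (forall S, (forall y, 0 < y -> `|D y| <= S) ->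
     forall x, 0 < x -> `|D' x + lam * D x| <= lam * S) ->
  forall x, 0 < x -> D x = 0.
Proof.
move=> dD D0 Doo Db DS.
have contr S : (forall y, 0 < y -> `|D y| <= S) ->
    forall x, 0 < x -> `|D x| <= S * (1 - expR (- (lam * x))).
  move=> HS x x0; rewrite ler_norml; apply/andP; split; last first.
    apply: (ode_half dD D0) => // z z0.
    by apply: le_trans (ler_norm _) _; exact: DS.
  rewrite lerNl; apply: (ode_half (D := fun x => - D x) (D' := fun x => - D' x)) => //.
  - by move=> z z0; have := dD z z0; exact: is_deriveN.
  - by rewrite -[X in _ --> X]oppr0; exact: cvgN.
  - move=> z z0; rewrite mulrN -opprD; apply: le_trans (ler_norm _) _.
    by rewrite normrN; exact: DS.
pose V := [set `|D x| | x in [set x | 0 < x]].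
have supV : has_sup V.
  split; first by exists `|D 1|; exists 1 => //=.
  by exists bnd => _ [x x0 <-]; exact: Db.
pose S := sup V.
have leS y : 0 < y -> `|D y| <= S.
  by move=> y0; apply: (sup_upper_bound supV); exists y.
have [S0|S0] := leP S 0.
  by move=> x x0; apply/eqP; rewrite -normr_le0; exact: le_trans (leS x x0) S0.
have S2 : 0 < S / 2 by rewrite divr_gt0.
have [B B0 HB] : exists2 B, 0 < B & forall x, B <= x -> `|D x| <= S / 2.
  have /cvgr0Pnorm_le/(_ _ S2) [B [_ HB]] := Doo.
  exists (Num.max B 0 + 1); first by rewrite ltr_wpDl// le_max lexx orbT.
  move=> x Bx; apply: HB; apply: lt_le_trans Bx.
  by rewrite (@le_lt_trans _ _ (Num.max B 0)) ?le_max ?lexx// ltrDl.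
pose rho := Num.max (S / 2) (S * (1 - expR (- (lam * B)))).
have rhoS : rho < S.
  rewrite gt_max; apply/andP; split; first by lra.
  have := expR_gt0 (- (lam * B)); nra.
have : S <= rho.
  apply: ge_sup; first by case: supV.
  move=> _ [x /= x0 <-]; rewrite le_max.
  have [Bx|xB] := leP B x; first by rewrite HB.
  apply/orP; right; apply: (le_trans (contr S leS x x0)).
  rewrite ler_pM2l// lerD2l lerN2 ler_expR lerN2 ler_pM2l//; exact: ltW.
by rewrite leNgt rhoS.
Qed.

End ode.

(** * Almost sure finiteness of the integral *)

Section poisson_laplace.
Context {R : realType} {d d' : measure_display} {T : measurableType d}
  {E : measurableType d'} (P : probability T R) (M : R.-ker T ~> E)
  (mu : set E -> \bar R).
Hypothesis prm : poisson_random_measure P M mu.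

Lemma poisson_laplace (B : set E) (th : R) : measurable B -> (mu B < +oo)%E ->
  (\int[P]_w expeR (- (th%:E * M w B)) =
   (expR (- (fine (mu B) * (1 - expR (- th)))))%:E)%E.
Proof.
move=> mB fB; pose A k := [set w | M w B = k%:R%:E].
have mA k : measurable (A k) by exact: measurable_count.
have mU : measurable (\bigcup_k A k) by exact: bigcup_measurable.
have PUC : P (~` \bigcup_k A k) = 0%E.
  by rewrite probability_setC// (prm_count_nat prm mB fB) subee.
have mf : measurable_fun setT (fun w => expeR (- (th%:E * M w B))).
  apply: measurableT_comp; first exact: measurable_expeR.
  apply: measurableT_comp => //; apply: measurable_funeM; exact: measurable_kernel.
have -> : (\int[P]_w expeR (- (th%:E * M w B)) =
    \int[P]_(w in \bigcup_k A k) expeR (- (th%:E * M w B)))%E.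
  rewrite (ge0_negligible_integral _ (N := ~` (\bigcup_k A k)))//.
  - by rewrite setDE setCK setTI.
  - exact: measurableC.
  - by move=> w _; exact: expeR_ge0.
rewrite ge0_integral_bigcup//; last 3 first.
- exact: measurable_funTS.
- by move=> w _; exact: expeR_ge0.
- by move=> i j _ _ [w [h1 h2]]; apply: (@natr_injective R); apply: EFin_inj; rewrite -h1 -h2.
case: prm => pois _ _.
set m := fine (mu B).
have term k : (\int[P]_(w in A k) expeR (- (th%:E * M w B)) =
    (exp_coeff (m * expR (- th)) k * expR (- m))%:E)%E.
  rewrite (eq_integral (cst (expR (- (th * k%:R)))%:E)); last first.
    by move=> w; rewrite inE => ->.
  rewrite integral_cst// [X in (_ * X)%E](pois B mB fB k) -EFinM; congr EFin.
  rewrite -/m /exp_coeff/= exprMn -expRM_natl mulrC.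
  have -> : expR (k%:R * - th) = expR (- (th * k%:R)) by congr expR; ring.
  by move: (expR _) (expR (- m)) => u v; rewrite [in RHS]mulrAC; ring.
under eq_eseriesr do rewrite term.
have -> : (fun n : nat => \sum_(0 <= k < n) (exp_coeff (m * expR (- th)) k * expR (- m))%:E)%E =
  EFin \o (fun n => series (exp_coeff (m * expR (- th))) n * expR (- m)).
  by apply/funext => n /=; rewrite sumEFin big_distrl.
apply/cvg_lim => //; apply: cvg_EFin; first exact: nearW.
rewrite (_ : expR (- (m * (1 - expR (- th)))) = expR (m * expR (- th)) * expR (- m)).
  by apply: cvgM; [exact: is_cvg_series_exp_coeff|exact: cvg_cst].
by rewrite -expRD; congr expR; ring.
Qed.

End poisson_laplace.

Section finiteness.
Context {R : realType} {d : measure_display} {T : measurableType d}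
  (P : probability T R) (nu : {sigma_finite_measure set R -> \bar R})
  (M : R.-ker T ~> (R * R)%type) (e th : R).
Hypothesis prm : poisson_random_measure P M (jump_intensity nu).
Hypothesis e0 : 0 < e.
Hypothesis th0 : 0 < th.
Hypothesis nu_fin : (nu `[e, +oo[ < +oo)%E.
Hypothesis nu_pos : (0 < nu `[e, +oo[)%E.

Let cnt (t : R) w : \bar R := M w (`]0, t] `*` `[e, +oo[).
Let f w t : \bar R := expeR (- (th%:E * cnt t w)).

Let cnt_nondec (t u : R) w : t <= u -> (cnt t w <= cnt u w)%E.
Proof.
move=> tu; apply: le_measure; rewrite ?inE; [exact: measurableX|exact: measurableX|].
move=> [x y] [/= xst my]; split=> //=.
by move: xst; rewrite !in_itv/= => /andP[-> /le_trans]; exact.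
Qed.

Let f0 w t : (0 <= f w t)%E. Proof. exact: expeR_ge0. Qed.
Let f1 w t : (f w t <= 1)%E.
Proof.
have /expeRN_ge0_le1 /andP[_ h] : (0 <= th%:E * cnt t w)%E.
  by apply: mule_ge0; rewrite ?lee_fin ?(ltW th0)//.
exact: h.
Qed.
Let f_noninc w t u : 0 <= t -> t <= u -> (f w u <= f w t)%E.
Proof.
move=> _ tu; rewrite lee_expeR leeN2 lee_wpmul2l ?lee_fin ?(ltW th0)//; exact: cnt_nondec.
Qed.

Lemma count_exp_measurable w : measurable_fun (`[0, +oo[ : set R) (fun t : R => expeR (- (th%:E * M w (`]0%R, t] `*` `[e, +oo[)))%E).
Proof. exact: (measurable_noninc (f0 w) (f1 w) (@f_noninc w)). Qed.

(** The integral is at most the sum of the integrand over the integers, whose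
    expectation is a geometric series by [poisson_laplace]. *)
Lemma count_exp_integral_ae :
  {ae P, forall w, (\int[@lebesgue_measure R]_(t in `[0%R, +oo[)
     expeR (- (th%:E * M w (`]0%R, t] `*` `[e, +oo[))) < +oo)%E}.
Proof.
pose lam := fine (nu `[e, +oo[).
have lamE : nu `[e, +oo[ = lam%:E by rewrite fineK// ge0_fin_numE.
have lam0 : 0 < lam by rewrite -lte_fin -lamE.
pose rho := expR (- (lam * (1 - expR (- th)))).
have rho1 : `|rho| < 1.
  rewrite gtr0_norm ?expR_gt0// -expR0 ltr_expR oppr_lt0 mulr_gt0// subr_gt0.
  by rewrite -expR0 ltr_expR oppr_lt0.
have mf i : measurable_fun setT (fun w => f w i%:R).
  apply: measurableT_comp; first exact: measurable_expeR.
  apply: measurableT_comp => //; apply: measurable_funeM; apply: measurable_kernel.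
  exact: measurableX.
have term (i : nat) : (\int[P]_w f w i%:R = (rho ^+ i)%:E)%E.
  have sub : `[e, +oo[ `<=` (`]0, +oo[ : set R).
    by move=> z /=; rewrite !in_itv/= !andbT; exact: lt_le_trans.
  have iE : jump_intensity nu (`]0, i%:R] `*` `[e, +oo[) = (i%:R * lam)%:E.
    by rewrite jump_intensity_rect// subr0 lamE.
  rewrite /f /cnt (poisson_laplace prm); [|exact: measurableX|by rewrite iE ltry].
  by rewrite iE /= /rho -expRM_natl; congr (expR _)%:E; ring.
have mS : measurable_fun setT (fun w => \sum_(0 <= i <oo) f w i%:R)%E.
  by apply: ge0_emeasurable_sum => // i _; exact: mf.
have iS : P.-integrable setT (fun w => \sum_(0 <= i <oo) f w i%:R)%E.
  apply/integrableP; split => //.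
  under eq_integral do rewrite gee0_abs ?nneseries_ge0//.
  rewrite integral_nneseries//.
  under eq_eseriesr do rewrite term.
  have -> : (fun n : nat => \sum_(0 <= i < n) (rho ^+ i)%:E)%E =
     EFin \o series (geometric 1 rho).
    by apply/funext => n /=; rewrite sumEFin; congr EFin; apply: eq_bigr => i _; rewrite /= mul1r.
  rewrite (_ : limn _ = (1 * (1 - rho)^-1)%:E) ?ltry//.
  by apply/cvg_lim => //; apply: cvg_EFin; [exact: nearW|exact: cvg_geometric_series].
apply: filterS (integrable_ae measurableT iS) => w /(_ I) Sfin.
apply: (@le_lt_trans _ _ (\sum_(0 <= i <oo) f w i%:R)%E); last first.
  by rewrite -ge0_fin_numE// nneseries_ge0.
have cvgI : (\int[@lebesgue_measure R]_(t in `[0%R, n%:R[) f w t @[n --> \oo] -->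
    \int[@lebesgue_measure R]_(t in `[0%R, +oo[) f w t)%E.
  have -> : `[0, +oo[%classic = \bigcup_n `[0, n%:R[%classic :> set R.
    apply/seteqP; split=> [t|t [n _]] /=; last first.
      by rewrite !in_itv/= andbT => /andP[].
    rewrite in_itv/= andbT => st; exists (Num.truncn t).+1 => //=.
    by rewrite in_itv/= st/= truncnS_gt.
  apply: ge0_nondecreasing_set_cvg_integral => //.
  - move=> n m nm; apply/subsetPset => t /=; rewrite !in_itv/= => /andP[-> h]/=.
    by rewrite (lt_le_trans h)// ler_nat.
  - move=> n; apply: (@measurable_funS _ _ _ _ (`[0%R : R, +oo[%classic)) => //.
      by move=> t /=; rewrite !in_itv/= andbT => /andP[].
    exact: count_exp_measurable.
apply: (cvge_to_le cvgI); apply: nearW => n.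
have /andP[_] := integral_lower_upper (f0 w) (f1 w) (@f_noninc w) n ltr01.
rewrite mulr1 add0r => /le_trans; apply.
rewrite /upper_sum; under eq_bigr do rewrite mul1e mulr1 add0r.
by rewrite -(big_mkord xpredT (fun i => f w i%:R)); exact: nneseries_lim_ge.
Qed.

End finiteness.

(** * The density for a fixed mesh *)

Section fixed_mesh.
Context {R : realType} {d : measure_display} {T : measurableType d}
  (P : probability T R) (nu : {sigma_finite_measure set R -> \bar R})
  (M : R.-ker T ~> (R * R)%type) (e : R).
Hypothesis prm : poisson_random_measure P M (jump_intensity nu).
Hypothesis e0 : 0 < e.
Hypothesis nu_fin : (nu `[e, +oo[ < +oo)%E.
Hypothesis nu_pos : (0 < nu `[e, +oo[)%E.

Let lam := jump_rate nu e.
Let F := expint_cdf P M e.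
Let G := rjump_mean P nu M e.

Lemma jump_rateE : nu `[e, +oo[ = lam%:E.
Proof. by rewrite fineK// ge0_fin_numE. Qed.

Lemma jump_rate_gt0 : 0 < lam.
Proof. by rewrite -lte_fin -jump_rateE. Qed.

Let lam0 := jump_rate_gt0.

Lemma expint_cdfE b : (F b)%:E = P [set w | (expint M e 0%R w <= b%:E)%E].
Proof.
rewrite fineK// fin_num_measure//.
exact/measurable_le_set/(measurable_expint M e0).
Qed.

Lemma expint_cdf01 a : 0 <= F a <= 1.
Proof.
rewrite -!lee_fin expint_cdfE probability_le1 ?andbT//.
exact/measurable_le_set/(measurable_expint M e0).
Qed.

Lemma expint_cdf_nondec : {homo F : a b / a <= b}.
Proof. exact: expint_cdf_nondecreasing. Qed.

Lemma expint_cdf_neg (a : R) : a < 0 -> F a = 0.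
Proof.
move=> a0; apply: EFin_inj; rewrite expint_cdfE (_ : [set w | _] = set0) ?measure0//.
apply/seteqP; split=> // w /=; apply/negP; rewrite -ltNge.
apply: (@lt_le_trans _ _ 0%E); first by rewrite lte_fin.
by apply: integral_ge0 => t _; exact: expeR_ge0.
Qed.

Lemma rjump_mean_bound a : 0 <= G a <= lam.
Proof.
have := jump_mean_bounds P M e0 nu_fin a.
by rewrite (jump_meanE P M e0 nu_fin) !lee_fin.
Qed.

Let step (a h : R) : 0 <= h ->
  expR (- (lam * h)) * F (a - h) + h * expR (- (lam * h)) * G (a - h) <= F a <=
  expR (- (lam * h)) * F (a - h) + h * expR (- (lam * h)) * G a +
    (1 - expR (- (lam * h)) * (1 + lam * h)).
Proof. exact: cdf_step. Qed.

Lemma expint_cdf_continuous : continuous F.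
Proof.
exact: (step_continuous (ltW lam0) expint_cdf01 expint_cdf_nondec rjump_mean_bound step).
Qed.

Lemma expint_cdf_le0 a : a <= 0 -> F a = 0.
Proof.
exact: (step_le0 (ltW lam0) expint_cdf01 expint_cdf_nondec expint_cdf_neg rjump_mean_bound step).
Qed.

Let mF (a : R) : measurable_fun setT (fun z => F (a * expR (quantize e z))).
Proof.
apply: measurableT_comp.
  by apply: nondecreasing_measurable => //; exact: expint_cdf_nondec.
apply: measurable_funM => //; apply: measurableT_comp; first exact: measurable_expR.
exact: measurable_quantize.
Qed.

Let intF (a : R) : nu.-integrable `[e, +oo[ (EFin \o (fun z => F (a * expR (quantize e z)))).
Proof.
apply: measurable_bounded_integrable => //; first exact: measurable_funTS.
exists 1; split => // x x1 z _ /=; have /andP[h1 h2] := expint_cdf01 (a * expR (quantize e z)).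
by rewrite ger0_norm// (le_trans h2)// ltW.
Qed.

Let intc (k : R) : nu.-integrable `[e, +oo[ (EFin \o (cst k : R -> R)).
Proof.
apply: measurable_bounded_integrable => //.
exists `|k|; split; first exact: num_real.
by move=> x x1 z _ /=; exact: ltW.
Qed.

Lemma rjump_mean_continuous : continuous G.
Proof.
move=> a; apply: (@continuity_under_integral _ _ _ nu
   (fun l z => F (l * expR (quantize e z))) `[e, +oo[%classic _ (a - 1) (a + 1) _ _ (cst 1)) => //.
- apply: aeW => z _ l _.
  apply: (cvg_comp (fun l => l * expR (quantize e z)) F); last exact: expint_cdf_continuous.
  by apply: cvgM; [exact: cvg_id|exact: cvg_cst].
- move=> x _; apply: aeW => z _; have /andP[h1 h2] := expint_cdf01 (x * expR (quantize e z)).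
  by rewrite ger0_norm.
- by rewrite inE/= in_itv/= ltrBlDr ltrDl ltr01.
Qed.

Lemma expint_cdf_is_derive (a : R) : is_derive a 1 F (G a - lam * F a).
Proof.
exact: (step_is_derive (ltW lam0) expint_cdf01 expint_cdf_nondec rjump_mean_bound step rjump_mean_continuous).
Qed.

Lemma quantize_small (z : R) : 0 <= z < e -> quantize e z = 0.
Proof.
by move=> ze; rewrite (@quantize_cell _ _ e0 0) ?mulr0// mulr1.
Qed.

(** The derivative of F, in a form that does not involve the rate of all jumps: small jumps
    contribute small increments of F, and the expression has a limit as the mesh
    tends to zero. *)
Definition mesh_density (x : R) : R :=
  \int[nu]_(z in `]0, +oo[) (F (x * expR (quantize e z)) - F x).

Lemma mesh_density_restrict (x : R) :
  mesh_density x = \int[nu]_(z in `[e, +oo[) (F (x * expR (quantize e z)) - F x).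
Proof.
rewrite /mesh_density Rintegral_mkcond [RHS]Rintegral_mkcond.
apply: eq_Rintegral => z _; rewrite !patchE.
case: ifPn; rewrite ?inE ?notin_setE/= in_itv/= andbT => z0.
  case: ifPn; rewrite ?inE ?notin_setE/= in_itv/= andbT => // /negP; rewrite -ltNge => ze.
  by rewrite quantize_small ?(ltW z0)// expR0 mulr1 subrr.
case: ifPn; rewrite ?inE ?notin_setE/= in_itv/= andbT => // ez.
by case: z0; exact: lt_le_trans ez.
Qed.

Lemma mesh_densityE (x : R) : mesh_density x = G x - lam * F x.
Proof.
rewrite mesh_density_restrict RintegralB//; last exact: intc.
congr (_ - _); rewrite Rintegral_cst//.
by rewrite mulrC.
Qed.

Lemma mesh_density_is_derive (x : R) : is_derive x 1 F (mesh_density x).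
Proof. by rewrite mesh_densityE; exact: expint_cdf_is_derive. Qed.

Lemma mesh_density_continuous : continuous mesh_density.
Proof.
rewrite (_ : mesh_density = (fun x => G x - lam * F x)); last exact/funext/mesh_densityE.
move=> x; apply: cvgB; first exact: rjump_mean_continuous.
by apply: cvgM; [exact: cvg_cst|exact: expint_cdf_continuous].
Qed.

Lemma mesh_density_bounds (x : R) : 0 <= x -> 0 <= mesh_density x <= lam.
Proof.
move=> x0; apply/andP; split.
  rewrite mesh_density_restrict; apply: Rintegral_ge0 => z /=; rewrite in_itv/= andbT => ez.
  rewrite subr_ge0 expint_cdf_nondec// ler_peMr// -expR0 ler_expR; exact: quantize_ge0.
rewrite mesh_densityE; have /andP[_ h] := rjump_mean_bound x.
apply: le_trans h; rewrite gerBl mulr_ge0 ?(ltW lam0)//.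
by case/andP: (expint_cdf01 x).
Qed.

Lemma level_ge_count (t : R) w :
  (e%:E * M w (`]0%R, t] `*` `[e, +oo[) <= level M e 0%R t w)%E.
Proof.
rewrite -integral_cst; last exact: measurableX.
apply: ge0_le_integral => //.
- exact: measurableX.
- by move=> p _; rewrite lee_fin ltW.
- apply: measurable_funTS; apply/measurable_EFinP.
  by apply: measurableT_comp; [exact: measurable_quantize|exact: measurable_snd].
- move=> [x y] [_ /=]; rewrite in_itv/= andbT lee_fin => ey.
  rewrite /quantize ler_peMr ?(ltW e0)//.
  have : 0 < Num.floor (y / e) by rewrite floor_gt0 ler_pdivlMr// mul1r.
  by rewrite gtz0_ge1 ler1z.
Qed.

Lemma expint_finite_ae : {ae P, forall w, (expint M e 0%R w < +oo)%E}.
Proof.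
apply: filterS (count_exp_integral_ae prm e0 e0 nu_fin nu_pos) => w; apply: le_lt_trans.
apply: ge0_le_integral => //.
- by move=> t _; exact: expeR_ge0.
- by apply: measurable_exp_path => [??|???? ?]; [exact: level_ge0|exact: level_nondec].
- exact: count_exp_measurable.
- by move=> t _; rewrite lee_expeR leeN2 level_ge_count.
Qed.

Let mle (b : \bar R) : measurable [set w | (expint M e 0%R w <= b)%E].
Proof. exact/measurable_le_set/(measurable_expint M e0). Qed.

Lemma expint_cdf_cvg1 : F x @[x --> +oo] --> (1 : R).
Proof.
pose A (n : nat) := [set w | (expint M e 0%R w <= n%:R%:E)%E].
have mA n : measurable (A n) by exact: mle.
have mU : measurable (\bigcup_n A n) by exact: bigcup_measurable.
have PU : P (\bigcup_n A n) = 1%E.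
  rewrite -(setTI (\bigcup_n A n)) (measure_ae_setI (P := P)) ?probability_setT//.
  apply: filterS expint_finite_ae => w fin.
  have ge0 : (0 <= expint M e 0%R w)%E by apply: integral_ge0 => t _; exact: expeR_ge0.
  exists (Num.truncn (fine (expint M e 0%R w))).+1 => //=; rewrite /A/=.
  rewrite -[leLHS]fineK; last by rewrite ge0_fin_numE.
  by rewrite lee_fin ltW// truncnS_gt.
have Acvg : P (A n) @[n --> \oo] --> 1%E.
  rewrite -PU; apply: nondecreasing_cvg_mu => //.
  move=> m n mn; apply/subsetPset => w; rewrite /A/= => /le_trans; apply.
  by rewrite lee_fin ler_nat.
have Fcvg : F n%:R @[n --> \oo] --> (1 : R).
  have : (F n%:R)%:E @[n --> \oo] --> 1%E.
    by under eq_fun do rewrite expint_cdfE.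
  by move/fine_cvg.
apply/cvgrPdist_le => eps eps0.
have /cvgrPdist_le/(_ _ eps0) [n0 _ Hn] := Fcvg.
near=> x.
have xn : n0%:R <= x by near: x; exact: nbhs_pinfty_ge.
have := Hn n0 (leqnn _) => /=; have /andP[_ h1] := expint_cdf01 x.
have h2 := expint_cdf_nondec xn.
have /andP[_ h3] := expint_cdf01 n0%:R.
by rewrite !ger0_norm ?subr_ge0//; apply: le_trans; rewrite lerD2l lerN2.
Unshelve. all: by end_near. Qed.

Let ups k := cell_rate nu e k.

Let ups_ge0 k : 0 <= ups k.
Proof. exact: fine_ge0. Qed.

Let real_series (f : nat -> R) (l : R) : (forall k, 0 <= f k) ->
  (\sum_(0 <= k <oo) (f k)%:E = l%:E)%E -> series f n @[n --> \oo] --> l.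
Proof.
move=> f0 fl.
have h : (\sum_(0 <= k < n) (f k)%:E)%E @[n --> \oo] --> l%:E.
  by rewrite -fl; apply: is_cvg_nneseries => k _ _; rewrite lee_fin.
have h2 := fine_cvg h.
rewrite (_ : series f = fine \o (fun n => (\sum_(0 <= k < n) (f k)%:E)%E)); first exact: h2.
by apply/funext => n /=; rewrite sumEFin.
Qed.

Let ups_cvg : series ups n @[n --> \oo] --> lam.
Proof. by apply: real_series => //; exact: cell_rate_series. Qed.

Let ups_le n : \sum_(k < n) ups k <= lam.
Proof.
rewrite -(big_mkord xpredT ups) -(cvg_lim (@Rhausdorff R) ups_cvg).
apply: (nondecreasing_cvgn_le _ (cvgP _ ups_cvg)).
by apply: nondecreasing_series => k _ _.
Qed.

Let rjump_cvg x : series (fun k => ups k * F (x * expR (e * k.+1%:R))) n @[n --> \oo] --> G x.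
Proof.
apply: real_series.
  by move=> k; rewrite mulr_ge0//; case/andP: (expint_cdf01 (x * expR (e * k.+1%:R))).
rewrite -(jump_meanE P M e0 nu_fin) (jump_mean_series P M e0 nu_fin).
by apply: eq_eseriesr => k _; rewrite EFinM.
Qed.

Lemma upsilon_sumE : upsilon_sum nu e = lam.
Proof.
rewrite /upsilon_sum -[RHS]/(fine lam%:E) -(cell_rate_series e0 nu_fin); congr fine.
rewrite -[LHS](nneseries_addn 1)//; apply: eq_eseriesr => k _; rewrite addn1.
rewrite /cell_rate fineK// ge0_fin_numE//; apply: le_lt_trans nu_fin.
apply: le_measure; rewrite ?inE// => z /=; rewrite !in_itv/= andbT => /andP[h _].
by apply: le_trans h; rewrite ler_peMr ?(ltW e0)// ler1n.
Qed.

Section formula.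
Variable c : nat -> R.
Hypothesis c_coef : density_coefficients nu e c.

Let c0 : c 0%N = 1. Proof. by case: c_coef. Qed.

Let c_rec j : c j * (1 - expR (e * j%:R)) * lam =
  \sum_(k < j) expR (e * k.+1%:R) * c (j - k.+1)%N * ups k.
Proof.
case: j => [|j]; first by rewrite big_ord0 mulr0 expR0 subrr mulr0 mul0r.
case: c_coef => _ /(_ j.+1 isT); rewrite upsilon_sumE.
rewrite big_add1 big_mkord => ->.
rewrite -mulrA mulrC mulrA mulfV ?mul1r//.
apply: mulf_neq0; last by rewrite gt_eqF.
by rewrite subr_eq0 lt_eqF// -{1}expR0 ltr_expR mulr_gt0.
Qed.

Let nt_recc := nt_rec c_rec.

(** The wave sum H and the tail 1 - F satisfy the same equation. With g0 the value of H at
    0+, the difference D = H - g0 (1 - F) vanishes at 0 and at infinity, so D = 0 by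
    [ode_unique], and differentiating gives the formula. *)
Lemma mesh_density_formula :
  [/\ cvgn (series (norm_term e c)),
      forall x : R, 0 < x -> cvgn (series (density_term nu e c x))
    & forall x : R, 0 < x -> mesh_density x = density_formula nu e c x].
Proof.
have [C C0 ntC] := nt_geometric e0 lam0 ups_ge0 ups_le c_rec.
have termE x : density_term nu e c x = (fun j => c j * wave e lam j x).
  by apply/funext => j; rewrite /density_term upsilon_sumE.
pose A := C * (1 - expR (- e))^-1.
have A0 : 0 < A by rewrite divr_gt0// subr_gt0 -expR0 ltr_expR oppr_lt0.
pose H := wave_sum e lam c; pose Dn := wave_dsum e lam c.
pose g0 := limn (series (norm_term e c)).
have Hle x : 0 <= x -> `|H x| <= A * wave e lam 0 x by exact: wave_sum_le.
have wave0 x : wave e lam 0 x = expR (- (x * lam)) by rewrite /wave mulr0 expR0 mul1r.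
pose D x := H x - g0 * (1 - F x).
pose D' x := - (lam * Dn x) + g0 * mesh_density x.
have dD (x : R) : 0 < x -> is_derive x 1 D (D' x).
  move=> x0.
  have d1 : is_derive x 1 H (- (lam * Dn x)) by exact: (wave_dsum_deriv e0 lam0 ntC).
  have d2 := mesh_density_is_derive x.
  have d3 : is_derive x 1 (fun x => g0 * (1 - F x)) (- (g0 * mesh_density x)).
    have d4 := is_deriveB (is_derive_cst (1 : R) x 1) d2.
    have d5 := is_deriveZ g0 d4.
    apply: (is_derive_eq d5); rewrite sub0r /GRing.scale/=; by rewrite mulrN.
  apply: (is_derive_eq (is_deriveB d1 d3)).
  by rewrite opprK.
have D0 : D x @[x --> 0^'+] --> 0.
  rewrite -[X in _ --> X](_ : g0 - g0 * (1 - F 0) = 0).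
    apply: cvgB; first exact: (wave_sum_at0 e0 lam0 C0 ntC).
    apply: cvgM; first exact: cvg_cst.
    apply: cvgB; first exact: cvg_cst.
    apply: cvg_at_right_filter; exact: expint_cdf_continuous.
  by rewrite expint_cdf_le0// subr0 mulr1 subrr.
have Hoo : H x @[x --> +oo] --> 0.
  apply/cvgr0Pnorm_le => eps eps0; near=> x.
  have x0 : 0 < x by near: x; exact: nbhs_pinfty_gt.
  have xb : A / eps / lam <= x by near: x; apply: nbhs_pinfty_ge; exact: num_real.
  apply: (le_trans (Hle x (ltW x0))); rewrite wave0 expRN ler_pdivrMr ?expR_gt0//.
  rewrite mulrC -ler_pdivrMr//; apply: le_trans (expR_ge1Dx _).
  by move: xb; rewrite ler_pdivrMr// => xb; apply: (le_trans xb); rewrite lerDr.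
have Doo : D x @[x --> +oo] --> 0.
  rewrite -[X in _ --> X](_ : 0 - g0 * (1 - 1) = 0); last by rewrite subrr mulr0 subr0.
  apply: cvgB; first exact: Hoo.
  apply: cvgM; first exact: cvg_cst.
  by apply: cvgB; [exact: cvg_cst|exact: expint_cdf_cvg1].
have Dbnd x : 0 < x -> `|D x| <= A + `|g0|.
  move=> x0; apply: (le_trans (ler_normB _ _)); apply: lerD.
    apply: (le_trans (Hle x (ltW x0))); rewrite -[leRHS]mulr1 ler_pM2l//.
    by apply: wave_le1 => //; exact: ltW.
  rewrite normrM -[leRHS]mulr1; apply: ler_wpM2l => //.
  by have /andP[h1 h2] := expint_cdf01 x; rewrite ger0_norm ?subr_ge0// gerBl.
have DS S : (forall y, 0 < y -> `|D y| <= S) ->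
    forall x, 0 < x -> `|D' x + lam * D x| <= lam * S.
  move=> HS x x0.
  have h1 : series (fun k => ups k * H (x * expR (e * k.+1%:R))) n @[n --> \oo] --> lam * (H x - Dn x).
    exact: (wave_sum_rates e0 lam0 C0 ups_ge0 ups_le ntC nt_recc).
  have h2 := @rjump_cvg x; have h3 := ups_cvg.
  have h4 : series (fun k => ups k * D (x * expR (e * k.+1%:R))) n @[n --> \oo] -->
      lam * (H x - Dn x) - g0 * (lam - G x).
    rewrite (_ : series _ = (fun n => series (fun k => ups k * H (x * expR (e * k.+1%:R))) n -
      g0 * (series ups n - series (fun k => ups k * F (x * expR (e * k.+1%:R))) n))).
      apply: cvgB; first exact: h1.
      by apply: cvgM; [exact: cvg_cst|exact: cvgB].
    apply/funext => n; rewrite /series/= -sumrB mulr_sumr -sumrB; apply: eq_bigr => k _.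
    by rewrite /D; move: (H _) (F _) (ups k) => a b u; ring.
  have -> : D' x + lam * D x = lam * (H x - Dn x) - g0 * (lam - G x).
    rewrite /D' /D mesh_densityE; move: (H x) (Dn x) (G x) (F x) => a b u v; ring.
  rewrite -(cvg_lim (@Rhausdorff R) h4); apply: le_lim_norm; first exact: cvgP h4.
  apply: nearW => n; rewrite /series/= big_mkord.
  apply: (le_trans (ler_norm_sum _ _ _)).
  have S0 : 0 <= S by apply: le_trans (HS x x0).
  apply: (@le_trans _ _ (\sum_(k < n) ups k * S)).
    apply: ler_sum => k _; rewrite normrM (ger0_norm (ups_ge0 _)); apply: ler_wpM2l => //.
    by apply: HS; rewrite mulr_gt0// expR_gt0.
  by rewrite -mulr_suml; apply: ler_wpM2r.
have Dz := ode_unique lam0 dD D0 Doo Dbnd DS.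
(* Otherwise H = 0, and the first wave would be bounded by a multiple of the second,
   which fails at the point x below, far enough from 0. *)
have g0_neq0 : g0 != 0.
  apply/eqP => g00.
  have Hz x : 0 < x -> H x = 0 by move=> x0; have := Dz x x0; rewrite /D g00 mul0r subr0.
  have e1 : 0 < expR e - 1 by rewrite subr_gt0 -{1}expR0 ltr_expR.
  pose x := A / ((expR e - 1) * lam).
  have x0 : 0 < x by rewrite divr_gt0// mulr_gt0.
  have := wave_sum_first e0 lam0 C0 c0 ntC (ltW x0); rewrite -/H (Hz x x0) sub0r normrN.
  rewrite gtr0_norm ?wave_gt0// wave0 /wave mulr1 -/A => h.
  have : expR (expR e * x * lam - x * lam) <= A.
    by rewrite expRD mulrC -ler_pdivlMr ?expR_gt0// -expRN.
  rewrite leNgt => /negP; apply; apply: lt_le_trans (expR_ge1Dx _).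
  rewrite -[X in 1 + X](_ : A = _); first by rewrite ltrDr.
  by rewrite /x; field; rewrite gt_eqF//= gt_eqF.
split.
- exact: (cvg_nt e0 ntC).
- by move=> x x0; rewrite termE; exact: (cvg_c_wave e0 lam0 ntC).
move=> x x0; rewrite /density_formula upsilon_sumE termE -/g0 -/(wave_dsum e lam c x) -/(Dn x).
have D_le0 y : 0 < y -> `|D y| <= 0 by move=> y0; rewrite (Dz y y0) normr0.
have := DS 0 D_le0 x x0; rewrite mulr0 normr_le0 (Dz x x0) mulr0 addr0.
rewrite /D' addrC subr_eq0 => /eqP h2.
by apply: (mulfI g0_neq0); rewrite h2; field.
Unshelve. all: by end_near. Qed.

End formula.

End fixed_mesh.

(** * A bound on the density that is uniform in the mesh *)

Section levy.
Context {R : realType} (nu : {sigma_finite_measure set R -> \bar R}).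
Hypothesis nuL : subordinator_levy_measure nu.

Let mmin (D : set R) : measurable_fun D (fun z : R => (Num.min z 1)%:E).
Proof.
apply: measurable_funTS; apply/measurable_EFinP; exact: measurable_minr.
Qed.

Lemma levy_min_integrable : nu.-integrable `]0, +oo[ (fun z : R => (Num.min z 1)%:E).
Proof.
case: nuL => _ fin; apply/integrableP; split; first exact: mmin.
rewrite (eq_integral (fun z : R => (Num.min z 1)%:E))// => z; rewrite inE/= in_itv/= andbT => z0.
by rewrite ger0_norm// le_min ler01 ltW.
Qed.

Lemma levy_tail_fin (dl : R) : 0 < dl -> (nu `[dl, +oo[ < +oo)%E.
Proof.
move=> dl0; case: nuL => _ fin.
have m0 : 0 < Num.min dl 1 by rewrite lt_min dl0 ltr01.
have h : ((Num.min dl 1)%:E * nu `[dl, +oo[ <= \int[nu]_(z in `]0%R, +oo[) (Num.min z 1)%:E)%E.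
  rewrite -integral_cst//.
  apply: (@le_trans _ _ (\int[nu]_(z in `[dl, +oo[) (Num.min z 1)%:E)%E).
    apply: ge0_le_integral => //.
    - by move=> z _; rewrite lee_fin ltW.
    - move=> z /=; rewrite in_itv/= andbT => dz; rewrite lee_fin le_min !ge_min lexx.
      by rewrite dz/= orbT.
  apply: ge0_subset_integral => //.
    by move=> z /=; rewrite in_itv/= andbT => z0; rewrite lee_fin le_min ler01 ltW.
  by move=> z /=; rewrite !in_itv/= !andbT; exact: lt_le_trans.
rewrite ltey; apply/eqP => noo; have := le_lt_trans h fin.
by rewrite noo gt0_muley ?lte_fin.
Qed.

Lemma exp_sub1_le (z : R) : 0 <= z -> z <= 1 -> expR z - 1 <= expR 1 * z.
Proof.
move=> z0 z1; have h := expR_ge1Dx (- z); have E := expRxMexpNx_1 z.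
have h2 : expR z * (1 - z) <= 1 by rewrite -[leRHS]E ler_pM2l ?expR_gt0.
have h3 : expR z <= expR 1 by rewrite ler_expR.
have h4 : 0 <= (expR 1 - expR z) * z by rewrite mulr_ge0// subr_ge0.
nra.
Qed.

(** exp z - 1 is of order z near 0, where z is nu-integrable. *)
Lemma small_jumps (eps : R) : 0 < eps -> exists2 dl, 0 < dl &
  (\int[nu]_(z in `]0%R, dl[) (expR z - 1)%:E <= eps%:E)%E.
Proof.
move=> eps0.
pose f (n : nat) (z : R) : \bar R := ((expR z - 1) * \1_(`]0%R, n.+1%:R^-1[) z)%:E.
have mf n : measurable_fun (`]0, +oo[ : set R) (f n).
  apply: measurable_funTS; apply/measurable_EFinP; apply: measurable_funM.
    by apply: measurable_funB => //; exact: measurable_expR.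
  exact: measurable_indic.
have dom n (z : R) : 0 < z -> (`|f n z| <= (expR 1)%:E * (Num.min z 1)%:E)%E.
  move=> z0; rewrite /f abse_EFin -EFinM lee_fin indicE.
  have e1 : 0 <= expR z - 1 by rewrite subr_ge0 -expR0 ler_expR ltW.
  have [|_] := boolP (z \in _); last first.
    by rewrite mulr0 normr0 mulr_ge0 ?expR_ge0// le_min ler01 ltW.
  rewrite inE/= in_itv/= => /andP[_ zn]; rewrite mulr1 ger0_norm//.
  have z1 : z <= 1 by rewrite ltW// (lt_le_trans zn)// invf_le1// ler1n.
  by rewrite min_l//; apply: exp_sub1_le => //; exact: ltW.
have cvg0 : (\int[nu]_(z in `]0%R, +oo[) f n z)%E @[n --> \oo] --> (\int[nu]_(z in `]0%R, +oo[) cst 0%E z)%E.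
  apply: (@dominated_cvg_ae _ _ _ nu (`]0, +oo[ : set R) f (cst 0%E) (fun z : R => (expR 1)%:E * (Num.min z 1)%:E)%E) => //.
  - apply: aeW => z /=; rewrite in_itv/= andbT => z0; apply: cvg_near_cst.
    near=> n; rewrite /f indicE memNset ?mulr0//= in_itv/= z0/=; apply/negP; rewrite -leNgt.
    rewrite -[leRHS]invrK lef_pV2 ?posrE ?invr_gt0//.
    have h : z^-1 <= n%:R by near: n; exact: nbhs_infty_ger.
    by rewrite (le_trans h)// ler_nat.
  - by apply: integrableZl => //; exact: levy_min_integrable.
  - by apply: aeW => z n /=; rewrite in_itv/= andbT => z0; exact: dom.
rewrite integral0_eq// in cvg0.
have /(cvg0 [set y | (y < eps%:E)%E]) [n _ /(_ n (leqnn n)) /= Hn] : nbhs 0%E [set y | (y < eps%:E)%E].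
  by apply: (@open_ereal_lt' _ 0%E); rewrite lte_fin.
exists n.+1%:R^-1; first by rewrite invr_gt0.
apply: le_trans (ltW Hn); rewrite le_eqVlt; apply/orP; left; apply/eqP.
rewrite integral_mkcond [RHS]integral_mkcond; apply: eq_integral => z _.
rewrite !patchE; case: ifPn => zI.
  rewrite ifT; last by move: zI; rewrite !inE/= !in_itv/= andbT => /andP[].
  by rewrite /f indicE zI mulr1.
by case: ifPn => // _; rewrite /f indicE (negbTE zI) mulr0.
Unshelve. all: by end_near. Qed.

End levy.

Section uniform_bound.
Context {R : realType} {d : measure_display} {T : measurableType d}
  (P : probability T R) (nu : {sigma_finite_measure set R -> \bar R})
  (M : R.-ker T ~> (R * R)%type) (e : R).
Hypothesis prm : poisson_random_measure P M (jump_intensity nu).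
Hypothesis nuL : subordinator_levy_measure nu.
Hypothesis e0 : 0 < e.
Hypothesis nu_pos : (0 < nu `[e, +oo[)%E.

Let nu_fin : (nu `[e, +oo[ < +oo)%E. Proof. exact: levy_tail_fin. Qed.
Let F := expint_cdf P M e.
Let phi := mesh_density P nu M e.

Lemma quantize_le (z : R) : quantize e z <= z.
Proof. by rewrite /quantize mulrC -ler_pdivlMr// floor_le. Qed.

Lemma quantize_nneg (z : R) : 0 <= z -> 0 <= quantize e z.
Proof. by move=> z0; rewrite mulr_ge0 ?(ltW e0)// ler0z floor_ge0 divr_ge0// ltW. Qed.

Lemma mesh_incr_ge0 (x z : R) : 0 <= x -> 0 <= z -> 0 <= F (x * expR (quantize e z)) - F x.
Proof.
move=> x0 z0; rewrite subr_ge0; apply: (expint_cdf_nondec P M e0).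
by rewrite ler_peMr// -expR0 ler_expR quantize_nneg.
Qed.

Lemma measurable_mesh_incr (D : set R) (x : R) :
  measurable_fun D (fun z => (F (x * expR (quantize e z)) - F x)%:E).
Proof.
apply: measurable_funTS; apply/measurable_EFinP; apply: measurable_funB => //.
apply: measurableT_comp.
  by apply: nondecreasing_measurable => //; exact: expint_cdf_nondec.
apply: measurable_funM => //; apply: measurableT_comp; first exact: measurable_expR.
exact: measurable_quantize.
Qed.

Lemma mesh_density_ereal (x : R) : 0 <= x ->
  (phi x)%:E = (\int[nu]_(z in `]0%R, +oo[) (F (x * expR (quantize e z)) - F x)%:E)%E.
Proof.
move=> x0; rewrite fineK//.
have ge0 : (0 <= \int[nu]_(z in `]0%R, +oo[) (F (x * expR (quantize e z)) - F x)%:E)%E.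
  by apply: integral_ge0 => z /=; rewrite in_itv/= andbT lee_fin => z0; apply: mesh_incr_ge0 => //; exact: ltW.
rewrite ge0_fin_numE//; apply: (@le_lt_trans _ _ (nu `[e, +oo[)); last exact: nu_fin.
rewrite -[leRHS]mul1e -integral_cst// integral_mkcond [leRHS]integral_mkcond.
apply: ge0_le_integral => //.
- move=> z _; apply: erestrict_ge0 => y /=; rewrite in_itv/= andbT lee_fin => y0.
  by apply: mesh_incr_ge0 => //; exact: ltW.
- by apply/(measurable_restrictT _ _).1 => //; exact: measurable_mesh_incr.
- by apply/(measurable_restrictT _ _).1.
- move=> z _; rewrite !patchE.
  case: ifPn; rewrite ?inE ?notin_setE/= in_itv/= andbT => z0; last by case: ifPn.
  case: ifPn; rewrite ?inE ?notin_setE/= in_itv/= andbT => // ze.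
    rewrite lee_fin lerBlDr; have /andP[_ h] := expint_cdf01 P M e0 (x * expR (quantize e z)).
    by apply: (le_trans h); rewrite lerDl; case/andP: (expint_cdf01 P M e0 x).
  move/negP : ze; rewrite -ltNge => ze.
  by rewrite (quantize_small e0) ?(ltW z0)// expR0 mulr1 subrr.
Qed.

Variables (B dl K : R).
Hypothesis B0 : 0 < B.
Hypothesis dl0 : 0 < dl.
Hypothesis small : (\int[nu]_(z in `]0%R, dl[) (expR z - 1)%:E <= ((2 * B)^-1)%:E)%E.
Hypothesis tailK : (nu `[dl, +oo[ <= K%:E)%E.

(** Let S be the supremum of (B - x) phi x over ]0, B]. It controls the increments of F:
    (B - x) (F y - F x) <= (y - x) (S + 1), where the factor B - x covers the case
    y > B, since F is at most 1. Inserted in the integral that defines phi, this bounds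
    the contribution of the jumps below [dl] by (S + 1) / 2, and that of the others is at
    most B K. So S <= (S + 1) / 2 + B K, whatever the mesh. *)
Lemma mesh_density_uniform : forall x : R, 0 < x -> x <= B ->
  (B - x) * phi x <= 1 + 2 * B * K.
Proof.
pose V := [set (B - x) * phi x | x in [set x | 0 < x <= B]].
have lam0 := jump_rate_gt0 nu_fin nu_pos.
have phib x : 0 <= x -> 0 <= phi x <= jump_rate nu e by exact: mesh_density_bounds.
have supV : has_sup V.
  split; first by exists ((B - B) * phi B); exists B => //=; rewrite B0 lexx.
  exists (B * jump_rate nu e) => _ [x /andP[x0 xB] <-].
  have /andP[h1 h2] := phib x (ltW x0).
  by apply: ler_pM => //; rewrite ?subr_ge0// gerBl ltW.
pose S := sup V.
have leS x : 0 < x -> x <= B -> (B - x) * phi x <= S.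
  by move=> x0 xB; apply: (sup_upper_bound supV); exists x => //=; rewrite x0.
have S0 : 0 <= S.
  by have := leS B B0 (lexx B); rewrite subrr mul0r.
(* For y <= B write (B - x) = (B - y) + (y - x): the first part is integrated from
   phi, the second uses that F is bounded by 1. *)
have lip x y : 0 < x -> x <= B -> x <= y -> (B - x) * (F y - F x) <= (y - x) * (S + 1).
  move=> x0 xB xy.
  have /andP[Fx0 Fx1] := expint_cdf01 P M e0 x; have /andP[Fy0 Fy1] := expint_cdf01 P M e0 y.
  have Fxy := expint_cdf_nondec P M e0 xy; rewrite -/F in Fx0 Fx1 Fy0 Fy1 Fxy.
  have [yB|By] := leP y B; last first.
    have h1 : (B - x) * (F y - F x) <= (y - x) * 1.
      by apply: ler_pM; rewrite ?subr_ge0//; lra.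
    by apply: (le_trans h1); apply: ler_wpM2l; rewrite ?subr_ge0// lerDr.
  have h : (B - y) * (F y - F x) <= (y - x) * S.
    pose W u := (u - x) * S - (B - u) * (F u - F x).
    have : W x <= W y.
      apply: (@derive_ge0_nondec _ W (fun u => S + (F u - F x) - (B - u) * phi u) x y _ _ xy).
      - move=> z _; have d1 := mesh_density_is_derive prm e0 nu_fin nu_pos z.
        have d2 : is_derive z 1 (fun u => F u - F x) (phi z - 0) by exact: is_deriveB.
        have d3 : is_derive z 1 (fun u : R => B - u) (0 - 1) by exact: is_deriveB.
        have d4 : is_derive z 1 (fun u : R => u - x) (1 - 0) by exact: is_deriveB.
        have d5 := is_deriveM d3 d2.
        have d6 : is_derive z 1 (fun u : R => (u - x) * S) S.
          apply: (is_derive_eq (is_deriveM d4 (is_derive_cst S z 1))).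
          by rewrite /GRing.scale/=; ring.
        apply: (is_derive_eq (is_deriveB d6 d5)).
        by rewrite /GRing.scale/=; move: (phi z) (F z) (F x) => a b c; ring.
      - move=> z /andP[xz zy]; have := leS z (lt_le_trans x0 xz) (le_trans zy yB).
        have := expint_cdf_nondec P M e0 xz; rewrite -/F; lra.
    by rewrite /W !subrr mul0r mulr0 subr0 subr_ge0.
  have h2 : 0 <= (y - x) * (1 - (F y - F x)) by rewrite mulr_ge0 ?subr_ge0//; lra.
  lra.
have K0 : 0 <= K by rewrite -lee_fin; apply: le_trans tailK.
have main x : 0 < x -> x <= B -> (B - x) * phi x <= (S + 1) / 2 + B * K.
  move=> x0 xB; have Bx : 0 <= B - x by rewrite subr_ge0.
  rewrite -lee_fin EFinM (mesh_density_ereal (ltW x0)) -ge0_integralZl_EFin//; last 2 first.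
  - by move=> z /=; rewrite in_itv/= andbT lee_fin => z0; apply: mesh_incr_ge0; exact: ltW.
  - exact: measurable_mesh_incr.
  have U : `]0, +oo[%classic = `]0, dl[%classic `|` `[dl, +oo[%classic :> set R.
    by rewrite -itv_bndbnd_setU.
  have ge0 z : (`]0, +oo[ : set R) z ->
      (0 <= (B - x)%:E * (F (x * expR (quantize e z)) - F x)%:E)%E.
    rewrite /= in_itv/= andbT => z0; rewrite -EFinM lee_fin mulr_ge0//.
    by apply: mesh_incr_ge0; exact: ltW.
  have mI D : measurable_fun D (fun z => (B - x)%:E * (F (x * expR (quantize e z)) - F x)%:E)%E.
    by apply: measurable_funeM; exact: measurable_mesh_incr.
  rewrite U ge0_integral_setU//; last 2 first.
  - by move=> z; rewrite -U; exact: ge0.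
  - apply/disj_setPS => z [] /=; rewrite !in_itv/= andbT => /andP[_ h1] h2.
    by move: (lt_le_trans h1 h2); rewrite ltxx.
  rewrite [leRHS]EFinD; apply: leeD.
    apply: (@le_trans _ _ (\int[nu]_(z in `]0%R, dl[) ((B * (S + 1))%:E * (expR z - 1)%:E))%E).
      apply: ge0_le_integral => //.
      - by move=> z h; apply: ge0; rewrite U; left.
      - apply: measurable_funeM; apply: measurable_funTS; apply/measurable_EFinP.
        by apply: measurable_funB => //; exact: measurable_expR.
      - move=> z /=; rewrite in_itv/= => /andP[z0 _]; rewrite -!EFinM lee_fin.
        have xq : x <= x * expR (quantize e z).
          by rewrite ler_peMr ?(ltW x0)// -expR0 ler_expR quantize_nneg// ltW.
        apply: (le_trans (lip _ _ x0 xB xq)).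
        rewrite [leRHS](_ : _ = B * (expR z - 1) * (S + 1)); last by ring.
        apply: ler_wpM2r; first by rewrite addr_ge0.
        rewrite -[X in _ - X]mulr1 -mulrBr; apply: ler_pM => //; first exact: ltW.
          by rewrite subr_ge0 -expR0 ler_expR quantize_nneg// ltW.
        by rewrite lerD2r ler_expR quantize_le.
    rewrite ge0_integralZl_EFin//; last 3 first.
    - by move=> z /=; rewrite in_itv/= => /andP[z0 _]; rewrite lee_fin subr_ge0 -expR0 ler_expR ltW.
    - apply: measurable_funTS; apply/measurable_EFinP.
      by apply: measurable_funB => //; exact: measurable_expR.
    - by rewrite mulr_ge0 ?(ltW B0)// addr_ge0.
    apply: (@le_trans _ _ ((B * (S + 1))%:E * ((2 * B)^-1)%:E)%E).
      by apply: lee_wpmul2l => //; rewrite lee_fin mulr_ge0 ?(ltW B0)// addr_ge0.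
    rewrite -EFinM lee_fin le_eqVlt; apply/orP; left; apply/eqP; field.
    by rewrite gt_eqF.
  apply: (@le_trans _ _ (B%:E * nu `[dl, +oo[)%E); last first.
    by rewrite EFinM lee_wpmul2l// lee_fin ltW.
  rewrite -integral_cst//; apply: ge0_le_integral => //.
  - by move=> z h; apply: ge0; rewrite U; right.
  - move=> z _; rewrite -EFinM lee_fin -[leRHS]mulr1.
    have /andP[h1 h2] := expint_cdf01 P M e0 (x * expR (quantize e z)).
    have /andP[h3 h4] := expint_cdf01 P M e0 x; rewrite -/F in h1 h2 h3 h4.
    have h5 : 0 <= (B - x) * (1 - (F (x * expR (quantize e z)) - F x)) by rewrite mulr_ge0//; lra.
    lra.
have S_le : S <= (S + 1) / 2 + B * K.
  apply: ge_sup; first by case: supV.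
  by move=> _ [x /andP[x0 xB] <-]; exact: main.
move=> x x0 xB; apply: (le_trans (leS x x0 xB)); lra.
Qed.

End uniform_bound.

(** * From a distribution function to a continuous density *)

Section density_law.
Context {R : realType} (f : R -> R).
Hypothesis f0 : forall x, 0 < x -> 0 <= f x.
Hypothesis mf : measurable_fun (`]0, +oo[ : set R) f.

Definition density_law (B : set (\bar R)) : \bar R :=
  (\int[@lebesgue_measure R]_(x in `]0%R, +oo[ `&` EFin @^-1` B) (f x)%:E)%E.

Let mE (B : set (\bar R)) : measurable B -> measurable (`]0, +oo[ `&` EFin @^-1` B : set R).
Proof.
move=> mB; apply: measurableI => //.
by rewrite -[X in measurable X]setTI; exact: EFin_measurable.
Qed.

Let density_law0 : density_law set0 = 0%E.
Proof. by rewrite /density_law preimage_set0 setI0 integral_set0. Qed.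

Let density_law_ge0 B : (0 <= density_law B)%E.
Proof.
apply: integral_ge0 => x [/=]; rewrite in_itv/= andbT lee_fin => x0 _; exact: f0.
Qed.

Let density_law_sigma_additive : semi_sigma_additive density_law.
Proof.
move=> /= B mB tB mUB; rewrite /density_law; apply: cvg_toP.
  apply: ereal_nondecreasing_is_cvgn => m n mn.
  by apply: lee_sum_nneg_natr => // k _ _; exact: density_law_ge0.
rewrite preimage_bigcup setI_bigcupr ge0_integral_bigcup//=.
- by move=> k; exact: mE.
- apply: (@measurable_funS _ _ _ _ (`]0, +oo[ : set R)) => //.
    by move=> x [k _ []].
  exact/measurable_EFinP.
- by move=> x [k _ [/=]]; rewrite in_itv/= andbT lee_fin => x0 _; exact: f0.
- move=> i j _ _ [x [[_ hi] [_ hj]]]; apply: (tB i j) => //.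
  by exists x%:E.
Qed.

HB.instance Definition _ := isMeasure.Build _ _ _ density_law
  density_law0 density_law_ge0 density_law_sigma_additive.

End density_law.

Section pdf_of_cdf.
Context {R : realType} {d : measure_display} {T : measurableType d}.
Variables (P : probability T R) (Y : T -> \bar R) (F f : R -> R).
Hypothesis mY : measurable_fun setT Y.
Hypothesis cdfE : forall r : R, P [set w | (Y w <= r%:E)%E] = (F r)%:E.
Hypothesis cdf_le0 : forall r : R, r <= 0 -> F r = 0.
Hypothesis cdf_cvg1 : F x @[x --> +oo] --> (1 : R).
Hypothesis f_cont : forall x : R, 0 < x -> {for x, continuous f}.
Hypothesis f_ge0 : forall x : R, 0 < x -> 0 <= f x.
Hypothesis f_primitive : forall x y : R, 0 < x -> x < y ->
  (\int[@lebesgue_measure R]_(t in `[x, y]) (f t)%:E = (F y - F x)%:E)%E.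

Let mf : measurable_fun (`]0, +oo[ : set R) f.
Proof.
apply: open_continuous_measurable_fun; first exact: interval_open.
by move=> x; rewrite inE/= in_itv/= andbT => x0; exact: f_cont.
Qed.

(** Right continuity of a distribution function; at 0 it shows that F tends to 0, so that
    no mass escapes there. *)
Let cdf_right (r : R) : F (r + n.+1%:R^-1) @[n --> \oo] --> F r.
Proof.
suff : (F (r + n.+1%:R^-1))%:E @[n --> \oo] --> (F r)%:E by move/fine_cvgP => [].
rewrite -(cdfE r); under eq_fun do rewrite -cdfE.
have -> : [set w | (Y w <= r%:E)%E] =
    \bigcap_n [set w | (Y w <= (r + n.+1%:R^-1)%:E)%E].
  apply/seteqP; split => [w /= Yr n _ /=|w /= h /=].
    by apply: le_trans Yr _; rewrite lee_fin lerDl.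
  apply/lee_addgt0Pr => e e0.
  have [n _ hn] : \forall n \near \oo, n.+1%:R^-1 < e.
    by exact: (near_infty_natSinv_lt (PosNum e0)).
  have := h n I; move=> /= /le_trans; apply.
  by rewrite -EFinD lee_fin lerD2l ltW //; apply: hn => /=.
apply: (@nonincreasing_cvg_mu _ _ _ P
  (fun n => [set w | (Y w <= (r + n.+1%:R^-1)%:E)%E])).
- by rewrite [X in (X < _)%E](cdfE (r + 1%:R^-1)) ltry.
- by move=> i; rewrite -[X in measurable X]setTI; exact: emeasurable_fun_infty_c.
- apply: bigcapT_measurable => i.
  by rewrite -[X in measurable X]setTI; exact: emeasurable_fun_infty_c.
- move=> m n mn; apply/subsetPset => w /= /le_trans; apply.
  by rewrite lee_fin lerD2l lef_pV2 ?posrE // ler_nat.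
Qed.

(** Increasing intervals reduce the ray to increments of F. *)
Let density_law_ray (r : R) : 0 <= r ->
  density_law f [set y | (r%:E < y)%E] = (1 - F r)%:E.
Proof.
move=> r0.
pose D (n : nat) : set R := `](r + n.+1%:R^-1), (r + n.+2%:R)].
have UD : \bigcup_n D n = `]0, +oo[ `&` EFin @^-1` [set y | (r%:E < y)%E].
  apply/seteqP; split => [x [n _]|x []]; rewrite /D /= !in_itv /= ?andbT lte_fin.
    move=> /andP[h _]; have : r < x by apply: le_lt_trans h; rewrite lerDl.
    by move=> rx; split => //; exact: le_lt_trans rx.
  move=> x0 rx.
  have xr0 : 0 < x - r by rewrite subr_gt0.
  have [n [_ [hn1 hn2]]] : exists n, True /\ (n.+1%:R^-1 < x - r /\ x - r <= n.+2%:R).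
    near \oo => n; exists n; split => //; split.
      by near: n; exact: (near_infty_natSinv_lt (PosNum xr0)).
    rewrite (@le_trans _ _ n%:R) ?ler_nat //; last by rewrite ltnW.

    by near: n; exact: nbhs_infty_ger.
  by exists n => //=; rewrite /D /= in_itv /= -ltrBrDl hn1 -lerBlDl.
have h1 : (\int[@lebesgue_measure R]_(x in D n) (f x)%:E)%E @[n --> \oo] -->
    density_law f [set y | (r%:E < y)%E].
  rewrite /density_law -UD; apply: ge0_nondecreasing_set_cvg_integral.
  - move=> m n mn; apply/subsetPset => x; rewrite /D /= !in_itv /=.
    move=> /andP[a b]; apply/andP; split.
      by apply: le_lt_trans a; rewrite lerD2l lef_pV2 ?posrE // ler_nat.
    by apply: (le_trans b); rewrite lerD2l ler_nat.
  - by move=> i; exact: measurable_itv.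
  - move=> i; apply/measurable_EFinP; apply: measurable_funS mf => //.
    move=> x; rewrite /D /= !in_itv /= andbT => /andP[a _]; apply: le_lt_trans a.
    by rewrite addr_ge0.
  - move=> i x; rewrite /D /= !in_itv /= lee_fin => /andP[a _]; apply: f_ge0.
    by apply: le_lt_trans a; rewrite addr_ge0.
apply: (cvg_unique _ h1) => //.
have -> : (fun n => \int[@lebesgue_measure R]_(x in D n) (f x)%:E)%E =
    (fun n => (F (r + n.+2%:R) - F (r + n.+1%:R^-1))%:E).
  apply/funext => n; rewrite /D.
  have i1 : (n.+1%:R^-1 : R) <= 1 by rewrite invf_le1 ?ler1n.
  have i2 : (2 : R) <= n.+2%:R by rewrite ler_nat.
  rewrite integral_itv_obnd_cbnd; last first.
    apply/measurable_EFinP; apply: measurable_funS mf => //.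
    move=> x; rewrite /= !in_itv /= andbT => /andP[a _]; apply: lt_trans a.
    by rewrite ltr_wpDl.
  apply: f_primitive; first by rewrite ltr_wpDl.
  by rewrite ltrD2l (le_lt_trans i1) // (lt_le_trans _ i2) // ltr1n.
apply: cvg_EFin; first by near=> n.
apply: cvgB; last exact: cdf_right.
apply: (cvg_comp (fun n : nat => r + n.+2%:R) F _ cdf_cvg1).
apply/cvgryPge => A; near=> n.
rewrite (@le_trans _ _ n%:R) //; first by near: n; exact: nbhs_infty_ger.
by rewrite (@le_trans _ _ n.+2%:R) ?ler_nat ?lerDr // ltnW.
Unshelve. all: by end_near. Qed.

(** The two laws agree on the rays ]r, +oo], a generating family stable under
    intersection. The total mass 1 comes from the limit of F at infinity. *)
Lemma continuous_pdf_of_cdf : continuous_pdf P Y f.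
Proof.
split => // B mB.
have [m1 m1E] : exists m : {measure set (\bar R) -> \bar R},
    forall A, m A = P (Y @^-1` A) by unshelve eexists (pushforward P Y).
have [m2 m2E] : exists m : {measure set (\bar R) -> \bar R},
    forall A, m A = density_law f A by unshelve eexists (density_law f).
pose G : set (set (\bar R)) :=
  [set A | A = setT \/ exists r : R, A = `]r%:E, +oo[%classic].
have rayE (r : R) : `]r%:E, +oo[%classic = [set y : \bar R | (r%:E < y)%E].
  by apply/seteqP; split => y /=; rewrite in_itv /= andbT.
have mray (r : R) : measurable [set y : \bar R | (r%:E < y)%E].
  by rewrite -rayE; exact: emeasurable_itv.
have PY (r : R) : P (Y @^-1` [set y | (r%:E < y)%E]) = (1 - F r)%:E.
  have -> : Y @^-1` [set y | (r%:E < y)%E] = ~` [set w | (Y w <= r%:E)%E].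
    by apply/seteqP; split => w /=; rewrite ltNge => /negP.
  rewrite probability_setC ?cdfE //.
  by rewrite -[X in measurable X]setTI; exact: emeasurable_fun_infty_c.
have lawT : density_law f setT = 1%E.
  have -> : density_law f setT = density_law f [set y | (0%:E < y)%E].
    rewrite /density_law; congr (integral _ _ _).
    by apply/seteqP; split => x /= [a b]; split => //;
      move: a; rewrite in_itv /= andbT lte_fin.
  by rewrite density_law_ray // cdf_le0 // subr0.
rewrite -m1E -[RHS]/(density_law f B) -m2E.
apply: (measure_unique G (fun=> setT)) => //.
- apply: (etrans (ErealGenOInfty.measurableE R)); apply/seteqP; split.
    by apply: sub_smallest2r => [|A [r ->]]; [exact: smallest_sigma_algebra|right; exists r].
  apply: smallest_sub; first exact: smallest_sigma_algebra.
  move=> A [->|[r ->]].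
    exact: (@measurableT _ (g_sigma_algebraType (@ErealGenOInfty.G R))).
  by apply: sub_sigma_algebra; exists r.
- move=> A1 A2 [->|[r ->]] [->|[s ->]]; rewrite ?setTI ?setIT; [by left|by right; exists s|by right; exists r|].
  right; exists (Num.max r s); rewrite !rayE.
  apply/seteqP; split => y /=; rewrite EFin_max gt_max; first by move=> [-> ->].
  by move=> /andP[].
- by left.
- by rewrite bigcup_const.
- move=> A [->|[r ->]]; rewrite m1E m2E ?rayE.
    by rewrite lawT preimage_setT probability_setT.
  rewrite PY.
  have [r0|r0] := leP 0 r; first by rewrite density_law_ray.
  rewrite cdf_le0 ?subr0 ?ltW // -lawT /density_law; congr (integral _ _ _).
  apply/seteqP; split => x /= [a b]; split => //.
  by move: a; rewrite in_itv /= andbT lte_fin; exact: lt_trans.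
- by move=> k; rewrite m1E preimage_setT probability_setT ltry.
Qed.

End pdf_of_cdf.

(** * The discretized process and the jump at time zero *)

Section half_mesh.
Context {R : realType}.

Lemma quantize_gt (e z : R) : 0 < e -> z - e < quantize e z.
Proof.
move=> e0; have := @floorD1_gt R (z / e).
rewrite ltr_pdivrMr // intrD mulrDl mul1r -ltrBlDr => h.
by rewrite /quantize mulrC.
Qed.

(** For z >= e, the largest multiple of e below z is at least e and more than z - e. *)
Lemma quantize_ge_half (e z : R) : 0 < e -> e <= z -> z / 2 <= quantize e z.
Proof.
move=> e0 ez; have := quantize_gt z e0.
have : e <= quantize e z.
  rewrite /quantize ler_peMr ?(ltW e0)//.
  have : 0 < Num.floor (z / e) by rewrite floor_gt0 ler_pdivlMr// mul1r.
  by rewrite gtz0_ge1 ler1z.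
by move: (quantize e z) => q; lra.
Qed.

Lemma cvg_quantize (u : nat -> R) (z : R) : (forall n, 0 < u n) ->
  u n @[n --> \oo] --> (0 : R) -> quantize (u n) z @[n --> \oo] --> z.
Proof.
move=> u0 ucvg; apply: (@squeeze_cvgr _ _ _ _ (fun n => z - u n) (fun=> z)).
- by apply: nearW => n; rewrite quantize_le // andbT ltW // quantize_gt.
- by rewrite -[X in _ --> X]subr0; apply: cvgB => //; exact: cvg_cst.
- exact: cvg_cst.
Qed.

End half_mesh.

Section origin.
Context {R : realType} {d} {T : measurableType d} (P : probability T R).
Context (nu : {sigma_finite_measure set R -> \bar R}).
Variable M : R.-ker T ~> (R * R)%type.
Hypothesis prm : poisson_random_measure P M (jump_intensity nu).

(** The set of times {0} is Lebesgue negligible. *)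
Lemma no_jump_at0_ae : {ae P, forall w, M w ([set 0%R] `*` `]0%R, +oo[) = 0%E}.
Proof.
pose N : set (R * R) := [set 0%R] `*` `]0%R, +oo[.
have mN : measurable N by exact: measurableX.
have N0 : jump_intensity nu N = 0%E.
  rewrite /jump_intensity (_ : _ `&` _ = N); last first.
    apply/seteqP; split => [x []//|[x y] [/= -> yp]]; split => //; split => //=.
    by rewrite in_itv /= lexx.
  rewrite /N; have := @product_measure1E _ _ _ _ R (@lebesgue_measure R) nu
    [set 0%R] `]0%R, +oo[ (measurable_set1 _) (measurable_itv _).
  by move=> /= ->; rewrite lebesgue_measure_set1 mul0e.
have [prm1 _ _] := prm.
have := prm1 N mN; rewrite N0 => /(_ (ltry 0) 0%N).
rewrite /= expr0 fact0 invr1 !mul1r oppr0 expR0 => h.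
have mE : measurable [set w | M w N = 0%E].
  have := @measurable_kernel _ _ _ _ _ M N mN.
  move=> /(_ measurableT [set 0%E]); rewrite setTI; apply.
  exact: emeasurable_set1.
exists (~` [set w | M w N = 0%E]); split.
- exact: measurableC.
- by have := probability_setC P mE; rewrite h subee.
- by move=> w.
Qed.

Lemma jump_integral_open (D : set R) (g : R -> R) (t : R) w :
  M w ([set 0%R] `*` `]0%R, +oo[) = 0%E -> 0 <= t -> measurable D ->
  D `<=` `]0, +oo[ -> measurable_fun setT g -> (forall z, D z -> 0 <= g z) ->
  jump_integral M D g t w = (\int[M w]_(p in `]0%R, t] `*` D) (g p.2)%:E)%E.
Proof.
move=> w0 t0 mD D0 mg g0; rewrite /jump_integral.
have mN : measurable ([set 0%R] `*` `]0%R, +oo[ : set (R * R)) by exact: measurableX.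
rewrite (ge0_negligible_integral mN) //; first last.
- by move=> p [_ /g0]; rewrite lee_fin.
- apply: measurable_funTS; apply/measurable_EFinP.
  by apply: measurableT_comp => //; exact: measurable_snd.
- exact: measurableX.
congr (integral _ _ _); apply/seteqP; split => [[x y] [[/= xt Dy] h]|[x y] [/= xt Dy]].
  split => //=; move: xt; rewrite !in_itv /= => /andP[x0 ->]; rewrite andbT.
  rewrite lt_neqAle x0 andbT; apply/negP => /eqP x00; apply: h; split => //=.
  exact: D0.
split; first split => //=.
  by move: xt; rewrite !in_itv /= => /andP[/ltW -> ->].
by move=> [/= x0 _]; move: xt; rewrite x0 in_itv /= ltxx.
Qed.

Lemma exp_functional_discretized_ae (e : R) : 0 < e ->
  {ae P, forall w, exp_functional (discretized_process M e) w = expint M e 0%R w}.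
Proof.
move=> e0; apply: filterS no_jump_at0_ae => w w0.
apply: eq_integral => t; rewrite inE /= in_itv /= andbT => t0.
rewrite /discretized_process jump_integral_open //.
- by move=> z /=; rewrite !in_itv /= !andbT; exact: lt_le_trans.
- exact: measurable_quantize.
- by move=> z /=; rewrite in_itv /= andbT; exact: quantize_ge0.
Qed.

Lemma measurable_exp_functional_discretized (e : R) : 0 < e ->
  measurable_fun setT (exp_functional (discretized_process M e)).
Proof.
move=> e0.
have mq (A : set (R * R)) : measurable_fun A (fun p : R * R => (quantize e p.2)%:E).
  apply: measurable_funTS; apply/measurable_EFinP.
  by apply: measurableT_comp; [exact: measurable_quantize|exact: measurable_snd].
have q0 (t : R) (p : R * R) : (`[0%R, t] `*` `[e, +oo[) p -> (0 <= (quantize e p.2)%:E)%E.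
  by move=> [_ /=]; rewrite in_itv/= andbT lee_fin; exact: quantize_ge0.
apply: measurable_exp_integral => [t w|t|t u w t0 tu].
- by apply: integral_ge0 => p; exact: q0.
- by apply: measurable_kernel_integral; [exact: measurableX|exact: q0|exact: mq].
- apply: ge0_subset_integral => //; [exact: measurableX|exact: measurableX|exact: q0|].
  move=> [x y] [/= xt Dy]; split => //=.
  by move: xt; rewrite !in_itv /= => /andP[-> /le_trans]; exact.
Qed.

End origin.

(** * Refinement of the mesh along a path *)

Section mesh_refinement.
Context {R : realType} {d} {T : measurableType d} (M : R.-ker T ~> (R * R)%type).

Definition jumps (t : R) (w : T) : \bar R :=
  (\int[M w]_(p in `]0%R, t] `*` `]0%R, +oo[) (p.2)%:E)%E.

Let mrect (t : R) : measurable (`]0%R, t] `*` `]0%R, +oo[ : set (R * R)).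
Proof. exact: measurableX. Qed.

Let mq (e : R) (A : set (R * R)) : measurable_fun A (fun p : R * R => (quantize e p.2)%:E).
Proof.
apply: measurable_funTS; apply/measurable_EFinP.
by apply: measurableT_comp; [exact: measurable_quantize|exact: measurable_snd].
Qed.

Let m2 (A : set (R * R)) : measurable_fun A (fun p : R * R => (p.2)%:E).
Proof.
by apply: measurable_funTS; apply/measurable_EFinP; exact: measurable_snd.
Qed.

Lemma level_fullE (e t : R) w : 0 < e ->
  level M e 0%R t w = (\int[M w]_(p in `]0%R, t] `*` `]0%R, +oo[) (quantize e p.2)%:E)%E.
Proof.
move=> e0; rewrite /level integral_mkcond [RHS]integral_mkcond.
apply: eq_integral => -[x z] _; rewrite !patchE.
have [xt|xt] := pselect ((`]0, t] : set R) x); last first.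
  by rewrite memNset; last move=> [/=] //; rewrite memNset // => -[].
have [ez|ez] := leP e z.
  rewrite mem_set /=; last by split; rewrite //= in_itv /= andbT.
  by rewrite mem_set //; split; rewrite //= in_itv /= andbT (lt_le_trans e0).
rewrite memNset; last by move=> [_ /=]; rewrite in_itv /= andbT leNgt ez.
case: ifPn => //; rewrite inE /= => -[_ /=]; rewrite in_itv /= andbT => z0.
by rewrite quantize_small // ltW.
Qed.

Lemma level_le_jumps (e t : R) w : 0 < e -> (level M e 0%R t w <= jumps t w)%E.
Proof.
move=> e0; rewrite level_fullE //; apply: ge0_le_integral => //.
  by move=> p [_ /=]; rewrite in_itv /= andbT lee_fin => /ltW; exact: quantize_nneg.
by move=> p _; rewrite lee_fin quantize_le.
Qed.

(** A lower bound common to all the meshes finer than [e0]; it provides the dominating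
    function in [cvg_expint]. *)
Lemma level_ge_half_count (e e0 t : R) w : 0 < e -> e <= e0 ->
  ((e0 / 2)%:E * M w (`]0%R, t] `*` `[e0, +oo[) <= level M e 0%R t w)%E.
Proof.
move=> ep ee0; have mr : measurable (`]0%R, t] `*` `[e0, +oo[ : set (R * R)).
  exact: measurableX.
rewrite -integral_cst //.
apply: (@le_trans _ _ (\int[M w]_(p in `]0%R, t] `*` `[e0, +oo[) (quantize e p.2)%:E)%E).
  apply: ge0_le_integral => //.
    by move=> p _; rewrite lee_fin divr_ge0 // ltW // (lt_le_trans ep).
  move=> p [_ /=]; rewrite in_itv /= andbT lee_fin => e0p.
  apply: le_trans (quantize_ge_half ep (le_trans ee0 e0p)).
  by rewrite ler_pM2r // invr_gt0.
apply: ge0_subset_integral => //; first exact: measurableX.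
  by move=> p [_ /=]; rewrite in_itv /= andbT lee_fin; exact: quantize_ge0.
move=> [x y] [/= xt]; rewrite /= in_itv /= andbT => e0y; split => //=.
by rewrite in_itv /= andbT (le_trans ee0).
Qed.

Section along_sequence.
Variable u : nat -> R.
Hypothesis u0 : forall n, 0 < u n.
Hypothesis u_cvg : u n @[n --> \oo] --> (0 : R).

(** Dominated convergence for the measure [M w], the marks themselves dominating. *)
Lemma cvg_level (t : R) w : (jumps t w < +oo)%E ->
  level M (u n) 0%R t w @[n --> \oo] --> jumps t w.
Proof.
move=> fin; under eq_fun do rewrite level_fullE //.
apply: (@dominated_cvg_ae _ _ _ (M w) _ _ _ (fun p => (p.2)%:E)) => //.
- apply: aeW => p _; apply: cvg_EFin; first by near=> n.
  exact: cvg_quantize.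
- apply/integrableP; split => //.
  rewrite (eq_integral (fun p => (p.2)%:E)) // => p; rewrite inE => -[_ /=].
  by rewrite in_itv /= andbT => p0; rewrite ger0_norm // ltW.
- apply: aeW => p n [_ /=]; rewrite in_itv /= andbT => p0.
  rewrite lee_fin ger0_norm ?quantize_le //.
  by apply: quantize_nneg => //; exact: ltW.
Unshelve. all: by end_near. Qed.

(** Dominated convergence in time; [level_ge_half_count] bounds all the integrands by the
    one whose integral is almost surely finite. *)
Lemma cvg_expint (e0 : R) w : (forall n, u n <= e0) ->
  (forall t : R, 0 <= t -> (jumps t w < +oo)%E) ->
  (\int[@lebesgue_measure R]_(t in `[0%R, +oo[)
     expeR (- ((e0 / 2)%:E * M w (`]0%R, t] `*` `[e0, +oo[))) < +oo)%E ->
  measurable_fun (`[0%R, +oo[ : set R) (fun t => expeR (- jumps t w)) ->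
  expint M (u n) 0%R w @[n --> \oo] -->
    (\int[@lebesgue_measure R]_(t in `[0%R, +oo[) expeR (- jumps t w))%E.
Proof.
move=> ue0 fin cfin mj.
have e0p : 0 < e0 := lt_le_trans (u0 0) (ue0 0%N).
have e02 : 0 < e0 / 2 by rewrite divr_gt0.
pose g (t : R) := expeR (- ((e0 / 2)%:E * M w (`]0%R, t] `*` `[e0, +oo[))).
apply: (@dominated_cvg_ae _ _ _ (@lebesgue_measure R) _ _ _ g) => //.
- move=> n; apply: measurable_exp_path => [??|???? ?].
    by apply: level_ge0.
  exact: level_nondec.
- apply: aeW => t; rewrite /= in_itv /= andbT => t0.
  have := cvg_level (fin _ t0).
  have jE : jumps t w = (fine (jumps t w))%:E.
    rewrite fineK // ge0_fin_numE ?fin //.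
    by apply: integral_ge0 => p [_ /=]; rewrite in_itv /= andbT lee_fin => /ltW.
  rewrite jE => /fine_cvgP[lfin lcvg].
  have : (expR (- fine (level M (u n) 0%R t w)))%:E @[n --> \oo] -->
      (expR (- fine (jumps t w)))%:E.
    apply: cvg_EFin; first by near=> n.
    apply: continuous_cvg; first exact: continuous_expR.
    exact: cvgN.
  apply: cvg_trans; apply: near_eq_cvg.
  by apply: filterS lfin => n /fineK <-.
- apply/integrableP; split; first exact: count_exp_measurable.
  apply: le_lt_trans cfin; rewrite le_eqVlt; apply/orP; left; apply/eqP.
  by apply: eq_integral => t _; rewrite gee0_abs //; exact: expeR_ge0.
- apply: aeW => t n _; rewrite gee0_abs ?expeR_ge0 // lee_expeR leeN2.
  exact: level_ge_half_count.
Unshelve. all: by end_near. Qed.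

End along_sequence.
End mesh_refinement.

(** * The law of the discretized functional *)

Section mesh_pdf.
Context {R : realType} {d} {T : measurableType d} (P : probability T R).
Context (nu : {sigma_finite_measure set R -> \bar R}).
Variables (M : R.-ker T ~> (R * R)%type) (e : R).
Hypothesis prm : poisson_random_measure P M (jump_intensity nu).
Hypothesis e0 : 0 < e.
Hypothesis nu_fin : (nu `[e, +oo[ < +oo)%E.
Hypothesis nu_pos : (0 < nu `[e, +oo[)%E.
Local Notation F := (expint_cdf P M e).

Lemma mesh_density_primitive (x y : R) : x < y ->
  (\int[@lebesgue_measure R]_(t in `[x, y]) (mesh_density P nu M e t)%:E =
   (F y - F x)%:E)%E.
Proof.
move=> xy; rewrite (@continuous_FTC2 _ _ F) //.
- by apply: continuous_subspaceT => z; exact: mesh_density_continuous.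
- split.
  + by move=> z _; have [] := mesh_density_is_derive prm e0 nu_fin nu_pos z.
  + apply: cvg_at_right_filter; exact: (expint_cdf_continuous prm).
  + apply: cvg_at_left_filter; exact: (expint_cdf_continuous prm).
- move=> z _; rewrite derive1E.
  by have [_] := mesh_density_is_derive prm e0 nu_fin nu_pos z.
Qed.

Lemma mesh_density_pdf :
  continuous_pdf P (exp_functional (discretized_process M e)) (mesh_density P nu M e).
Proof.
have mZ := measurable_exp_functional_discretized M e0.
apply: (@continuous_pdf_of_cdf _ _ _ P _ F) => //.
- move=> r; rewrite (expint_cdfE P M e0).
  have mI := measurable_expint M e0 0.
  move: mZ mI (exp_functional_discretized_ae prm e0).
  move: (exp_functional _) (expint M e 0) => Z I mZ mI ZI.
  have mG : measurable [set w | Z w = I w].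
    by have := measurable_eqe measurableT mZ mI; rewrite setTI.
  rewrite -(measure_ae_setI (measurable_le_set r%:E mZ) mG ZI).
  rewrite -(measure_ae_setI (measurable_le_set r%:E mI) mG ZI).
  by congr (P _); apply/seteqP; split => w [/= + Gw]; rewrite Gw.
- by move=> r r0; exact: (expint_cdf_le0 prm).
- exact: (expint_cdf_cvg1 prm).
- by move=> x _; exact: mesh_density_continuous.
- by move=> x /ltW x0; case/andP: (mesh_density_bounds P M e0 nu_fin nu_pos x0).
- by move=> x y _; exact: mesh_density_primitive.
Qed.

End mesh_pdf.

(** * The limit distribution function and its density *)

Section limit_cdf.
Context {R : realType} {d} {T : measurableType d} (P : probability T R).
Context (nu : {sigma_finite_measure set R -> \bar R}).
Variables (M : R.-ker T ~> (R * R)%type) (u : nat -> R) (I : T -> \bar R).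
Hypothesis prm : poisson_random_measure P M (jump_intensity nu).
Hypothesis nuL : subordinator_levy_measure nu.
Hypothesis u0 : forall n, 0 < u n.
Hypothesis u_cvg : u n @[n --> \oo] --> (0 : R).
Hypothesis u_pos : forall n, (0 < nu `[u n, +oo[)%E.
Hypothesis mI : measurable_fun setT I.
Hypothesis I_gt0 : forall w, (0 < I w)%E.
Hypothesis I_le : {ae P, forall w n, (I w <= expint M (u n) 0%R w)%E}.
Hypothesis I_cvg : {ae P, forall w, expint M (u n) 0%R w @[n --> \oo] --> I w}.

Let u_fin n : (nu `[u n, +oo[ < +oo)%E := levy_tail_fin nuL (u0 n).

Local Notation Fn n := (expint_cdf P M (u n)).

Definition limit_cdf (r : R) : R := fine (P [set w | (I w <= r%:E)%E]).
Local Notation F := limit_cdf.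

Let mle (r : R) : measurable [set w | (I w <= r%:E)%E].
Proof. exact: measurable_le_set. Qed.

Lemma limit_cdfE (r : R) : P [set w | (I w <= r%:E)%E] = (F r)%:E.
Proof. by rewrite /limit_cdf fineK // fin_num_measure. Qed.

Lemma limit_cdf_nondec : {homo F : x y / x <= y}.
Proof.
move=> x y xy; rewrite -lee_fin -!limit_cdfE le_measure ?inE //.
by move=> w /= /le_trans; apply; rewrite lee_fin.
Qed.

Lemma limit_cdf_le1 (r : R) : F r <= 1.
Proof. by rewrite -lee_fin -limit_cdfE probability_le1. Qed.

Lemma limit_cdf_le0 (r : R) : r <= 0 -> F r = 0.
Proof.
move=> r0; rewrite /limit_cdf (_ : [set w | _] = set0) ?measure0 //.
apply/seteqP; split => // w /=; rewrite leNgt => /negP; apply.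
by apply: le_lt_trans (I_gt0 w); rewrite lee_fin.
Qed.

(** Rounding the marks down can only increase the integral. *)
Lemma mesh_cdf_le_limit n (r : R) : Fn n r <= F r.
Proof.
rewrite -lee_fin -limit_cdfE expint_cdfE //.
have mIn := measurable_expint M (u0 n) 0.
have mG : measurable [set w | (I w <= expint M (u n) 0%R w)%E].
  by have := measurable_lee measurableT mI mIn; rewrite setTI.
have aG : {ae P, forall w, (I w <= expint M (u n) 0%R w)%E}.
  by apply: filterS I_le => w; exact.
rewrite -(measure_ae_setI (measurable_le_set r%:E mIn) mG aG).
apply: le_measure; rewrite ?inE //.
  by apply: measurableI => //; exact: measurable_le_set.
by move=> w [/= h1 h2]; exact: le_trans h1.
Qed.

(** The defect is the probability that I <= r while I_n overshoots r + h; it vanishes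
    because I_n converges to I almost surely. *)
Lemma limit_cdf_le_mesh (r h : R) : 0 < h ->
  exists2 p : nat -> R, p n @[n --> \oo] --> (0 : R) &
    forall n, F r <= Fn n (r + h) + p n.
Proof.
move=> h0; pose In n := expint M (u n) 0%R.
have mIn n : measurable_fun setT (In n) := measurable_expint M (u0 n) 0.
(* I_n dominates I only almost surely; the maximum makes the comparison sure. *)
pose S n w := (- maxe (In n w) (I w))%E.
have mS n : measurable_fun setT (S n).
  exact: (measurableT_comp (@oppe_measurable R setT) (measurable_maxe (mIn n) mI)).
pose D := [set w | (I w <= r%:E)%E].
pose A n := D `&` [set w | (S n w <= (- (r + h))%:E)%E].
have mA n : measurable (A n).
  by apply: measurableI; [exact: mle|exact: measurable_le_set].
exists (fun n => fine (P (A n))).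
  suff : P (A n) @[n --> \oo] --> 0%E by move/fine_cvgP => [].
  have -> : 0%E = P (D `&` [set w | (- I w <= (- (r + h))%:E)%E]).
    rewrite (_ : D `&` _ = set0) ?measure0 //; apply/seteqP; split => // w [].
    rewrite /D /= EFinN leeN2 => h1 h2.
    by have := le_trans h2 h1; rewrite lee_fin; lra.
  apply: prob_le_cvg => //.
  - exact: mle.
  - exact: (measurableT_comp (@oppe_measurable R setT) mI).
  - by move=> n w; rewrite leeN2 le_max lexx orbT.
  - apply: filterS2 I_le I_cvg => w le_w cvg_w.
    rewrite (_ : S ^~ w = (fun n => - In n w)%E); first exact: cvgeN.
    by apply/funext => n; rewrite /S max_l //; exact: le_w.
move=> n; rewrite -lee_fin EFinD -limit_cdfE expint_cdfE // fineK ?fin_num_measure //.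
apply: (@le_trans _ _ (P ([set w | (In n w <= (r + h)%:E)%E] `|` A n))).
  apply: le_measure; rewrite ?inE //.
    by apply: measurableU => //; exact: measurable_le_set.
  move=> w /= Iw; have [Inw|Inw] := leP (In n w) (r + h)%:E; first by left.
  by right; split => //=; rewrite /S EFinN leeN2 le_max (ltW Inw).
by apply: measureU2 => //; exact: measurable_le_set.
Qed.

(** [mesh_density_uniform] on ]0, 2 Y] bounds the densities on ]0, Y] independently of n. *)
Lemma mesh_cdf_lipschitz (Y : R) : 0 < Y -> exists2 C : R, 0 <= C &
  forall n (x y : R), 0 < x -> x <= y -> y <= Y -> Fn n y - Fn n x <= C * (y - x).
Proof.
move=> Y0; pose B := 2 * Y.
have B0 : 0 < B by rewrite mulr_gt0.
have [dl dl0 hdl] : exists2 dl : R, 0 < dl &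
    (\int[nu]_(z in `]0%R, dl[) (expR z - 1)%:E <= ((2 * B)^-1)%:E)%E.
  by have [|dl dl0 h] := small_jumps nuL (eps := (2 * B)^-1); [rewrite invr_gt0 mulr_gt0|exists dl].
pose K := fine (nu `[dl, +oo[).
have hK : (nu `[dl, +oo[ <= K%:E)%E by rewrite fineK // ge0_fin_numE // levy_tail_fin.
have K0 : 0 <= K by rewrite fine_ge0.
pose C := (1 + 2 * B * K) / Y.
have C0 : 0 <= C by rewrite divr_ge0 ?(ltW Y0) // addr_ge0 // !mulr_ge0 // ltW.
exists C => // n x y x0 xy yY.
have der (z : R) : is_derive z 1 (fun t => C * t - Fn n t) (C - mesh_density P nu M (u n) z).
  have h := mesh_density_is_derive prm (u0 n) (u_fin n) (u_pos n) z.
  by apply: is_derive_eq; rewrite scaler1 //; ring.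
have := @derive_ge0_nondec _ (fun t => C * t - Fn n t) _ x y (fun z _ => der z).
have hle z : x <= z <= y -> 0 <= C - mesh_density P nu M (u n) z.
  move=> /andP[xz zy]; have z0 : 0 < z := lt_le_trans x0 xz.
  have zY : z <= Y := le_trans zy yY.
  have zB : z <= B by rewrite /B; lra.
  have := mesh_density_uniform prm nuL (u0 n) (u_pos n) B0 dl0 hdl hK z0 zB.
  have /andP[+ _] := mesh_density_bounds P M (u0 n) (u_fin n) (u_pos n) (ltW z0).
  rewrite subr_ge0 /C ler_pdivlMr // /B; move: (mesh_density _ _ _ _ _) => q.
  by move=> q0; apply: le_trans; rewrite mulrC ler_wpM2r //; lra.
by move=> /(_ hle xy); lra.
Qed.

(** F_n r <= F r <= F_n (r + h) + p_n by the two previous comparisons, and the common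
    Lipschitz constant makes F_n (r + h) - F_n r small with h. *)
Lemma mesh_cdf_cvg (r : R) : Fn n r @[n --> \oo] --> F r.
Proof.
have [r0|r0] := leP r 0.
  rewrite limit_cdf_le0 //; under eq_fun do rewrite (expint_cdf_le0 prm) //.
  exact: cvg_cst.
have [|C C0 hC] := @mesh_cdf_lipschitz (r + 1); first by rewrite addr_gt0.
apply/cvgrPdist_le => eps eps0.
pose h := Num.min 1 (eps / (2 * (C + 1))).
have C1 : 0 < 2 * (C + 1) by lra.
have h0 : 0 < h by rewrite lt_min ltr01 divr_gt0.
have h1 : h <= 1 by rewrite ge_min lexx.
have hC2 : C * h <= eps / 2.
  have : h * (2 * (C + 1)) <= eps by rewrite -ler_pdivlMr // ge_min lexx orbT.
  by nra.
have [p pcvg hp] := limit_cdf_le_mesh r h0.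
have /cvgrPdist_le/(_ (eps / 2)) := pcvg.
rewrite divr_gt0 // => /(_ isT) pn.
near=> n.
have : `|0 - p n| <= eps / 2 by near: n.
rewrite sub0r normrN => /(le_trans (ler_norm _)) pe.
rewrite ger0_norm ?subr_ge0 ?mesh_cdf_le_limit //.
have := hp n; have := hC n r (r + h) r0.
rewrite lerDl (ltW h0) lerD2l h1 => /(_ isT isT).
rewrite (_ : r + h - r = h); last by ring.
by lra.
Unshelve. all: by end_near. Qed.

Lemma limit_cdf_lipschitz (Y : R) : 0 < Y -> exists2 C : R, 0 <= C &
  forall x y : R, 0 < x -> x <= y -> y <= Y -> F y - F x <= C * (y - x).
Proof.
move=> Y0; have [C C0 hC] := mesh_cdf_lipschitz Y0; exists C => // x y x0 xy yY.
have h : Fn n y - Fn n x @[n --> \oo] --> F y - F x by apply: cvgB; exact: mesh_cdf_cvg.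
rewrite -(cvg_lim (@Rhausdorff R) h); apply: limr_le; first exact: cvgP h.
by apply: nearW => n; exact: hC.
Qed.

Lemma limit_cdf_continuous (x : R) : 0 < x -> {for x, continuous F}.
Proof.
move=> x0; have [|C C0 hC] := @limit_cdf_lipschitz (2 * x); first by rewrite mulr_gt0.
apply/cvgrPdist_le => eps eps0.
have C1 : 0 < C + 1 by lra.
near=> y.
have xy : `|x - y| <= eps / (C + 1).
  by near: y; apply: cvgr_dist_le => //; rewrite divr_gt0.
have xy2 : `|x - y| < x.
  by near: y; apply: cvgr_dist_lt => //.
rewrite ler_pdivlMr // in xy.
have [le|/ltW le] := leP x y.
- rewrite distrC ger0_norm ?subr_ge0 ?limit_cdf_nondec //.
  rewrite distrC ger0_norm ?subr_ge0 // in xy xy2.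
  apply: le_trans (hC _ _ x0 le _) _; first by lra.
  by nra.
- rewrite ger0_norm ?subr_ge0 ?limit_cdf_nondec //.
  rewrite ger0_norm ?subr_ge0 // in xy xy2.
  apply: le_trans (hC _ _ _ le _) _; [by lra|by lra|].
  by nra.
Unshelve. all: by end_near. Qed.

Lemma limit_cdf_cvg1 : F x @[x --> +oo] --> (1 : R).
Proof.
apply: (@squeeze_cvgr _ _ _ _ (Fn 0%N) (fun=> 1)).
- by apply: nearW => x; rewrite mesh_cdf_le_limit limit_cdf_le1.
- exact: (expint_cdf_cvg1 prm).
- exact: cvg_cst.
Qed.

Definition limit_density (x : R) : R := \int[nu]_(z in `]0, +oo[) (F (x * expR z) - F x).
Local Notation phi := limit_density.

(** For z <= 1 the Lipschitz bound gives a multiple of exp z - 1; for z > 1 the increment is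
    at most 1. The resulting dominating function is nu-integrable. *)
Lemma mesh_cdf_incr_le (Y : R) : 0 < Y -> exists2 D : R, 0 <= D &
  forall n (x z : R), 0 < x -> x <= Y -> 0 < z ->
    Fn n (x * expR z) - Fn n x <= D * Num.min z 1.
Proof.
move=> Y0; have e1 : 0 < expR 1 :> R := expR_gt0 1.
have [|C C0 hC] := @mesh_cdf_lipschitz (Y * expR 1); first by rewrite mulr_gt0.
exists (C * (Y * expR 1) + 1) => [|n x z x0 xY z0].
  by rewrite addr_ge0 // !mulr_ge0 // ltW.
have Y1 : 0 <= C * (Y * expR 1) by rewrite !mulr_ge0 // ltW.
have [z1|/ltW z1] := leP z 1.
  have ez1 : 1 <= expR z by rewrite -expR0 ler_expR ltW.
  have ez2 : expR z <= expR 1 by rewrite ler_expR.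
  have xz : x <= x * expR z by rewrite ler_peMr // ltW.
  have xzY : x * expR z <= Y * expR 1 by rewrite ler_pM // ltW // expR_gt0.
  apply: le_trans (hC n x _ x0 xz xzY) _.
  apply: (@le_trans _ _ (C * (Y * expR 1) * z)); last by rewrite ler_wpM2r ?lerDl // ltW.
  rewrite -mulrA ler_wpM2l // -{2}[x]mulr1 -mulrBr -mulrA.
  apply: ler_pM => //; [exact: ltW|by rewrite subr_ge0|].
  by apply: exp_sub1_le => //; exact: ltW.
rewrite mulr1.
have /andP[_ a] := expint_cdf01 P M (u0 n) (x * expR z).
have /andP[b _] := expint_cdf01 P M (u0 n) x.
by lra.
Qed.

Lemma limit_cdf_incr_le (Y : R) : 0 < Y -> exists2 D : R, 0 <= D &
  [/\ forall n (x z : R), 0 < x -> x <= Y -> 0 < z ->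
    Fn n (x * expR z) - Fn n x <= D * Num.min z 1 &
   forall x z : R, 0 < x -> x <= Y -> 0 < z ->
    F (x * expR z) - F x <= D * Num.min z 1].
Proof.
move=> Y0; have [D D0 hD] := mesh_cdf_incr_le Y0; exists D => //; split => // x z x0 xY z0.
have h : Fn n (x * expR z) - Fn n x @[n --> \oo] --> F (x * expR z) - F x.
  by apply: cvgB; exact: mesh_cdf_cvg.
rewrite -(cvg_lim (@Rhausdorff R) h); apply: limr_le; first exact: cvgP h.
by apply: nearW => n; exact: hD.
Qed.

Lemma limit_incr_ge0 (x z : R) : 0 < x -> 0 < z -> 0 <= F (x * expR z) - F x.
Proof.
move=> x0 z0; rewrite subr_ge0 limit_cdf_nondec // ler_peMr ?(ltW x0) //.
by rewrite -expR0 ler_expR ltW.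
Qed.

Lemma measurable_limit_incr (x : R) (D : set R) : 0 <= x ->
  measurable_fun D (fun z => F (x * expR z) - F x).
Proof.
move=> x0; apply: measurable_funTS; apply: measurable_funB => //.
apply: nondecreasing_measurable => // a b ab.
by apply: limit_cdf_nondec; rewrite ler_wpM2l // ler_expR.
Qed.

Let integrable_dominant (D : R) : nu.-integrable `]0, +oo[ (fun z => (D * Num.min z 1)%:E).
Proof.
have -> : (fun z => (D * Num.min z 1)%:E) = (fun z => D%:E * (Num.min z 1)%:E)%E :> (R -> \bar R).
  by apply/funext => z; rewrite EFinM.
by apply: integrableZl => //; exact: levy_min_integrable.
Qed.

Lemma integrable_limit_incr (x : R) : 0 < x ->
  nu.-integrable `]0, +oo[ (fun z => (F (x * expR z) - F x)%:E).
Proof.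
move=> x0; have [D D0 [_ hD]] := limit_cdf_incr_le x0.
apply: le_integrable (integrable_dominant D) => //.
  by apply/measurable_EFinP; apply: measurable_limit_incr; exact: ltW.
move=> z /=; rewrite in_itv /= andbT => z0; rewrite lee_fin.
by rewrite ger0_norm ?limit_incr_ge0 // (le_trans (hD x z x0 _ z0)) // ler_norm.
Qed.

Lemma limit_density_ereal (x : R) : 0 < x ->
  (phi x)%:E = (\int[nu]_(z in `]0%R, +oo[) (F (x * expR z) - F x)%:E)%E.
Proof.
move=> x0; rewrite /limit_density /Rintegral fineK //.
by apply: integrable_fin_num; [|exact: integrable_limit_incr].
Qed.

Lemma limit_density_ge0 (x : R) : 0 < x -> 0 <= phi x.
Proof.
move=> x0; apply: Rintegral_ge0 => z /=; rewrite in_itv /= andbT => z0.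
exact: limit_incr_ge0.
Qed.

(** The argument of F_n moves with n; the common Lipschitz constant controls the effect. *)
Lemma mesh_incr_cvg (x z : R) : 0 < x -> 0 < z ->
  Fn n (x * expR (quantize (u n) z)) - Fn n x @[n --> \oo] --> F (x * expR z) - F x.
Proof.
move=> x0 z0; apply: cvgB; last exact: mesh_cdf_cvg.
have xz0 : 0 < x * expR z by rewrite mulr_gt0 // expR_gt0.
have [C C0 hC] := mesh_cdf_lipschitz xz0.
have qz n : x * expR (quantize (u n) z) <= x * expR z.
  by rewrite ler_pM2l // ler_expR quantize_le.
apply: (@squeeze_cvgr _ _ _ _
  (fun n => Fn n (x * expR z) - C * (x * expR z - x * expR (quantize (u n) z)))
  (fun n => Fn n (x * expR z))).
- apply: nearW => n; rewrite expint_cdf_nondec ?qz // andbT.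
  rewrite lerBlDl -lerBlDr; apply: hC => //.
  by rewrite mulr_gt0 // expR_gt0.
- rewrite -[X in _ --> X]subr0; apply: cvgB; first exact: mesh_cdf_cvg.
  rewrite -[X in _ --> X](mulr0 C); apply: cvgM; first exact: cvg_cst.
  rewrite -(subrr (x * expR z)); apply: cvgB; first exact: cvg_cst.
  apply: cvgM; first exact: cvg_cst.
  apply: continuous_cvg; first exact: continuous_expR.
  exact: cvg_quantize.
- exact: mesh_cdf_cvg.
Qed.

(** Dominated convergence in the integral that defines the densities. *)
Lemma mesh_density_cvg (x : R) : 0 < x ->
  mesh_density P nu M (u n) x @[n --> \oo] --> phi x.
Proof.
move=> x0; have [D D0 [hD _]] := limit_cdf_incr_le x0.
suff : (mesh_density P nu M (u n) x)%:E @[n --> \oo] --> (phi x)%:E.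
  by move/fine_cvgP => [].
rewrite limit_density_ereal //.
under eq_fun do rewrite mesh_density_ereal ?(ltW x0) //.
apply: (@dominated_cvg_ae _ _ _ nu _ _ _ (fun z => (D * Num.min z 1)%:E)) => //.
- by move=> n; exact: measurable_mesh_incr.
- by apply/measurable_EFinP; apply: measurable_limit_incr; exact: ltW.
- apply: aeW => z; rewrite /= in_itv /= andbT => z0.
  apply: cvg_EFin; first by near=> n.
  exact: mesh_incr_cvg.
- apply: aeW => z n; rewrite /= in_itv /= andbT => z0; rewrite lee_fin.
  rewrite ger0_norm ?mesh_incr_ge0 ?(ltW x0) ?(ltW z0) //.
  apply: le_trans (hD n x z x0 _ z0) => //; rewrite lerD2r expint_cdf_nondec //.
  by rewrite ler_pM2l // ler_expR quantize_le.
Unshelve. all: by end_near. Qed.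

Lemma limit_density_continuous (x : R) : 0 < x -> {for x, continuous phi}.
Proof.
move=> x0; have x2 : 0 < 2 * x by rewrite mulr_gt0.
have [D D0 [_ hD]] := limit_cdf_incr_le x2.
have sub (y : R) : (`](x / 2), (2 * x)[ : set R) y -> 0 < y /\ y <= 2 * x.
  rewrite /= in_itv /= => /andP[h1 h2]; split; last exact: ltW.
  by apply: lt_trans h1; rewrite divr_gt0.
apply: (@continuity_under_integral _ _ _ nu (fun y z => F (y * expR z) - F y)
  `]0, +oo[ _ (x / 2) (2 * x) _ _ (fun z => D * Num.min z 1)) => //.
- by move=> y /sub[y0 _]; exact: integrable_limit_incr.
- apply: aeW => z _ y; rewrite inE => /sub[y0 _].
  apply: cvgB; last exact: limit_cdf_continuous.
  have cF : {for y * expR z, continuous F}.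
    by apply: limit_cdf_continuous; rewrite mulr_gt0 // expR_gt0.
  have cm : t * expR z @[t --> y] --> y * expR z.
    by apply: cvgM; [exact: cvg_id|exact: cvg_cst].
  exact: cvg_comp cm cF.
- exact: integrable_dominant.
- move=> y /sub[y0 y2]; apply: aeW => z; rewrite /= in_itv /= andbT => z0.
  by rewrite ger0_norm ?limit_incr_ge0 // hD.
- by rewrite inE /= in_itv /=; lra.
Qed.

(** The fundamental theorem of calculus for F_n, in the limit; the densities are bounded on
    [x, y] by the integral of the dominating function. *)
Lemma limit_density_primitive (x y : R) : 0 < x -> x < y ->
  (\int[@lebesgue_measure R]_(t in `[x, y]) (phi t)%:E = (F y - F x)%:E)%E.
Proof.
move=> x0 xy; have y0 : 0 < y := lt_trans x0 xy.
have [D D0 [hD _]] := limit_cdf_incr_le y0.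
pose m := \int[nu]_(z in `]0, +oo[) (D * Num.min z 1).
have pos (t : R) : (`[x, y] : set R) t -> 0 < t /\ t <= y.
  by rewrite /= in_itv /= => /andP[h1 h2]; split => //; exact: lt_le_trans h1.
have h1 : (\int[@lebesgue_measure R]_(t in `[x, y])
    (mesh_density P nu M (u n) t)%:E)%E @[n --> \oo] -->
    (\int[@lebesgue_measure R]_(t in `[x, y]) (phi t)%:E)%E.
  apply: (@dominated_cvg_ae _ _ _ (@lebesgue_measure R) _ _ _ (cst m%:E)) => //.
  - move=> n; apply/measurable_EFinP; apply: measurable_funTS.
    by apply: continuous_measurable_fun; exact: mesh_density_continuous.
  - apply/measurable_EFinP; apply: (@measurable_funS _ _ _ _ (`]0, +oo[ : set R)) => //.
      by move=> t /pos[t0 _]; rewrite /= in_itv /= andbT.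
    apply: open_continuous_measurable_fun; first exact: interval_open.
    by move=> t; rewrite inE /= in_itv /= andbT => t0; exact: limit_density_continuous.
  - apply: aeW => t /pos[t0 _]; apply: cvg_EFin; first by near=> n.
    exact: mesh_density_cvg.
  - apply: (@continuous_compact_integrable _ (cst m)); first exact: segment_compact.
    by apply: continuous_subspaceT => ?; exact: cst_continuous.
  - apply: aeW => t n /pos[t0 ty]; rewrite lee_fin.
    have /andP[q0 _] := mesh_density_bounds P M (u0 n) (u_fin n) (u_pos n) (ltW t0).
    rewrite ger0_norm // -lee_fin mesh_density_ereal ?(ltW t0) //.
    rewrite /m /Rintegral fineK; last by apply: integrable_fin_num.
    apply: ge0_le_integral => //.
    + move=> z /=; rewrite in_itv /= andbT => z0.
      by rewrite lee_fin mesh_incr_ge0 ?ltW.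
    + exact: measurable_mesh_incr.
    + by have /integrableP[] := integrable_dominant D.
    + move=> z /=; rewrite in_itv /= andbT => z0; rewrite lee_fin.
      apply: le_trans (hD n t z t0 ty z0); rewrite lerD2r expint_cdf_nondec //.
      by rewrite ler_pM2l // ler_expR quantize_le.
apply: (cvg_unique (@ereal_hausdorff R) h1).
have -> : (fun n => \int[@lebesgue_measure R]_(t in `[x, y])
    (mesh_density P nu M (u n) t)%:E)%E = (fun n => (Fn n y - Fn n x)%:E).
  by apply/funext => n; exact: mesh_density_primitive.
apply: cvg_EFin; first by near=> n.
by apply: cvgB; exact: mesh_cdf_cvg.
Unshelve. all: by end_near. Qed.

Lemma limit_density_pdf : continuous_pdf P I phi.
Proof.
apply: (@continuous_pdf_of_cdf _ _ _ P I F) => //.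
- exact: limit_cdfE.
- exact: limit_cdf_le0.
- exact: limit_cdf_cvg1.
- exact: limit_density_continuous.
- exact: limit_density_ge0.
- exact: limit_density_primitive.
Qed.

End limit_cdf.

(** * The exponential functional of the subordinator *)

Section exponential_functional.
Context {R : realType} {d} {T : measurableType d} (P : probability T R).
Variable X : R -> {RV P >-> R}.
Hypothesis X_sub : subordinator X.
Local Notation I := (exp_functional (fun t w => (X t w)%:E)).

Let X_ge0 (t : R) w : 0 <= t -> 0 <= X t w.
Proof. by move=> t0; case: X_sub => X0 Xle _ _ _; rewrite -(X0 w) Xle. Qed.

(** Monotonicity is known at nonnegative times only, whence the clamping of time at 0. *)
Let pathE w : I w = (\int[@lebesgue_measure R]_(t in `[0%R, +oo[)
  expeR (- (X (Num.max t 0) w)%:E))%E.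
Proof.
apply: eq_integral => t; rewrite inE /= in_itv /= andbT => t0.
by rewrite max_l.
Qed.

Let clamp_ge0 (t : R) w : (0 <= (X (Num.max t 0) w)%:E)%E.
Proof. by rewrite lee_fin X_ge0 // le_max lexx orbT. Qed.

Let clamp_measurable (t : R) : measurable_fun setT (fun w => (X (Num.max t 0) w)%:E).
Proof. by apply/measurable_EFinP. Qed.

Let clamp_nondec (t s : R) w : 0 <= t -> t <= s ->
  ((X (Num.max t 0) w)%:E <= (X (Num.max s 0) w)%:E)%E.
Proof.
move=> t0 ts; rewrite lee_fin !max_l // ?(le_trans t0) //.
by case: X_sub => _ Xle _ _ _; exact: Xle.
Qed.

Lemma measurable_exp_functional : measurable_fun setT I.
Proof.
rewrite (funext pathE).
by apply: measurable_exp_integral => [??|?|???? ?]; [exact: clamp_ge0|exact: clamp_measurable|exact: clamp_nondec].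
Qed.

Lemma measurable_path w :
  measurable_fun (`[0%R, +oo[ : set R) (fun t => expeR (- (X t w)%:E)).
Proof.
have mZ : measurable_fun (`[0%R, +oo[ : set R) (fun t => expeR (- (X (Num.max t 0) w)%:E)).
  apply: (@measurable_exp_path _ _ _ _ (fun t w => (X (Num.max t 0) w)%:E)) => [??|???? ?].
    exact: clamp_ge0.
  exact: clamp_nondec.
apply: eq_measurable_fun mZ => t.
by rewrite inE /= in_itv /= andbT => t0; rewrite max_l.
Qed.

(** On [0, 1] the path stays below its value at time 1. *)
Lemma exp_functional_gt0 w : (0 < I w)%E.
Proof.
apply: (@lt_le_trans _ _ (expR (- X 1 w))%:E); first by rewrite lte_fin expR_gt0.
have s01 : (`[0%R, 1%R] : set R) `<=` `[0%R, +oo[.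
  by move=> t /=; rewrite !in_itv /= andbT => /andP[].
apply: (@le_trans _ _ (\int[@lebesgue_measure R]_(t in `[0%R, 1%R]) expeR (- (X t w)%:E))%E);
  last first.
  apply: ge0_subset_integral => //; first exact: measurable_path.
  by move=> t _; exact: expeR_ge0.
have <- : (\int[@lebesgue_measure R]_(t in `[0%R, 1%R]) (expR (- X 1 w))%:E)%E = (expR (- X 1 w))%:E.
  have l01 : @lebesgue_measure R `[0%R, 1%R] = 1%E.
    by rewrite lebesgue_measure_itv /= lte_fin ltr01 oppr0 adde0.
  by rewrite integral_cst //= l01 mule1.
apply: ge0_le_integral => //.
- by apply: (@measurable_funS _ _ _ _ (`[0, +oo[ : set R)) => //; exact: measurable_path.
- move=> t /=; rewrite in_itv /= => /andP[t0 t1].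
  rewrite lee_fin ler_expR lerN2.
  by case: X_sub => _ Xle _ _ _; exact: Xle.
Qed.

Context (nu : {sigma_finite_measure set R -> \bar R}).
Variable M : R.-ker T ~> (R * R)%type.
Hypothesis prm : poisson_random_measure P M (jump_intensity nu).
Hypothesis X_jumps : {ae P, forall w, forall t : R, 0 <= t ->
  (X t w)%:E = jump_integral M `]0, +oo[ id t w}.

(** No jump occurs at time 0, so the closed and half-open time intervals carry the same
    jumps. *)
Lemma jumps_ae : {ae P, forall w, forall t : R, 0 <= t -> jumps M t w = (X t w)%:E}.
Proof.
apply: filterS2 X_jumps (no_jump_at0_ae prm) => w h w0 t t0.
by rewrite h // jump_integral_open // => z /=; rewrite in_itv /= andbT => /ltW.
Qed.

Let jumps_exp w : (forall t : R, 0 <= t -> jumps M t w = (X t w)%:E) ->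
  I w = (\int[@lebesgue_measure R]_(t in `[0%R, +oo[) expeR (- jumps M t w))%E /\
  measurable_fun (`[0%R, +oo[ : set R) (fun t => expeR (- jumps M t w)).
Proof.
move=> h; split.
  by apply: eq_integral => t; rewrite inE /= in_itv /= andbT => t0; rewrite h.
apply: eq_measurable_fun (measurable_path w) => t.
by rewrite inE /= in_itv /= andbT => t0; rewrite h.
Qed.

Lemma exp_functional_le_expint (u : nat -> R) : (forall n, 0 < u n) ->
  {ae P, forall w n, (I w <= expint M (u n) 0%R w)%E}.
Proof.
move=> u0; apply: filterS jumps_ae => w /jumps_exp[-> mj] n.
apply: ge0_le_integral => //.
- by move=> t _; exact: expeR_ge0.
- by apply: measurable_exp_path => [??|???? ?]; [exact: level_ge0|exact: level_nondec].
- by move=> t _; rewrite lee_expeR leeN2 level_le_jumps.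
Qed.

Lemma expint_cvg_exp_functional (u : nat -> R) (e0 : R) : (forall n, 0 < u n) ->
  u n @[n --> \oo] --> (0 : R) -> (forall n, u n <= e0) ->
  (0 < nu `[e0, +oo[)%E -> (nu `[e0, +oo[ < +oo)%E ->
  {ae P, forall w, expint M (u n) 0%R w @[n --> \oo] --> I w}.
Proof.
move=> u0 u_cvg ue0 nu_pos nu_fin.
have e00 : 0 < e0 := lt_le_trans (u0 0%N) (ue0 0%N).
have e02 : 0 < e0 / 2 by rewrite divr_gt0.
apply: filterS2 jumps_ae (count_exp_integral_ae prm e00 e02 nu_fin nu_pos) => w h fin.
have [-> mj] := jumps_exp h.
by apply: (cvg_expint u0 u_cvg ue0) => // t t0; rewrite h // ltry.
Qed.

End exponential_functional.

Lemma tail_gt0 {R : realType} (nu : {sigma_finite_measure set R -> \bar R}) :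
  nu `]0, +oo[ <> 0%E -> exists2 e : R, 0 < e & (0 < nu `[e, +oo[)%E.
Proof.
move=> nu0; apply: contrapT => h; apply: nu0.
pose A (n : nat) : set R := `[n.+1%:R^-1, +oo[.
have A0 n : nu (A n) = 0%E.
  apply/eqP; rewrite eq_le measure_ge0 andbT leNgt; apply/negP => An; apply: h.
  by exists n.+1%:R^-1.
have UA : \bigcup_n A n = `]0, +oo[.
  apply/seteqP; split => [z [n _]|z]; rewrite /A /= !in_itv /= !andbT.
    by apply: lt_le_trans; rewrite invr_gt0.
  move=> z0; near \oo => n; exists n => //; rewrite /A /= in_itv /= andbT ltW //.
  by near: n; exact: (near_infty_natSinv_lt (PosNum z0)).
have : nu (A n) @[n --> \oo] --> nu (\bigcup_n A n).
  apply: nondecreasing_cvg_mu => //; first by move=> n; exact: measurable_itv.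
    by rewrite UA.
  move=> m n mn; apply/subsetPset => z; rewrite /A /= !in_itv /= !andbT.
  by apply: le_trans; rewrite lef_pV2 ?posrE // ler_nat.
under eq_fun do rewrite A0.
rewrite UA => /(cvg_lim (@ereal_hausdorff R)) <-.
by rewrite lim_cst.
Unshelve. all: by end_near. Qed.

Theorem theoremA4 (R : realType) (d : measure_display) (T : measurableType d)
  (P : probability T R)
  (nu : {sigma_finite_measure set R -> \bar R})
  (X : R -> {RV P >-> R})
  (M : R.-ker T ~> (R * R)%type)
  (c : R -> nat -> R)
  (nu_neq0 : nu `]0, +oo[ <> 0%E)
  (X_sub : pure_jump_subordinator X nu)
  (M_prm : poisson_random_measure P M (jump_intensity nu))
  (X_jumps : {ae P, forall w, forall t : R, 0 <= t ->
     (X t w)%:E = jump_integral M `]0, +oo[ id t w})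
  (c_coef : forall e, rational01 e -> density_coefficients nu e (c e)) :
  exists (phi : R -> R) (phi_ : R -> R -> R),
  [/\ continuous_pdf P (exp_functional (fun t w => (X t w)%:E)) phi,
      forall e, rational01 e -> (0 < nu `[e, +oo[)%E ->
        continuous_pdf P (exp_functional (discretized_process M e)) (phi_ e),
      forall x : R, 0 < x ->
        phi_ e x @[e --> within (@rational01 R) (nbhs (0 : R))] --> phi x
    & forall e, rational01 e -> (0 < nu `[e, +oo[)%E ->
        [/\ cvgn (series (norm_term e (c e))),
            forall x : R, 0 < x -> cvgn (series (density_term nu e (c e) x))
          & forall x : R, 0 < x -> phi_ e x = density_formula nu e (c e) x]].
Proof.
have [subX nuL _] := X_sub.
have [e0 e00 tail0] := tail_gt0 nu_neq0.
have nu_fin (e : R) : 0 < e -> (nu `[e, +oo[ < +oo)%E := @levy_tail_fin _ _ nuL e.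
have tail_le (e : R) : e <= e0 -> (0 < nu `[e, +oo[)%E.
  move=> ee0; apply: lt_le_trans tail0 _; apply: le_measure; rewrite ?inE //.
  by move=> z /=; rewrite !in_itv /= !andbT; exact: le_trans.
have mI := measurable_exp_functional subX.
have I_gt0 := exp_functional_gt0 subX.
pose I := exp_functional (fun t w => (X t w)%:E).
have I_le (u : nat -> R) (u0 : forall n, 0 < u n) :=
  exp_functional_le_expint subX M_prm X_jumps u0.
have I_cvg (u : nat -> R) (u0 : forall n, 0 < u n) (uc : u n @[n --> \oo] --> (0 : R))
    (ue : forall n, u n <= e0) :=
  expint_cvg_exp_functional subX M_prm X_jumps u0 uc ue tail0 (nu_fin _ e00).
exists (limit_density P nu I), (fun e => mesh_density P nu M e); split.
- pose u (n : nat) : R := e0 * n.+1%:R^-1.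
  have u0 n : 0 < u n by rewrite mulr_gt0.
  have ue n : u n <= e0 by rewrite ler_piMr ?(ltW e00) // invf_le1 // ler1n.
  have uc : u n @[n --> \oo] --> (0 : R).
    by rewrite -[X in _ --> X](mulr0 e0); apply: cvgM; [exact: cvg_cst|exact: cvg_harmonic].
  have up n : (0 < nu `[u n, +oo[)%E := tail_le _ (ue n).
  exact: (limit_density_pdf M_prm nuL u0 uc up mI I_gt0 (I_le u u0) (I_cvg u u0 uc ue)).
- move=> e [+ _] ep; rewrite /= in_itv /= => /andP[e_gt0 _].
  by apply: mesh_density_pdf => //; exact: nu_fin.
- move=> x x0.
  suff lim : mesh_density P nu M e x @[e --> (0 : R)^'+] --> limit_density P nu I x.
    apply: cvg_trans lim; apply: cvg_app => A [r /= r0 hr].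
    exists r => //= e er [+ _]; rewrite /= in_itv /= => /andP[e_gt0 _].
    exact: hr.
  (* The right limit at 0 over all real meshes implies the one over rational meshes. *)
  apply/cvg_at_rightP => v [v0 vc].
  have [N _ hN] : \forall n \near \oo, v n <= e0.
    have /cvgrPdist_le/(_ e0 e00) := vc; apply: filterS => n /=.
    by rewrite sub0r normrN; apply: le_trans; exact: ler_norm.
  rewrite -(cvg_shiftn N).
  pose u n := v (n + N)%N.
  have u0 n : 0 < u n := v0 _.
  have ue n : u n <= e0 by apply: hN => /=; rewrite leq_addl.
  have uc : u n @[n --> \oo] --> (0 : R) by rewrite /u (cvg_shiftn N).
  have up n : (0 < nu `[u n, +oo[)%E := tail_le _ (ue n).
  exact: (mesh_density_cvg M_prm nuL u0 uc up mI I_gt0 (I_le u u0) (I_cvg u u0 uc ue) x0).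
- move=> e er ep; move: (er) => [+ _]; rewrite /= in_itv /= => /andP[e_gt0 _].
  by apply: (mesh_density_formula M_prm e_gt0 (nu_fin _ e_gt0) ep); exact: c_coef.
Qed.
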